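(* Let $T$ be a canonical theory in a language $\mathcal L$, let $k=\max\{k(P):P\in\mathcal L\}$, and let $\mathcal N,\mathcal N'$ be two weak $T$-ons. The following are equivalent. (1) $p(M,\mathcal N)=p(M,\mathcal N')$ for every finite model $M$ of $T$. (2) There exist families $f=(f_1,\dots,f_k)$ and $g=(g_1,\dots,g_k)$ of symmetric functions measure preserving on the highest order argument, $f_d,g_d:\mathcal E_d\to[0,1]$, and a weak $T$-on $\mathcal N''$ such that for every $P\in\mathcal L$ and almost every $x\in\mathcal E_{k(P)}$, $x\in\mathcal N''_P\iff\widehat f_{k(P)}(x)\in\mathcal N_P\iff\widehat g_{k(P)}(x)\in\mathcal N'_P$.
   Context: A language $\mathcal L$ is a finite set of predicate symbols with arities $k(P)\ge1$ (no constants/function symbols); a universal theory is a set of axioms $\forall\vec xF(\vec x)$, $F$ open; structures have a vertex set $V(M)$ and relations $R_{P,M}\subseteq V(M)^{k(P)}$. $T$ is canonical if it entails $x_i=x_j\to\neg P(x_1,\dots,x_k)$ for every $P$ of arity $k$, $i<j$; a structure is canonical if no relation contains a tuple with repeated entries. $r(V)$: non-empty finite subsets of $V$; $\mathcal E_V=[0,1]^{r(V)}$ with Lebesgue measure $\lambda$; $\mathcal E_d=\mathcal E_{[d]}$; for injective $\alpha:[d]\to V$, $\alpha^*(x)_A=x_{\alpha(A)}$. A Euclidean structure $\mathcal N$ assigns to each $P$ a Lebesgue measurable $\mathcal N_P\subseteq\mathcal E_{k(P)}$. For finite $M$, $R_P(M)$ (resp. $\overline R_P(M)$) is the set of injections $\alpha:[k(P)]\to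 V(M)$ with $(\alpha(1),\dots)\in R_{P,M}$ (resp. $\notin$), $T_{\mathrm{ind}}(M,\mathcal N)=\bigcap_P\big(\bigcap_{\alpha\in R_P(M)}(\alpha^* )^{-1}(\mathcal N_P)\cap\bigcap_{\alpha\in\overline R_P(M)}(\alpha^* )^{-1}(\mathcal E_{k(P)}\setminus\mathcal N_P)\big)$, $p(M,\mathcal N)=\frac{|V(M)|!}{|\mathrm{Aut}(M)|}\lambda(T_{\mathrm{ind}}(M,\mathcal N))$. A weak $T$-on is a Euclidean structure with $\lambda(T_{\mathrm{ind}}(M,\mathcal N))=0$ for every finite canonical structure $M$ not a model of $T$. The symmetric group $S_V$ acts on $\mathcal E_V$ by $(x\cdot\sigma)_A=x_{\sigma(A)}$; $f:\mathcal E_V\to[0,1]$ is symmetric if invariant under this action. Let $r(V)^*=r(V)\setminus\{V\}$, $\mathcal E_V^*=[0,1]^{r(V)^*}$, so $\mathcal E_V=\mathcal E^*_V\times[0,1]$. $f$ is measure preserving on the highest order argument if it is measurable and for every $x^*\in\mathcal E_V^*$ the map $y\mapsto f(x^*,y)$, $[0,1]\to[0,1]$, is measure preserving. For a family $f=(f_1,\dots,f_k)$ of symmetric $f_d:\mathcal E_d\to[0,1]$, define $\widehat f_d:\mathcal E_d\to\mathcal E_d$ by $\widehat f_d(x)_A=f_{|A|}(\alpha_A^*(x))$ for $A\in r([d])$, where $\alpha_A:[|A|]\to[d]$ is the increasing enumeration of $A$. *)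

(* Defs.v *)
From HB Require Import structures.
From mathcomp Require Import all_boot all_order all_algebra perm.
From mathcomp Require Import all_classical all_reals all_analysis.

Set Implicit Arguments.
Unset Strict Implicit.
Unset Printing Implicit Defensive.

Import Order.TTheory GRing.Theory Num.Theory.
Import numFieldNormedType.Exports.

Local Open Scope classical_set_scope.
Local Open Scope ring_scope.

Record language := Language {
  symbol :> finType;
  arity : symbol -> nat;
  arity_gt0 : forall P, (0 < arity P)%N }.

Definition max_arity (L : language) : nat := \max_(P : L) arity P.

(* Every atom contains a variable, so the universal closure of an open formula
   holds vacuously in the empty structure. *)
Inductive open_formula (L : language) :=
| OEq of nat & nat
| OPred (P : L) of 'I_(arity P) -> nat
| ONot of open_formula L
| OAnd of open_formula L & open_formula L
| OOr of open_formula L & open_formula L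
| OImp of open_formula L & open_formula L.

Arguments OEq {L}.
Arguments OPred {L}.

(* An open formula in the set stands for its universal closure. *)
Definition universal_theory (L : language) := set (open_formula L).

(* V^k is represented by ['I_k -> V]. *)
Definition structure_on (L : language) (V : Type) :=
  forall P : L, set ('I_(arity P) -> V).

Fixpoint sat (L : language) (V : Type) (M : structure_on L V) (e : nat -> V)
    (F : open_formula L) : Prop :=
  match F with
  | OEq i j => e i = e j
  | OPred P v => M P (fun l => e (v l))
  | ONot G => ~ sat M e G
  | OAnd G H => sat M e G /\ sat M e H
  | OOr G H => sat M e G \/ sat M e H
  | OImp G H => sat M e G -> sat M e H
  end.

Definition holds (L : language) (V : Type) (M : structure_on L V)
  (F : open_formula L) := forall e : nat -> V, sat M e F.

Definition is_model (L : language) (T : universal_theory L) (V : Type)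
  (M : structure_on L V) := forall F, T F -> holds M F.

Definition entails (L : language) (T : universal_theory L) (F : open_formula L) :=
  forall (V : Type) (M : structure_on L V), is_model T M -> holds M F.

Definition canonical_theory (L : language) (T : universal_theory L) :=
  forall (P : L) (i j : 'I_(arity P)), (i < j)%N ->
    entails T (OImp (OEq i j) (ONot (OPred P (fun l => l)))).

Definition canonical_structure (L : language) (V : Type) (M : structure_on L V) :=
  forall (P : L) (a : 'I_(arity P) -> V), M P a -> injective a.

Definition is_automorphism (L : language) (V : finType) (M : structure_on L V)
  (s : {perm V}) :=
  forall (P : L) (a : 'I_(arity P) -> V), M P (s \o a) <-> M P a.

Definition automorphisms (L : language) (V : finType) (M : structure_on L V) :
  {set {perm V}} := [set s | `[< is_automorphism M s >]]%SET.

HB.instance Definition _ (R : realType) := isPointed.Build {i01 R} 0%:i01.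

Section image_ext.
Context d (T : measurableType d) (R : realType) (mu : {measure set T -> \bar R}).
Context (X : Type) (j : X -> T).
Local Open Scope ereal_scope.

(* Outer measure of [S], seen as a subset of [T] through the embedding [j]. *)
Definition image_ext (S : set X) : \bar R := (mu^*)%mu (j @` S).

Let image_ext0 : image_ext set0 = 0.
Proof. by rewrite /image_ext image_set0; exact: outer_measure0. Qed.

Let image_ext_ge0 S : 0 <= image_ext S.
Proof. exact: outer_measure_ge0. Qed.

Let le_image_ext : {homo image_ext : A B / A `<=` B >-> A <= B}.
Proof. by move=> A B AB; apply: le_outer_measure; exact: image_subset. Qed.

Let image_ext_subadditive : sigma_subadditive image_ext.
Proof.
by move=> F; rewrite /image_ext image_bigcup;
  exact: outer_measure_sigma_subadditive.
Qed.

HB.instance Definition _ := isOuterMeasure.Build R X image_ext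
  image_ext0 image_ext_ge0 le_image_ext image_ext_subadditive.

End image_ext.

Section unif_tuple.
Context (R : realType).

Local Notation mR := (measurableTypeR R).

Definition tuple_cons n (p : mR * n.-tuple mR) : n.+1.-tuple mR :=
  [tuple of p.1 :: p.2].

Let measurable_tuple_cons n : measurable_fun setT (@tuple_cons n).
Proof. exact: measurable_cons. Qed.

HB.instance Definition _ n :=
  @isMeasurableFun.Build _ _ _ _ (@tuple_cons n) (@measurable_tuple_cons n).

Fixpoint unif_tuple n : probability (n.-tuple mR) R :=
  match n with
  | 0 => \d_([tuple])
  | m.+1 => distribution (uniform_prob (@ltr01 R) \x unif_tuple m)%E (@tuple_cons m)
  end.

Lemma measurable_box n (B : 'I_n -> set mR) :
  (forall i, measurable (B i)) ->
  measurable [set t : n.-tuple mR | forall i, B i (tnth t i)].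
Proof.
move=> mB.
rewrite (_ : [set _ | _] = \bigcap_(i in [set: 'I_n]) ((@tnth n mR)^~ i @^-1` B i)); last first.
  by apply/seteqP; split=> t /= h i; [move=> _; exact: h| exact: (h i I)].
apply: fin_bigcap_measurable => [|i _]; first exact: finite_finset.
by rewrite -[X in measurable X]setTI; exact: (measurable_tnth i measurableT (mB i)).
Qed.

Lemma unif_tuple_box n (B : 'I_n -> set mR) :
  (forall i, measurable (B i)) ->
  unif_tuple n [set t | forall i, B i (tnth t i)] =
  (\prod_(i < n) uniform_prob (@ltr01 R) (B i))%E.
Proof.
elim: n B => [|n IH] B mB.
  by rewrite big_ord0 /= diracE mem_set// => -[].
rewrite big_ord_recl /=.
rewrite -IH; last by move=> i; exact: mB.
rewrite /distribution /pushforward.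
rewrite (_ : _ @^-1` _ = B ord0 `*` [set t : n.-tuple mR | forall i, B (lift ord0 i) (tnth t i)]).
  rewrite product_measure1E; [by []|exact: mB|].
  by apply: (@measurable_box n (fun i => B (lift ord0 i))) => i; exact: mB.
apply/seteqP; split=> -[x t] /=.
  move=> h; split; first exact: (h ord0).
  by move=> i; have := h (lift ord0 i); rewrite tnthS.
by move=> [h0 h] i; have [j ->|->//] := unliftP ord0 i; rewrite /= tnthS.
Qed.

End unif_tuple.

Section cube_measure.
Context (R : realType).

Definition cube (I : finType) := I -> {i01 R}.

HB.instance Definition _ (I : finType) := Pointed.on (cube I).

Definition cube_coords (I : finType) (x : cube I) : #|I|.-tuple R :=
  [tuple (x (enum_val i))%:num | i < #|I|].

(* As outer measures, [lebesgue_cube] and [lebesgue_i01] are complete: their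
   Caratheodory measurable sets are the Lebesgue measurable ones, not only the
   Borel ones. *)
Definition lebesgue_cube (I : finType) : {outer_measure set (cube I) -> \bar R} :=
  image_ext (unif_tuple R #|I|) (@cube_coords I).

Lemma lebesgue_cube_box (I : finType) (B : I -> set R) :
  (forall i, measurable (B i)) ->
  lebesgue_cube I [set x | forall i, B i (x i)%:num] =
  (\prod_(i : I) lebesgue_measure (B i `&` `[0%R, 1%R]))%E.
Proof.
move=> mB.
pose B' (i : 'I_#|I|) : set (measurableTypeR R) := B (enum_val i) `&` `[0%R, 1%R].
have mB' i : measurable (B' i) by apply: measurableI; [exact: mB|exact: measurable_itv].
have -> : lebesgue_cube I [set x | forall i, B i (x i)%:num] =
  (((unif_tuple R #|I|)^*)%mu [set t | forall i, B' i (tnth t i)]).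
  rewrite /lebesgue_cube /= /image_ext; apply: (congr1 (mu_ext (unif_tuple R #|I|))).
  apply/seteqP; split=> [_ [x /= hx <-] i|t /= ht].
    rewrite /cube_coords tnth_mktuple; split; first exact: hx.
    by rewrite /= in_itv/=; apply/andP; split.
  have h i : 0 <= tnth t i <= 1 by have [_] := ht i; rewrite /= in_itv.
  pose x (i : I) : {i01 R} := Itv01 (proj1 (andP (h (enum_rank i)))) (proj2 (andP (h (enum_rank i)))).
  exists x.
    by move=> i; have [] := ht (enum_rank i); rewrite enum_rankK.
  by apply: eq_from_tnth => i; rewrite tnth_mktuple /= enum_valK.
rewrite measurable_mu_extE; last exact: (measurable_box mB').
apply: (etrans (unif_tuple_box mB')).
rewrite [RHS](@reindex _ _ _ _ _ (@enum_val I (mem I))) /=; last first.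
  by exists enum_rank => i _; rewrite ?enum_valK ?enum_rankK.
apply: eq_bigr => i _; rewrite /uniform_prob integral_uniform_pdf /B' -setIA setIid.
rewrite (eq_integral (cst 1%E)); last first.
  by move=> x; rewrite inE /= /uniform_pdf in_itv/= => -[_ ->]; rewrite subr0 invr1.
rewrite integral_cst ?mul1e//.
by apply: measurableI; [exact: mB|exact: measurable_itv].
Qed.

Definition lebesgue_i01 : {outer_measure set {i01 R} -> \bar R} :=
  image_ext (@lebesgue_measure R) (fun y : {i01 R} => y%:num).

Definition cube_measurable (I : finType) (S : set (cube I)) :=
  (lebesgue_cube I).-cara.-measurable S.

Definition measurable_to_i01 (I : finType) (f : cube I -> {i01 R}) :=
  measurable_fun [set: caratheodory_type (lebesgue_cube I)]
    (fun x => (f x)%:num : R).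

Definition measure_preserving_i01 (h : {i01 R} -> {i01 R}) :=
  measurable_fun [set: caratheodory_type lebesgue_i01]
    (fun y => (h y)%:num : R) /\
  forall B : set R, measurable B ->
    lebesgue_i01 [set y | B (h y)%:num] = lebesgue_i01 [set y | B y%:num].

Definition ae_cube (I : finType) (Q : cube I -> Prop) :=
  {ae (lebesgue_cube I : set (caratheodory_type (lebesgue_cube I)) -> \bar R),
    forall x, Q x}.

End cube_measure.

Definition r (V : finType) : finType := {A : {set V} | A != finset.set0}.

Definition rstar (V : finType) : finType := {A : r V | val A != [set: V]%SET}.

Lemma imset_r_subproof (U V : finType) (a : U -> V) (A : r U) :
  a @: val A != finset.set0.
Proof. by case: A => A A0 /=; rewrite imset_eq0. Qed.

Definition imset_r (U V : finType) (a : U -> V) (A : r U) : r V :=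
  Sub (a @: val A) (imset_r_subproof a A).

Section euclidean.
Context (R : realType).

Definition E (V : finType) := cube R (r V).
Definition Estar (V : finType) := cube R (rstar V).

(* [pullback a] is a^* when [a] is injective, and the action of [a] on [E V]
   when [a] is a permutation of [V]. *)
Definition pullback (U V : finType) (a : U -> V) (x : E V) : E U :=
  fun A => x (imset_r a A).

(* The identification of E_V^* x [0,1] with E_V (V nonempty). *)
Definition E_pair (V : finType) (xs : Estar V) (y : {i01 R}) : E V :=
  fun A => if insub A is Some B then xs B else y.

Record euclidean_structure (L : language) := EuclideanStructure {
  eset :> forall P : L, set (E 'I_(arity P));
  eset_measurable : forall P, cube_measurable (@eset P) }.

Arguments eset {L} _ P _.

Definition R_in (L : language) (V : finType) (M : structure_on L V) (P : L) :
  set ('I_(arity P) -> V) := [set a | injective a /\ M P a].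

Definition R_out (L : language) (V : finType) (M : structure_on L V) (P : L) :
  set ('I_(arity P) -> V) := [set a | injective a /\ ~ M P a].

Arguments R_in {L V} M P _.
Arguments R_out {L V} M P _.

Definition Tind (L : language) (V : finType) (M : structure_on L V)
    (N : euclidean_structure L) : set (E V) :=
  \bigcap_(P in [set: L])
    ((\bigcap_(a in R_in M P) (pullback a @^-1` N P)) `&`
     (\bigcap_(a in R_out M P) (pullback a @^-1` (~` N P)))).

Definition density (L : language) (V : finType) (M : structure_on L V)
    (N : euclidean_structure L) : \bar R :=
  (((#|V|)`!%:R / #|automorphisms M|%:R)%R%:E *
     lebesgue_cube R (r V) (Tind M N))%E.

Definition weak_on (L : language) (T : universal_theory L)
    (N : euclidean_structure L) :=
  forall (V : finType) (M : structure_on L V),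
    canonical_structure M -> ~ is_model T M ->
    lebesgue_cube R (r V) (Tind M N) = 0%E.

Definition symmetric_fun (V : finType) (f : E V -> {i01 R}) :=
  forall (s : {perm V}) (x : E V), f (pullback s x) = f x.

Definition mp_highest_order (V : finType) (f : E V -> {i01 R}) :=
  measurable_to_i01 f /\
  forall xs : Estar V, measure_preserving_i01 (fun y => f (E_pair xs y)).

(* A family (f_1, ..., f_k) is given by functions for all [d]; only the members
   with 1 <= d <= k are constrained and used. *)
Definition fun_family := forall d : nat, E 'I_d -> {i01 R}.

Definition good_family (k : nat) (f : fun_family) :=
  forall d, (0 < d <= k)%N -> symmetric_fun (f d) /\ mp_highest_order (f d).

(* [enum_val] enumerates a set of ordinals increasingly. *)
Definition incr_enum (d : nat) (A : {set 'I_d}) : 'I_#|A| -> 'I_d :=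
  fun i => enum_val i.

Definition hat (f : fun_family) (d : nat) (x : E 'I_d) : E 'I_d :=
  fun A => f #|val A| (pullback (@incr_enum d (val A)) x).

End euclidean.

Arguments eset {R L} _ P _.

(* Main.v *)
Require Import Defs.
From HB Require Import structures.
From mathcomp Require Import all_boot all_order all_algebra fingroup perm finmap lra zify.
From mathcomp Require Import all_classical all_reals all_analysis measurable_realfun.

(** A weak T-on N and a point of the infinite cube indexed by the finite sets of
vertices determine a structure: an atom P(a) holds when the coordinates of the
faces of a form a point of N_P. Equality of the densities says that the random
structures sampled from N and N' have the same law.

Take the vertices to be a free copy and a reference copy of the naturals, and let
A and B be the free and the reference part of a finite set. Independent
coordinates of all pairs (A, B) sample from N; to sample from N', merge for each
A the coordinates over all B into a single one, whose binary digits give them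
back. Functions g_1, g_2, ... of the first kind of coordinates are built level by
level so that the merged coordinates A |-> g_|A| give almost surely the same
structure as N does. The next g exists by a transfer argument, made equivariant
under the relabelings of A, as soon as the joint law of the lower levels and of
the atoms with free part A is the same on both sides. This reduces to comparing
conditional expectations of functions of these atoms given the coordinates of the
sets that do not contain A. Such a conditional expectation is approximated in L^2
by functions of atoms over vertex sets not containing A: by Gowers-Cauchy-Schwarz,
the residual of a near minimiser of the L^2 distance is nearly uncorrelated with
all functions of these coordinates, and being a near minimiser depends on the law
of the atoms only. Fixing the coordinates without free part at a generic value
leaves functions of the coordinates of the free vertices only, and the bits of a
single real supply all coordinates with a given free part.

Conversely, the hat of a family is measure preserving because each coordinate of
its value is uniform given the coordinates of other sets of at most the same
size. *)

Set Implicit Arguments.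
Unset Strict Implicit.
Unset Printing Implicit Defensive.

Import Order.TTheory GRing.Theory Num.Theory.
Import numFieldNormedType.Exports.

Local Open Scope classical_set_scope.
Local Open Scope ring_scope.

(** * Expectation of bounded random variables *)

(** The Cauchy-Schwarz steps consume fresh vertices, whereas the induction knows agreement only on
    atoms with few free vertices. This is the use of the reference copy: the vertex exchanged for
    [i] is a reference vertex, so the exchanged atom loses a free vertex and falls under the
    induction hypothesis. The two sides are treated differently because transfer yields one real
    variable per level, which must determine at once all coordinates with a given free part. Until
    its level is built, the merged coordinate of a free set is a spare uniform variable, so the
    joint law to be imitated is explicit. Symmetry is obtained by averaging conditional distribution
    functions over a finite permutation group. The coordinates without free part have to be fixed
    because [r V] has no coordinate for the empty set. All arguments take place on Borel product
    spaces over countable index sets, themselves images of one uniform real; Lebesgue measurable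
    sets enter through Borel versions outside null sets, and as measure preservation is demanded on
    every fibre, the families are corrected on exceptional fibres. *)

Definition bdm (R : realType) d (T : measurableType d) (X : T -> R) :=
  measurable_fun setT X /\ exists M, forall x, `|X x| <= M.

Definition Ex (R : realType) d (T : measurableType d) (P : probability T R)
  (X : T -> R) : R := \int[P]_x X x.

Section bounded_measurable.
Context (R : realType) d (T : measurableType d).
Implicit Types X Y : T -> R.

Lemma bdm_cst (c : R) : bdm (fun _ : T => c).
Proof. by split; [exact: measurable_cst|exists `|c|]. Qed.

Lemma bdmD X Y : bdm X -> bdm Y -> bdm (fun x => X x + Y x).
Proof.
move=> [mX [M hM]] [mY [N hN]]; split; first exact: measurable_funD.
by exists (M + N) => x; apply: (le_trans (ler_normD _ _)); exact: lerD.
Qed.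

Lemma bdmN X : bdm X -> bdm (fun x => - X x).
Proof.
move=> [mX [M hM]]; split; first exact: measurable_funN.
by exists M => x; rewrite normrN.
Qed.

Lemma bdmB X Y : bdm X -> bdm Y -> bdm (fun x => X x - Y x).
Proof. by move=> bX bY; apply: bdmD => //; exact: bdmN. Qed.

Lemma bdmM X Y : bdm X -> bdm Y -> bdm (fun x => X x * Y x).
Proof.
move=> [mX [M hM]] [mY [N hN]]; split; first exact: measurable_funM.
by exists (M * N) => x; rewrite normrM; apply: ler_pM.
Qed.

Lemma bdmX X n : bdm X -> bdm (fun x => X x ^+ n).
Proof.
move=> bX; elim: n => [|n IH].
  by under eq_fun do rewrite expr0; exact: bdm_cst.
by under eq_fun do rewrite exprS; exact: bdmM.
Qed.

Lemma bdm_abs X : bdm X -> bdm (fun x => `|X x|).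
Proof.
move=> [mX [M hM]]; split; first exact: measurableT_comp.
by exists M => x; rewrite normr_id.
Qed.

Lemma bdm_indic (A : set T) : measurable A -> bdm (\1_A : T -> R).
Proof.
move=> mA; split; first exact: measurable_indic.
by exists 1 => x; rewrite indicE; case: (_ \in _); rewrite ?normr1 ?normr0.
Qed.

Lemma bdm_prod (I : Type) (s : seq I) (X : I -> T -> R) :
  (forall i, bdm (X i)) -> bdm (fun x => \prod_(i <- s) X i x).
Proof.
move=> bX; elim: s => [|i s IH].
  by under eq_fun do rewrite big_nil; exact: bdm_cst.
by under eq_fun do rewrite big_cons; exact: bdmM.
Qed.

Lemma bdm_sum (I : Type) (s : seq I) (X : I -> T -> R) :
  (forall i, bdm (X i)) -> bdm (fun x => \sum_(i <- s) X i x).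
Proof.
move=> bX; elim: s => [|i s IH].
  by under eq_fun do rewrite big_nil; exact: bdm_cst.
by under eq_fun do rewrite big_cons; exact: bdmD.
Qed.

Lemma bdm_comp d' (T' : measurableType d') (phi : T' -> T) X :
  measurable_fun setT phi -> bdm X -> bdm (fun x => X (phi x)).
Proof.
move=> mphi [mX [M hM]]; split; first exact: (measurableT_comp mX mphi).
by exists M => x.
Qed.

Lemma bdm_integrable (P : probability T R) X :
  bdm X -> P.-integrable setT (EFin \o X).
Proof.
move=> [mX [M hM]]; apply: measurable_bounded_integrable => //.
  by have := probability_setT P; rewrite /= => ->; rewrite ltry.
exists M; split => [|N MN x _]; first by rewrite num_real.
exact: le_trans (hM x) (ltW MN).
Qed.

End bounded_measurable.

#[global] Hint Resolve bdm_cst bdmD bdmN bdmB bdmM bdmX bdm_abs : core.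

Section expectation.
Context (R : realType) d (T : measurableType d) (P : probability T R).
Implicit Types X Y : T -> R.

Lemma eq_Ex X Y : X =1 Y -> Ex P X = Ex P Y.
Proof. by move=> XY; congr Ex; apply/funext. Qed.

Lemma ExD X Y : bdm X -> bdm Y -> Ex P (fun x => X x + Y x) = Ex P X + Ex P Y.
Proof. by move=> bX bY; rewrite /Ex RintegralD//; exact: bdm_integrable. Qed.

Lemma ExB X Y : bdm X -> bdm Y -> Ex P (fun x => X x - Y x) = Ex P X - Ex P Y.
Proof. by move=> bX bY; rewrite /Ex RintegralB//; exact: bdm_integrable. Qed.

Lemma ExZ c X : bdm X -> Ex P (fun x => c * X x) = c * Ex P X.
Proof. by move=> bX; rewrite /Ex RintegralZl//; exact: bdm_integrable. Qed.

Lemma Ex_cst c : Ex P (fun=> c) = c.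
Proof.
rewrite /Ex Rintegral_cst//; have := probability_setT P; rewrite /= => ->.
by rewrite /= mulr1.
Qed.

Lemma Ex_ge0 X : (forall x, 0 <= X x) -> 0 <= Ex P X.
Proof. by move=> X0; apply: Rintegral_ge0. Qed.

Lemma le_Ex X Y : bdm X -> bdm Y -> (forall x, X x <= Y x) -> Ex P X <= Ex P Y.
Proof. by move=> bX bY XY; apply: le_Rintegral => //; exact: bdm_integrable. Qed.

Lemma Ex_abs X : bdm X -> `|Ex P X| <= Ex P (fun x => `|X x|).
Proof. by move=> bX; apply: le_normr_Rintegral => //; exact: bdm_integrable. Qed.

Lemma Ex_indic A : measurable A -> (Ex P \1_A)%:E = P A.
Proof.
move=> mA; rewrite /Ex /Rintegral fineK.
  by rewrite integral_indic// setIT.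
exact: (integrable_fin_num measurableT (bdm_integrable P (bdm_indic R mA))).
Qed.

Lemma Ex_sum (I : Type) (s : seq I) (X : I -> T -> R) :
  (forall i, bdm (X i)) ->
  Ex P (fun x => \sum_(i <- s) X i x) = \sum_(i <- s) Ex P (X i).
Proof.
move=> bX; elim: s => [|i s IH].
  by rewrite big_nil -[RHS]Ex_cst; apply: eq_Ex => x; rewrite big_nil.
rewrite big_cons -IH -ExD//; last exact: bdm_sum.
by apply: eq_Ex => x; rewrite big_cons.
Qed.

Lemma Ex_le_cst X c : bdm X -> (forall x, X x <= c) -> Ex P X <= c.
Proof. by move=> bX Xc; rewrite -[leRHS]Ex_cst; exact: le_Ex. Qed.

Lemma Ex_abs_le X c : bdm X -> (forall x, `|X x| <= c) -> `|Ex P X| <= c.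
Proof. by move=> bX Xc; apply: (le_trans (Ex_abs bX)); apply: Ex_le_cst; auto. Qed.

Lemma Ex_sqr_ge0 X : 0 <= Ex P (fun x => X x ^+ 2).
Proof. by apply: Ex_ge0 => x; exact: sqr_ge0. Qed.

(** The second moment of [t * X + Y] is a nonnegative quadratic in [t]. It is evaluated at its
    minimiser [- b / a], or, when [a = 0] and [b != 0], at a point where it would equal -1. *)
Lemma Ex_CS X Y : bdm X -> bdm Y ->
  Ex P (fun x => X x * Y x) ^+ 2 <=
  Ex P (fun x => X x ^+ 2) * Ex P (fun x => Y x ^+ 2).
Proof.
move=> bX bY.
set a := Ex P (fun x => X x ^+ 2); set b := Ex P _; set c := Ex P (fun x => Y x ^+ 2).
have q t : 0 <= a * t ^+ 2 + 2 * b * t + c.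
  rewrite -[leRHS](_ : Ex P (fun x => (t * X x + Y x) ^+ 2) = _).
    exact: Ex_sqr_ge0.
  rewrite (@eq_Ex _ (fun x => t ^+ 2 * X x ^+ 2 + ((2 * t) * (X x * Y x) + Y x ^+ 2))).
    by rewrite ExD ?ExD ?ExZ; auto 6; rewrite -/a -/b -/c; lra.
  by move=> x; rewrite sqrrD exprMn mulr2n; lra.
have a0 : 0 <= a by exact: Ex_sqr_ge0.
have [a_eq0|a_neq0] := eqVneq a 0.
  have : b = 0.
    apply: contrapT => /eqP b0.
    have := q (- (c + 1) / (2 * b)); rewrite a_eq0 mul0r add0r.
    rewrite mulrCA mulfV ?mulr1; last by rewrite mulf_neq0// pnatr_eq0.
    by lra.
  by rewrite a_eq0 mul0r => ->; rewrite expr0n.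
have := q (- b / a); rewrite exprMn sqrrN exprVn.
have -> : a * (b ^+ 2 / a ^+ 2) = b ^+ 2 / a.
  by rewrite mulrCA expr2 invfM mulrA mulrA mulfK.
rewrite (_ : _ + _ + _ = c - b ^+ 2 / a); last by rewrite expr2; lra.
by rewrite subr_ge0 ler_pdivrMr ?lt_neqAle 1?eq_sym ?a_neq0// mulrC.
Qed.

Lemma Ex_CS1 X Y : bdm X -> bdm Y -> (forall x, `|Y x| <= 1) ->
  Ex P (fun x => X x * Y x) ^+ 2 <= Ex P (fun x => X x ^+ 2).
Proof.
move=> bX bY Y1; apply: (le_trans (Ex_CS bX bY)).
rewrite -[leRHS]mulr1; apply: ler_wpM2l; first exact: Ex_sqr_ge0.
apply: Ex_le_cst; auto => x.
by rewrite -[leRHS](expr1n _ 2) -[leLHS]real_normK ?num_real// lerXn2r ?nnegrE.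
Qed.

Lemma Ex_sqr_eq0_ae X : bdm X -> Ex P (fun x => X x ^+ 2) = 0 ->
  {ae P, forall x, X x = 0}.
Proof.
move=> bX h.
have bX2 : bdm (fun x => X x ^+ 2) by auto.
have : ae_eq P setT (EFin \o (fun x => X x ^+ 2)) (cst 0%E).
  apply/ae_eq_integral_abs => //; first by case: bX2 => m _; apply/measurable_EFinP.
  rewrite (eq_integral (EFin \o (fun x => X x ^+ 2))); last first.
    by move=> x _; rewrite /= normrX real_normK ?num_real.
  have := integrable_fin_num measurableT (bdm_integrable P bX2).
  by move/fineK => <-; congr (_%:E).
apply: filterS => x /(_ Logic.I) /= [] /eqP; rewrite sqrf_eq0 => /eqP.
exact.
Qed.

Lemma ae_Ex X Y : bdm X -> bdm Y -> {ae P, forall x, X x = Y x} -> Ex P X = Ex P Y.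
Proof.
move=> [mX _] [mY _] XY; congr fine; apply: ae_eq_integral => //.
- exact/measurable_EFinP.
- exact/measurable_EFinP.
- by apply: filterS XY => x + _ => ->.
Qed.

End expectation.

Lemma measurable_pair_l d d' (T : measurableType d) (T' : measurableType d') (x : T) :
  measurable_fun setT (fun y : T' => (x, y)).
Proof. exact/measurable_fun_pair. Qed.

Section fubini.
Context (R : realType) d d' (T : measurableType d) (T' : measurableType d').
Context (P : probability T R) (Q : probability T' R).
Implicit Type F : T * T' -> R.

Let bdm_integral F : bdm F ->
  forall x, (Ex Q (fun y => F (x, y)))%:E = (\int[Q]_y (F (x, y))%:E)%E.
Proof.
move=> bF x; rewrite fineK//; apply: integrable_fin_num => //.
by apply: (bdm_integrable Q (X := fun y => F (x, y))); apply: bdm_comp bF;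
   exact: measurable_pair_l.
Qed.

Lemma bdm_Ex F : bdm F -> bdm (fun x => Ex Q (fun y => F (x, y))).
Proof.
move=> bF; split; last first.
  have [_ [M hM]] := bF; exists M => x; apply: Ex_abs_le => //.
  by apply: bdm_comp bF; exact: measurable_pair_l.
apply/measurable_EFinP.
rewrite (_ : EFin \o _ = fun x => (\int[Q]_y (F (x, y))%:E)%E); last first.
  by apply/funext => x; exact: bdm_integral.
exact: (@measurable_fubini_F _ _ _ _ _ P Q _ (bdm_integrable (P \x Q)%E bF)).
Qed.

Lemma Ex_Fubini F : bdm F ->
  Ex (P \x Q)%E F = Ex P (fun x => Ex Q (fun y => F (x, y))).
Proof.
move=> bF; congr fine.
rewrite -(integral12_prod_meas1 (bdm_integrable (P \x Q)%E bF)).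
by apply: eq_integral => x _; rewrite bdm_integral.
Qed.

End fubini.

Definition mpres (R : realType) d d' (T : measurableType d) (T' : measurableType d')
    (P : probability T R) (P' : probability T' R) (phi : T -> T') :=
  measurable_fun setT phi /\
  forall A, measurable A -> P (phi @^-1` A) = P' A.

Section measure_preserving.
Context (R : realType) d d' (T : measurableType d) (T' : measurableType d').
Context d'' (T'' : measurableType d'').
Context (P : probability T R) (P' : probability T' R) (P'' : probability T'' R).

Lemma Ex_mpres (phi : T -> T') X :
  mpres P P' phi -> bdm X -> Ex P (fun x => X (phi x)) = Ex P' X.
Proof.
move=> [mphi hphi] bX.
pose Phi : {mfun T >-> T'} := HB.pack phi (isMeasurableFun.Build _ _ _ _ phi mphi).
congr fine; transitivity (\int[pushforward P Phi]_y (X y)%:E)%E; last first.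
  by apply: eq_measure_integral => A mA _; first [exact: hphi|exact: (esym (hphi A mA))].
rewrite integral_pushforward//=.
- by case: bX => mX _; apply/measurable_EFinP.
- by apply: (bdm_integrable P (X := fun x => X (phi x))); exact: bdm_comp bX.
Qed.

Lemma mpres_Ex (phi : T -> T') : measurable_fun setT phi ->
  (forall A, measurable A -> Ex P (\1_A \o phi) = Ex P' \1_A) -> mpres P P' phi.
Proof.
move=> mphi h; split => // A mA.
have mA' : measurable (phi @^-1` A) by rewrite -[X in measurable X]setTI; exact: mphi.
by rewrite -Ex_indic// -[RHS]Ex_indic// -h.
Qed.

Lemma mpres_comp (phi : T -> T') (psi : T' -> T'') :
  mpres P P' phi -> mpres P' P'' psi -> mpres P P'' (psi \o phi).
Proof.
move=> [mphi hphi] [mpsi hpsi]; split; first exact: measurableT_comp.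
move=> A mA; rewrite -hpsi// -hphi//.
by rewrite -[X in measurable X]setTI; exact: mpsi.
Qed.

Lemma ae_mpres (phi : T -> T') (Q : T' -> Prop) :
  mpres P P' phi -> {ae P', forall x, Q x} -> {ae P, forall x, Q (phi x)}.
Proof.
move=> [mphi hphi] [A [mA A0 QA]]; exists (phi @^-1` A); split.
- by rewrite -[X in measurable X]setTI; exact: mphi.
- by rewrite hphi.
- by move=> x; exact: QA.
Qed.

End measure_preserving.

Lemma eq_probability_Ex (R : realType) d (T : measurableType d)
    (P Q : probability T R) (G : set (set T)) :
  @measurable _ T = <<s G >> -> setI_closed G ->
  (forall A, G A -> P A = Q A) -> forall X, bdm X -> Ex P X = Ex Q X.
Proof.
move=> GE GI GPQ X bX; congr fine; apply: eq_measure_integral => A mA _.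
(* The uniqueness theorem asks for a cover by members of the generating system; adjoining [setT]
   provides one. *)
apply: (measure_unique (setT |` G) (fun=> setT)) => //.
- rewrite GE; apply/seteqP; split.
  + apply: smallest_sub => [|B GB]; first exact: smallest_sigma_algebra.
    by apply: sub_sigma_algebra; right.
  + apply: smallest_sub => [|B [->|GB]]; first exact: smallest_sigma_algebra.
      by rewrite -GE; exact: measurableT.
    exact: sub_sigma_algebra.
- move=> A' B' [->|GA] [->|GB]; rewrite ?setIT ?setTI; [by left|by right|by right|].
  by right; exact: GI.
- by move=> _; left.
- by apply/seteqP; split => // x _; exists 0%N.
- move=> B [->|GB]; last exact: GPQ.
  by have := probability_setT P; have := probability_setT Q; rewrite /= => -> ->.
- by move=> k; have := probability_setT P; rewrite /= => ->; rewrite ltry.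
Qed.

Section convergence.
Context (R : realType) d (T : measurableType d) (P : probability T R).

Lemma Ex_dct (h : nat -> T -> R) (f : T -> R) (M : R) :
  (forall n, measurable_fun setT (h n)) -> (forall n x, `|h n x| <= M) ->
  (forall x, h n x @[n --> \oo] --> f x) -> bdm f ->
  forall e, 0 < e -> exists N, forall n, (N <= n)%N ->
    Ex P (fun x => `|f x - h n x|) <= e.
Proof.
move=> mh hM hf bf e e0.
have bh n : bdm (h n) by split=> //; exists M.
have := @dominated_convergence _ T R P setT measurableT (fun n => EFin \o h n)
  (EFin \o f) (fun=> M%:E) _ _ _ _ _.
case.
- by move=> n; apply/measurable_EFinP.
- by case: bf => ? _; apply/measurable_EFinP.
- by apply: aeW => x _; apply: cvg_EFin; [exact: nearW|exact: hf].
- exact: (bdm_integrable P (bdm_cst T M)).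
- by apply: aeW => x n _ /=; rewrite lee_fin.
move=> _ + _.
rewrite (_ : [sequence _]_n = EFin \o (fun n => Ex P (fun x => `|f x - h n x|))).
  move/fine_cvg => /cvgrPdist_le /(_ _ e0) [N _ hN].
  exists N => n Nn; have := hN n Nn; rewrite /= sub0r normrN ger0_norm//.
  exact: Ex_ge0.
apply/funext => n /=; rewrite fineK.
  by apply: eq_integral => x _; rewrite /= distrC.
have bd : bdm (fun x => `|f x - h n x|) by auto.
exact: (integrable_fin_num measurableT (bdm_integrable P bd)).
Qed.

End convergence.

(** One index [n] serves all the measures: a functional that compares several laws is controlled by
    the sum of their L^1 norms. *)
Lemma Ex_dct_fin (R : realType) d (T : measurableType d) (I : finType)
    (Ps : I -> probability T R) (h : nat -> T -> R) (f : T -> R) (M : R) :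
  (forall n, measurable_fun setT (h n)) -> (forall n x, `|h n x| <= M) ->
  bdm f -> (forall x, h n x @[n --> \oo] --> f x) ->
  forall e, 0 < e -> exists n, forall i, Ex (Ps i) (fun x => `|f x - h n x|) <= e.
Proof.
move=> mh hM bf hf e e0.
have /choice[N hN] i := Ex_dct (Ps i) mh hM hf bf e0.
by exists (\max_i N i)%N => i; apply: hN; exact: leq_bigmax.
Qed.

(** The sum is the integer part of [y], written through level sets; it approximates a function with
    values in [0, 1] by averages of indicators. *)
Lemma step_count (R : realType) n (y : R) : 0 <= y <= n%:R ->
  0 <= y - \sum_(j < n) (j.+1%:R <= y)%R%:R <= 1.
Proof.
elim: n y => [|n IH] y /andP[y0 yn].
  by rewrite big_ord0 subr0 y0 (le_trans yn).
have [y1|y1] := leP 1 y; last first.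
  rewrite big1 ?subr0 ?y0 ?ltW// => i _.
  by rewrite leNgt (lt_le_trans y1)// ler1n.
have := IH (y - 1); rewrite subr_ge0 y1 lerBlDr natr1 => /(_ yn).
rewrite big_ord_recl /= y1 -[nat_of_bool true]/1%N.
rewrite [X in _ -> is_true (0 <= y - (_ + X) <= 1)](eq_bigr (fun i : 'I_n => (i.+1%:R <= y - 1)%R%:R)).
  by move: (\sum_(i < n) _) => S /andP[a b]; apply/andP; split; lra.
by move=> i _; rewrite lerBrDr natr1.
Qed.

(* The [Ps i] control the error of approximation in the closure hypothesis. *)
Theorem functional_monotone_class (R : realType) d (T : measurableType d)
    (I : finType) (Ps : I -> probability T R) (G : set (set T)) (S : (T -> R) -> Prop) :
  @measurable _ T = <<s G >> -> setI_closed G ->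
  (forall A, G A -> S \1_A) -> S (fun=> 1) ->
  (forall f g, bdm f -> bdm g -> S f -> S g -> S (fun x => f x + g x)) ->
  (forall c f, bdm f -> S f -> S (fun x => c * f x)) ->
  (forall f, bdm f ->
    (exists2 h : nat -> T -> R, (forall n, bdm (h n) /\ S (h n)) &
      forall e, 0 < e -> exists n, forall i, Ex (Ps i) (fun x => `|f x - h n x|) <= e) ->
    S f) ->
  forall f, bdm f -> S f.
Proof.
move=> GE GI SG S1 SD SZ SL.
have eqS f g : f =1 g -> S f -> S g by move=> /funext ->.
have Sind A : measurable A -> S \1_A.
  rewrite GE; move: A; apply: (dynkin_induction GE GI).
  - by apply: eqS S1 => x; rewrite indicT.
  - exact: SG.
  - move=> A mA SA; apply: (eqS (fun x => 1 + -1 * \1_A x)); last first.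
      apply: SD => //; last by apply: SZ => //; exact: bdm_indic.
      by apply: bdmM => //; exact: bdm_indic.
    move=> x; rewrite !indicE in_setC; case: (x \in A) => /=; lra.
  - move=> F mF tF SF.
    pose h n x := \sum_(k < n) \1_(F k) x : R.
    have bh n : bdm (h n) by apply: bdm_sum => k; exact: bdm_indic.
    have Sh n : S (h n).
      elim: n => [|n IH].
        apply: (eqS (fun x => 0 * 1)); last by apply: SZ.
        by move=> x; rewrite /h big_ord0 mul0r.
      apply: (eqS (fun x => h n x + \1_(F n) x)).
        by move=> x; rewrite /h big_ord_recr.
      by apply: SD => //; exact: bdm_indic.
    have hE n x : h n x = \1_(\bigcup_(k < n) F k) x.
      have tF' : trivIset setT (fun i => F i) by [].
      have [xU|] := boolP (x \in \bigcup_(k < n) F k).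
        rewrite indicE xU.
        have [k /= kn Fkx] := set_mem xU.
        rewrite /h (bigD1 (Ordinal kn))//= indicE mem_set// big1 ?addr0// => j jk.
        rewrite indicE memNset// => Fjx; move/eqP: jk; apply; apply/val_inj => /=.
        by apply: (tF j k) => //; exists x.
      move=> xU; rewrite indicE (negbTE xU); apply: big1 => i _.
      rewrite indicE memNset// => Fi; move/negP: xU; apply.
      by apply/mem_set; exists i => //=.
    apply: SL; first by apply: bdm_indic; exact: bigcup_measurable.
    exists h => [n|]; first by split.
    apply: (Ex_dct_fin Ps (M := 1)).
    + by move=> n; case: (bh n).
    + by move=> n x; rewrite hE indicE; case: (_ \in _); rewrite ?normr1 ?normr0.
    + by apply: bdm_indic; exact: bigcup_measurable.
    + move=> x; have [/set_mem [k _ Fkx]|xU] := boolP (x \in \bigcup_k F k).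
        apply: cvg_near_cst; exists k.+1 => // n /= kn.
        rewrite hE !indicE !mem_set//; exists k => //.
      apply: cvg_near_cst; exists 0%N => // n _.
      rewrite hE !indicE (negbTE xU) memNset// => -[k _ Fk].
      by move/negP: xU; apply; apply/mem_set; exists k.
move=> f bf.
suff H g : bdm g -> (forall x, 0 <= g x <= 1) -> S g.
  have [mf [M hM]] := bf.
  have M1 : 0 < `|M| + 1 by rewrite ltr_wpDl.
  (* An affine change brings the values into [0, 1]; the added 1 keeps the scale positive when [M]
     is 0. *)
  pose g x := ((`|M| + 1) * 2)^-1 * (f x + (`|M| + 1)).
  have bg : bdm g by apply: bdmM => //; apply: bdmD.
  apply: (eqS (fun x => ((`|M| + 1) * 2) * g x + - (`|M| + 1) * 1)).
    move=> x; rewrite /g mulrA mulfV; last by rewrite mulf_neq0// gt_eqF.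
    by lra.
  apply: SD; [exact: bdmM|exact: bdmM| |exact: SZ].
  apply: SZ => //; apply: H => // x; rewrite /g.
  have := le_trans (hM x) (ler_norm M); rewrite ler_norml => /andP[f1 f2].
  rewrite ler_pdivlMl ?mulr_gt0// ler_pdivrMl ?mulr_gt0//; apply/andP; split; lra.
move=> bg g01.
(* By [step_count] this average of level indicators is within 1/(n+1) of [g]. *)
pose h (n : nat) (x : T) : R := n.+1%:R^-1 * \sum_(j < n.+1) \1_[set y | j.+1%:R <= n.+1%:R * g y] x.
have mA n j : measurable [set y | j.+1%:R <= n.+1%:R * g y].
  rewrite [X in measurable X](_ : _ = (fun y => n.+1%:R * g y) @^-1` `[j.+1%:R, +oo[%classic); last first.
    by apply/seteqP; split => x /=; rewrite in_itv /= andbT.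
  rewrite -[X in measurable X]setTI.
  have [m _] : bdm (fun y => n.+1%:R * g y) by apply: bdmM.
  exact: m.
have bh n : bdm (h n).
  by apply: bdmM => //; apply: bdm_sum => j; exact: bdm_indic.
apply: SL => //; exists h => [n|e e0].
  split=> //; apply: (SZ _ _); first by apply: bdm_sum => j; exact: bdm_indic.
  suff Sk : forall k : nat, S (fun x => \sum_(j < k) \1_[set y | j.+1%:R <= n.+1%:R * g y] x).
    exact: Sk.
  elim=> [|k IH].
    apply: (eqS (fun x => 0 * 1)); last by apply: SZ.
    by move=> x; rewrite big_ord0 mul0r.
  apply: (eqS (fun x => \sum_(j < k) \1_[set y | j.+1%:R <= n.+1%:R * g y] x +
    \1_[set y | k.+1%:R <= n.+1%:R * g y] x)).
    by move=> x; rewrite big_ord_recr.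
  apply: SD => //; first by apply: bdm_sum => j; exact: bdm_indic.
  - exact: bdm_indic.
  - exact: Sind.
exists (Num.truncn e^-1) => i.
apply: Ex_le_cst => [|x]; first by apply: bdm_abs; apply: bdmB.
set n := Num.truncn _.
have n0 : 0 < n.+1%:R :> R by rewrite ltr0n.
apply: (@le_trans _ _ n.+1%:R^-1); last first.
  rewrite invf_ple ?posrE//; apply/ltW/truncnS_gt.
have /andP[g0 g1] := g01 x.
have := @step_count R n.+1 (n.+1%:R * g x).
rewrite mulr_ge0//= ger_pMr// => /(_ g1).
rewrite (_ : _ - _ = n.+1%:R * (g x - h n x)).
  by rewrite pmulr_rge0// => /andP[a b]; rewrite ger0_norm// -(ler_pM2l n0) mulfV ?gt_eqF.
rewrite mulrBr /h mulrA mulfV ?gt_eqF// mul1r; congr (_ - _); apply: eq_bigr => j _.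
rewrite indicE; congr (nat_of_bool _)%:R.
by apply/idP/idP => [h'|/set_mem//]; exact: mem_set.
Qed.

(** * Uniform variables and their binary digits *)

Section law.
Context (R : realType) d d' (T : measurableType d) (T' : measurableType d').

Definition law (P : probability T R) (phi : T -> T') (mphi : measurable_fun setT phi) :
  probability T' R :=
  distribution P (HB.pack_for {mfun T >-> T'} phi (isMeasurableFun.Build _ _ _ _ phi mphi)).

Lemma mpres_law P phi (mphi : measurable_fun setT phi) : mpres P (law P mphi) phi.
Proof. by split. Qed.

End law.

(** The identity carries the law from [measurableTypeR R] to [R] itself. *)
HB.lock Definition unif (R : realType) : probability R R :=
  @law R _ _ (measurableTypeR R) R (uniform_prob (@ltr01 R)) id (@measurable_id _ _ _).

Section dominated_functional.
Context (R : realType) d (T : measurableType d).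
Context (I : finType) (Ps : I -> probability T R) (D : (T -> R) -> R) (c : R).
Hypothesis DD : forall f g, bdm f -> bdm g -> D (fun x => f x + g x) = D f + D g.
Hypothesis DZ : forall a f, bdm f -> D (fun x => a * f x) = a * D f.
Hypothesis Dc : forall f, bdm f -> `|D f| <= c * \sum_i Ex (Ps i) (fun x => `|f x|).

Lemma linear_functional_lim f (h : nat -> T -> R) : bdm f ->
  (forall n, bdm (h n) /\ D (h n) = 0) ->
  (forall e, 0 < e -> exists n, forall i, Ex (Ps i) (fun x => `|f x - h n x|) <= e) ->
  D f = 0.
Proof.
move=> bf shift2 hf; apply/eqP; rewrite -normr_le0; apply/ler_addgt0Pl => e e0.
rewrite addr0.
have c1 : 0 < (`|c| + 1) * (#|I|.+1%:R) by rewrite mulr_gt0// ltr_wpDl.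
have [n hn] := hf _ (divr_gt0 e0 c1).
have [bh Dh] := shift2 n.
have -> : D f = D (fun x => f x + -1 * h n x).
  by rewrite DD// ?DZ// ?Dh ?mulr0 ?addr0//; exact: bdmM.
apply: (le_trans (Dc _)); first by apply: bdmD => //; apply: bdmM.
apply: (@le_trans _ _ (`|c| * \sum_i Ex (Ps i) (fun x => `|f x + -1 * h n x|))).
  by apply: ler_wpM2r (ler_norm _); apply: sumr_ge0 => i _; exact: Ex_ge0.
apply: (@le_trans _ _ (`|c| * \sum_(i : I) (e / ((`|c| + 1) * (#|I|.+1%:R))))).
  apply: ler_wpM2l => //; apply: ler_sum => i _; apply: le_trans (hn i).
  by rewrite le_eqVlt; apply/orP; left; apply/eqP/eq_Ex => x; rewrite mulN1r.
rewrite sumr_const -[_ *+ _]mulr_natr mulrCA mulrC mulrA.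
rewrite ler_pdivrMr// mulrC ler_wpM2l//; first exact: ltW.
by apply: ler_pM => //; [rewrite lerDl|rewrite ler_nat].
Qed.

(** Identities between expectations are proved below with [D] the difference of the two sides: being
    linear and dominated by finitely many L^1 norms, it is determined by the constant 1 and a
    generating pi-system. *)
Lemma linear_functional_eq0 (G : set (set T)) :
  @measurable _ T = <<s G >> -> setI_closed G ->
  (forall A, G A -> D \1_A = 0) -> D (fun=> 1) = 0 ->
  forall f, bdm f -> D f = 0.
Proof.
move=> GE GI DG D1.
apply: (functional_monotone_class (Ps := Ps) (S := fun f => D f = 0) GE GI) => //.
- by move=> f g bf bg Df Dg; rewrite DD// Df Dg addr0.
- by move=> a f bf Df; rewrite DZ// Df mulr0.
- by move=> f bf [h shift2 hf]; exact: (linear_functional_lim bf shift2 hf).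
Qed.

End dominated_functional.

Section uniform.
Context (R : realType).
Local Notation U := (unif R).

Lemma unif_itv (A : set R) : measurable A ->
  U A = lebesgue_measure (A `&` `[0, 1]%classic).
Proof.
move=> mA; have -> : U A = (\int[lebesgue_measure]_(x in A) (uniform_pdf 0 1 x)%:E)%E.
  by rewrite unif.unlock.
rewrite integral_uniform_pdf.
rewrite (eq_integral (cst 1%E)); last first.
  by move=> x; rewrite inE /= /uniform_pdf in_itv/= => -[_ ->]; rewrite subr0 invr1.
by rewrite integral_cst ?mul1e//; apply: measurableI.
Qed.

Lemma unif01 : {ae U, forall y : R, 0 <= y <= 1}.
Proof.
exists (~` `[0%R, 1%R]%classic); split.
- by apply: measurableC; exact: measurable_itv.
- by rewrite unif_itv ?setICl ?measure0//; apply: measurableC; exact: measurable_itv.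
- by move=> y /= h; apply: contra_not h; rewrite in_itv.
Qed.

Lemma Ex_unif_lt (s : R) : Ex U \1_(`]-oo, s[%classic) = Num.min (Num.max s 0) 1.
Proof.
apply: EFin_inj; rewrite Ex_indic ?unif_itv; [|exact: measurable_itv..].
have [s0|s0] := leP s 0.
  rewrite min_l// (_ : _ `&` _ = set0) ?measure0//.
  by apply/seteqP; split => // x /=; rewrite !in_itv /= => -[h1 /andP[h2 _]]; lra.
have [s1|s1] := leP s 1.
  rewrite (_ : _ `&` _ = `[0, s[%classic).
    by rewrite lebesgue_measure_itv/= lte_fin s0 sube0.
  apply/seteqP; split => x /=; rewrite !in_itv /=.
    by move=> [h1 /andP[h2 _]]; apply/andP.
  by move=> /andP[h1 h2]; split => //; apply/andP; split => //; lra.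
rewrite (_ : _ `&` _ = `[0, 1]%classic).
  by rewrite lebesgue_measure_itv/= lte_fin ltr01 sube0.
apply/seteqP; split => x /=; rewrite !in_itv /=; first by move=> [].
by move=> /andP[h1 h2]; split; [lra|exact/andP].
Qed.

Definition Iio_system : set (set R) := [set A | exists s, A = `]-oo, s[%classic].

Lemma Iio_systemE : @measurable _ R = <<s Iio_system >>.
Proof.
exact: RGenInftyO.measurableE.
Qed.

Lemma Iio_systemI : setI_closed Iio_system.
Proof.
move=> _ _ [s ->] [t ->]; exists (Num.min s t); apply/seteqP; split => x /=;
  rewrite !in_itv /= lt_min; first by move=> [-> ->].
by move=> /andP.
Qed.

(** Prepends the digit [b] to the binary expansion of [y]; these are the two inverse branches of the
    doubling map. *)
Definition bhalf (b : bool) (y : R) : R := ((b : nat)%:R + y) / 2.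

Lemma measurable_bhalf b : measurable_fun setT (bhalf b).
Proof. by apply: measurable_funM => //; exact: measurable_funD. Qed.

(** Self-similarity of the uniform law, checked on half-lines, where both sides are explicit
    distribution functions. *)
Lemma Ex_unif_bhalf (F : R -> R) : bdm F ->
  Ex U F = 2^-1 * Ex U (fun y => F (bhalf false y)) + 2^-1 * Ex U (fun y => F (bhalf true y)).
Proof.
move=> bF; apply/eqP; rewrite -subr_eq0; apply/eqP; move: F bF.
pose Ps (i : option bool) := if i is Some b then law U (measurable_bhalf b) else U.
have bh (F : R -> R) b : bdm F -> bdm (fun y => F (bhalf b y)).
  by move=> bF; apply: bdm_comp bF; exact: measurable_bhalf.
apply: (@linear_functional_eq0 _ _ _ _ Ps _ 1 _ _ _ _ Iio_systemE Iio_systemI).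
- by move=> f g bf bg; rewrite !ExD; auto; lra.
- by move=> a f bf; rewrite !ExZ; auto; lra.
- move=> f bf.
  have e b : Ex (Ps (Some b)) (fun x => `|f x|) = Ex U (fun y => `|f (bhalf b y)|).
    by rewrite -(Ex_mpres (mpres_law U (measurable_bhalf b))); auto.
  have -> : \sum_i Ex (Ps i) (fun x => `|f x|) = Ex U (fun x => `|f x|) +
      (Ex U (fun y => `|f (bhalf false y)|) + Ex U (fun y => `|f (bhalf true y)|)).
    rewrite (bigD1 None)//=; congr (_ + _).
    rewrite -!e (bigD1 (Some false))//=; congr (_ + _).
    rewrite (bigD1 (Some true))//= big1 ?addr0//.
    by case=> [[]|].
  have := Ex_abs U bf; have := Ex_abs U (bh _ true bf); have := Ex_abs U (bh _ false bf).
  rewrite !ler_norml => /andP[a1 a2] /andP[b1 b2] /andP[c1 c2].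
  by rewrite mul1r; apply/andP; split; lra.
- move=> _ [s ->].
  have e b : Ex U (fun y => \1_(`]-oo, s[%classic) (bhalf b y)) =
      Ex U \1_(`]-oo, 2 * s - (b : nat)%:R[%classic).
    apply: eq_Ex => y; rewrite !indicE; congr (nat_of_bool _)%:R.
    apply/idP/idP => /set_mem; rewrite /= in_itv /= => h; apply/mem_set; rewrite /= in_itv /=.
      by move: h; rewrite /bhalf; lra.
    by rewrite /bhalf; lra.
  rewrite !e !Ex_unif_lt /=.
  case: (leP s 0) => ?; case: (leP (2 * s - 0) 0) => ?; case: (leP (2 * s - 1) 0) => ?;
    repeat match goal with |- context [Order.min ?a 1] => case: (leP a 1) => ? end; lra.
- by rewrite !Ex_cst; lra.
Qed.

(** The first binary digit, and in [shift2] the expansion without it. They invert [bhalf] only for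
    [y < 1], since 1/2 has two expansions; the exception is a null set. *)
Definition bt (x : R) : bool := (2^-1 <= x)%R.
Definition shift2 (x : R) : R := 2 * x - (bt x : nat)%:R.

Lemma measurable_bt : measurable_fun setT bt.
Proof. exact: measurable_fun_ler. Qed.

Lemma measurable_btR : measurable_fun setT (fun x => (bt x : nat)%:R : R).
Proof.
rewrite (_ : (fun x => _) = (fun x => if bt x then 1 else 0)); last first.
  by apply/funext => x; case: bt.
by apply: measurable_fun_ifT => //; exact: measurable_bt.
Qed.

Lemma measurable_shift2 : measurable_fun setT shift2.
Proof. by apply: measurable_funB; [exact: measurable_funM|exact: measurable_btR]. Qed.

Lemma bt_bhalf b y : 0 <= y < 1 -> bt (bhalf b y) = b.
Proof.
move=> /andP[y0 y1]; rewrite /bt /bhalf; case: b => /=; first by lra.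
by apply/negbTE; rewrite -ltNge; lra.
Qed.

Lemma shift2_bhalf b y : 0 <= y < 1 -> shift2 (bhalf b y) = y.
Proof. by move=> y01; rewrite /shift2 bt_bhalf// /bhalf; lra. Qed.

Lemma unif01_lt : {ae U, forall y : R, 0 <= y < 1}.
Proof.
have : {ae U, forall y : R, y != 1}.
  exists [set 1]; split => //.
  - rewrite unif_itv// (_ : _ `&` _ = [set 1]) ?lebesgue_measure_set1//.
    apply/seteqP; split => [x [->]//|x -> /=]; split => //.
    by rewrite in_itv /= ler01 lexx.
  - by move=> y /= /negP; rewrite negbK => /eqP.
have := unif01; apply: filterS2 => y /andP[-> y1] y1'.
by rewrite lt_neqAle y1'.
Qed.

Lemma Ex_unif_bit (F : bool -> R -> R) : (forall b, bdm (F b)) ->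
  Ex U (fun x => F (bt x) (shift2 x)) = 2^-1 * Ex U (F false) + 2^-1 * Ex U (F true).
Proof.
move=> bF.
have bG : bdm (fun x => F (bt x) (shift2 x)).
  rewrite (_ : (fun x => _) = fun x => (bt x : nat)%:R * F true (shift2 x) +
    (1 - (bt x : nat)%:R) * F false (shift2 x)); last first.
    by apply/funext => x; case: bt => /=; lra.
  have b1 : bdm (fun x => (bt x : nat)%:R : R).
    split; first exact: measurable_btR.
    by exists 1 => x; case: bt; rewrite ?normr1 ?normr0.
  have b2 b : bdm (fun x => F b (shift2 x)) by apply: bdm_comp (bF b); exact: measurable_shift2.
  by auto.
rewrite Ex_unif_bhalf//; congr (_ * _ + _ * _).
  all: apply: ae_Ex => //; first by apply: bdm_comp bG; exact: measurable_bhalf.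
  all: by have := unif01_lt; apply: filterS => y y01; rewrite bt_bhalf// shift2_bhalf.
Qed.

(** One step reads a digit and skips the next one. Ending with 0 makes the approximations
    nondecreasing in [n], hence convergent. *)
Fixpoint sig_approx n (x : R) : R :=
  if n is m.+1 then bhalf (bt x) (sig_approx m (shift2 (shift2 x))) else 0.

Lemma sig_approx01 n x : 0 <= sig_approx n x <= 1.
Proof.
elim: n x => [|n IH] x /=; first by rewrite lexx ler01.
by have /andP[a b] := IH (shift2 (shift2 x)); rewrite /bhalf; case: bt => /=; apply/andP; split; lra.
Qed.

Lemma sig_approx_nd n x : sig_approx n x <= sig_approx n.+1 x.
Proof.
elim: n x => [|n IH] x.
  by have /andP[] := sig_approx01 1 x.
by have := IH (shift2 (shift2 x)); rewrite /= /bhalf; lra.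
Qed.

(* sigma1 keeps the binary digits of even rank of x, sigma2 those of odd rank. *)
Definition sigma1 (x : R) : R := limn (sig_approx ^~ x).
Definition sigma2 (x : R) : R := sigma1 (shift2 x).

Lemma cvg_sigma1 x : sig_approx n x @[n --> \oo] --> sigma1 x.
Proof.
apply: nondecreasing_is_cvgn.
  by apply/nondecreasing_seqP => n; exact: sig_approx_nd.
by exists 1 => _ [n _ <-]; have /andP[] := sig_approx01 n x.
Qed.

Lemma sigma1E x : sigma1 x = bhalf (bt x) (sigma1 (shift2 (shift2 x))).
Proof.
rewrite {1}/sigma1; apply: cvg_lim => //.
rewrite -(cvg_shiftS (sig_approx ^~ x)) /= /bhalf.
apply: cvgM; last exact: cvg_cst.
by apply: cvgD; [exact: cvg_cst|exact: cvg_sigma1].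
Qed.

Lemma measurable_sigma1 : measurable_fun setT sigma1.
Proof.
apply: (measurable_fun_cvg (h := sig_approx)); last by move=> x _; exact: cvg_sigma1.
elim=> [|n IH] /=; first exact: measurable_cst.
apply: measurable_funM => //; apply: measurable_funD; first exact: measurable_btR.
by apply: (measurableT_comp IH); exact: measurableT_comp measurable_shift2 measurable_shift2.
Qed.

Lemma measurable_sigma2 : measurable_fun setT sigma2.
Proof. exact: measurableT_comp measurable_sigma1 measurable_shift2. Qed.

Lemma sigma1_01 x : 0 <= sigma1 x <= 1.
Proof.
apply/andP; split.
  by apply: (limr_ge (cvgP _ (@cvg_sigma1 x))); apply: nearW => n;
    have /andP[] := sig_approx01 n x.
by apply: (limr_le (cvgP _ (@cvg_sigma1 x))); apply: nearW => n;
  have /andP[] := sig_approx01 n x.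
Qed.

End uniform.

Section splitting.
Context (R : realType).
Local Notation U := (unif R).

Let D (h k : R -> R) := Ex U (fun x => h (sigma1 x) * k (sigma2 x)) - Ex U h * Ex U k.

Let lip (L : R) (h : R -> R) :=
  [/\ bdm h, (forall y, `|h y| <= 1) & forall y z, `|h y - h z| <= L * `|y - z|].

Let lip_bhalf L h b : lip L h -> lip (L / 2) (fun y => h (bhalf b y)).
Proof.
move=> [bh h1 hL]; split => //; first by apply: bdm_comp bh; exact: measurable_bhalf.
move=> y z; apply: (le_trans (hL _ _)).
rewrite (_ : bhalf b y - bhalf b z = (y - z) / 2); last by rewrite /bhalf; lra.
by rewrite normrM (@ger0_norm _ 2^-1)// mulrA mulrAC.
Qed.

Let bdm_sig (h k : R -> R) : bdm h -> bdm k -> bdm (fun x => h (sigma1 x) * k (sigma2 x)).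
Proof.
move=> bh bk; apply: bdmM; first by apply: bdm_comp bh; exact: measurable_sigma1.
by apply: bdm_comp bk; exact: measurable_sigma2.
Qed.

(** The first two digits of [x] are the leading digits of [sigma1 x] and [sigma2 x]. Once they are
    removed the law is unchanged, so the defect of independence [D] is the average of its four
    rescalings. *)
Let D_bhalf (h k : R -> R) : bdm h -> bdm k -> D h k = 4^-1 *
  (D (fun y => h (bhalf false y)) (fun y => k (bhalf false y)) +
   D (fun y => h (bhalf false y)) (fun y => k (bhalf true y)) +
   D (fun y => h (bhalf true y)) (fun y => k (bhalf false y)) +
   D (fun y => h (bhalf true y)) (fun y => k (bhalf true y))).
Proof.
move=> bh bk.
have bhh (f : R -> R) b : bdm f -> bdm (fun y => f (bhalf b y)).
  by move=> bf; apply: bdm_comp bf; exact: measurable_bhalf.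
pose F2 b c z := h (bhalf b (sigma1 z)) * k (bhalf c (sigma2 z)).
have bF2 b c : bdm (F2 b c) by apply: bdm_sig (bhh _ b bh) (bhh _ c bk).
pose F1 b y := F2 b (bt y) (shift2 y).
have bF1 b : bdm (F1 b).
  rewrite (_ : F1 b = fun x => (bt x : nat)%:R * F2 b true (shift2 x) +
    (1 - (bt x : nat)%:R) * F2 b false (shift2 x)); last first.
    by apply/funext => x; rewrite /F1; case: bt => /=; lra.
  have b1 : bdm (fun x : R => (bt x : nat)%:R : R).
    split; first exact: measurable_btR.
    by exists 1 => x; case: bt; rewrite ?normr1 ?normr0.
  have b2 c : bdm (fun x => F2 b c (shift2 x)).
    by apply: (bdm_comp (@measurable_shift2 R) (bF2 b c)).
  by auto.
rewrite /D.
have -> : Ex U (fun x => h (sigma1 x) * k (sigma2 x)) = Ex U (fun x => F1 (bt x) (shift2 x)).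
  by apply: eq_Ex => x; rewrite /F1 /F2 /sigma2 (sigma1E x) (sigma1E (shift2 x)).
rewrite Ex_unif_bit// /F1 !Ex_unif_bit// (Ex_unif_bhalf bh) (Ex_unif_bhalf bk) /F2.
by lra.
Qed.

Let near0 L h : 0 <= L -> lip L h -> `|Ex U h - h 0| <= L.
Proof.
move=> L0 [bh h1 hL].
rewrite -(Ex_cst U (h 0)) -ExB//.
apply: (le_trans (Ex_abs _ _)); auto.
(* The bound by [L] is available on [0, 1] only; the minimum makes it hold everywhere without
   changing the expectation. *)
rewrite (@ae_Ex _ _ _ U _ (fun y => Num.min `|h y - h 0| L)).
- apply: Ex_le_cst => [|y]; last by rewrite ge_min lexx orbT.
  split; last first.
    exists L => y; rewrite ger0_norm ?ge_min ?lexx ?orbT// le_min L0.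
    by rewrite normr_ge0.
  apply: measurable_minr => //.
  by have [] : bdm (fun x => `|h x - h 0|) by auto.
- by auto.
- split; last first.
    exists L => y; rewrite ger0_norm ?ge_min ?lexx ?orbT// le_min L0.
    by rewrite normr_ge0.
  apply: measurable_minr => //.
  by have [] : bdm (fun x => `|h x - h 0|) by auto.
- have := unif01 R; apply: filterS => y /andP[y0 y1].
  rewrite min_l//; apply: (le_trans (hL _ _)); rewrite subr0 ger0_norm//.
  by rewrite -[leRHS]mulr1 ler_wpM2l.
Qed.

(** Each use of [D_bhalf] halves the Lipschitz constant. For [n = 0] both terms of [D] are within 2L
    of [h 0 * k 0], whence the factor 4. *)
Let D_lip n L h k : 0 <= L -> lip L h -> lip L k -> `|D h k| <= 4 * L / 2 ^+ n.
Proof.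
elim: n L h k => [|n IH] L h k L0 lh lk; last first.
  rewrite D_bhalf; [|by case: lh|by case: lk].
  have H b c : `|D (fun y => h (bhalf b y)) (fun y => k (bhalf c y))| <= 4 * (L / 2) / 2 ^+ n.
    by apply: IH; [exact: divr_ge0|exact: lip_bhalf|exact: lip_bhalf].
  have := H false false; have := H false true; have := H true false; have := H true true.
  have -> : 4 * L / 2 ^+ n.+1 = 4 * (L / 2) / 2 ^+ n by rewrite exprS invfM !mulrA.
  move: (_ / 2 ^+ n) => K; rewrite !ler_norml.
  by move=> /andP[? ?] /andP[? ?] /andP[? ?] /andP[? ?]; apply/andP; split; lra.
rewrite expr0 divr1.
have [bh h1 hL] := lh; have [bk k1 kL] := lk.
have s01 (f : R -> R) (x : R) : lip L f -> 0 <= x <= 1 -> `|f x - f 0| <= L.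
  move=> [_ _ fL] /andP[x0 x1]; apply: (le_trans (fL _ _)); rewrite subr0 ger0_norm//.
  by rewrite -[leRHS]mulr1 ler_wpM2l.
have prod a b a' b' : `|a| <= 1 -> `|b'| <= 1 -> `|a - a'| <= L -> `|b - b'| <= L ->
    `|a * b - a' * b'| <= 2 * L.
  move=> a1 b1 aa bb.
  rewrite (_ : _ - _ = a * (b - b') + (a - a') * b'); last by lra.
  apply: (le_trans (ler_normD _ _)); rewrite !normrM mulr2n mulrDl mul1r.
  by apply: lerD; [rewrite -[leRHS]mul1r|rewrite -[leRHS]mulr1]; exact: ler_pM.
have A : `|Ex U (fun x => h (sigma1 x) * k (sigma2 x)) - h 0 * k 0| <= 2 * L.
  rewrite -(Ex_cst U (h 0 * k 0)) -ExB//; last exact: bdm_sig.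
  apply: Ex_abs_le => [|x]; first by apply: bdmB => //; exact: bdm_sig.
  by apply: prod => //; apply: s01 => //; exact: sigma1_01.
have B : `|Ex U h * Ex U k - h 0 * k 0| <= 2 * L.
  by apply: prod => //; [exact: Ex_abs_le|exact: near0|exact: near0].
rewrite /D; move: A B; rewrite !ler_norml => /andP[? ?] /andP[? ?].
by apply/andP; split; lra.
Qed.

Let D_lip0 L h k : 0 <= L -> lip L h -> lip L k -> D h k = 0.
Proof.
move=> L0 lh lk; apply/eqP; rewrite -normr_le0; apply/ler_addgt0Pl => e e0.
rewrite addr0; pose n := Num.truncn (4 * L / e).
apply: (le_trans (D_lip n L0 lh lk)).
rewrite ler_pdivrMr ?exprn_gt0// [leRHS]mulrC -ler_pdivrMr//.
apply: (le_trans (ltW (truncnS_gt _))).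
have -> : 2 ^+ n = (2 ^ n)%N%:R :> R by rewrite natrX.
by rewrite ler_nat; exact: ltn_expl.
Qed.

(** Lipschitz functions increasing with [n] to the indicator of a half-line; through them [D_lip0]
    reaches measurable functions. *)
Let ramp (s : R) (n : nat) (y : R) := Num.max 0 (Num.min 1 (n%:R * (s - y))).

Let lip_ramp s n : lip n%:R (ramp s n).
Proof.
have r1 y : `|ramp s n y| <= 1.
  rewrite ger0_norm ?/ramp; last by rewrite le_max lexx.
  by rewrite ge_max ler01 ge_min lexx.
split => //.
- split; last by exists 1.
  apply: measurable_maxr => //; apply: measurable_minr => //.
  by apply: measurable_funM => //; exact: measurable_funB.
- move=> y z.
  rewrite -[X in X * `|_|](ger0_norm (ler0n R n)) -normrM.
  rewrite (_ : n%:R * (y - z) = n%:R * (s - z) - n%:R * (s - y)); last by lra.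
  rewrite /ramp; move: (n%:R * (s - y)) (n%:R * (s - z)) => a b.
  rewrite ler_norml.
  case: (ger0P (b - a)) => ?;
  (case: (leP 1 a) => ?; case: (leP 1 b) => ?; try case: (leP 0 a) => ?; try case: (leP 0 b) => ?;
    rewrite ?(max_r (@ler01 R)); try (apply/andP; split; lra)).
Qed.

Let cvg_ramp s x : ramp s n x @[n --> \oo] --> (\1_(`]-oo, s[%classic) x : R).
Proof.
rewrite indicE; have [xs|sx] := ltP x s.
  rewrite mem_set/=; last by rewrite /= in_itv.
  apply: cvg_near_cst; exists (Num.truncn (s - x)^-1).+1 => // n /= Nn.
  rewrite /ramp min_l ?max_r//.
  rewrite -ler_pdivrMr ?subr_gt0// mul1r.
  apply: (le_trans (ltW (truncnS_gt _))); rewrite ler_nat; exact: Nn.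
rewrite memNset/=; last by rewrite /= in_itv /= ltNge sx.
apply: cvg_near_cst; apply: nearW => n.
rewrite /ramp max_l// ge_min; apply/orP; right.
by apply: mulr_ge0_le0 => //; rewrite subr_le0.
Qed.

(** Passage from Lipschitz to bounded measurable functions in one argument, the other being fixed.
    It is stated for general [phi] and [psi] because [Ex_split] applies it to each argument in
    turn. *)
Let bilin (phi psi k : R -> R) : measurable_fun setT phi -> measurable_fun setT psi -> bdm k ->
  (forall L h, 0 <= L -> lip L h ->
    Ex U (fun x => h (phi x) * k (psi x)) - Ex U h * Ex U k = 0) ->
  forall h, bdm h -> Ex U (fun x => h (phi x) * k (psi x)) - Ex U h * Ex U k = 0.
Proof.
move=> mphi mpsi bk Dlip.
pose D' h := Ex U (fun x => h (phi x) * k (psi x)) - Ex U h * Ex U k.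
have [_ [M hM]] := bk.
pose Ps (b : bool) := if b then law U mphi else U.
have sumE f : bdm f -> \sum_i Ex (Ps i) (fun x => `|f x|) =
    Ex U (fun x => `|f (phi x)|) + Ex U (fun x => `|f x|).
  move=> bf; rewrite big_bool /=; congr (_ + _).
  by rewrite (Ex_mpres (mpres_law U mphi) (bdm_abs bf)).
have b1 (f : R -> R) : bdm f -> bdm (fun x => f (phi x)).
  by move=> bf; apply: bdm_comp bf.
have b2 : bdm (fun x => k (psi x)) by apply: bdm_comp bk.
have b12 (f : R -> R) : bdm f -> bdm (fun x => f (phi x) * k (psi x)).
  by move=> bf; apply: bdmM => //; exact: b1.
have DD f g : bdm f -> bdm g -> D' (fun x => f x + g x) = D' f + D' g.
  move=> bf bg; rewrite /D' (ExD _ bf bg).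
  have -> : Ex U (fun x => (f (phi x) + g (phi x)) * k (psi x)) =
      Ex U (fun x => f (phi x) * k (psi x)) + Ex U (fun x => g (phi x) * k (psi x)).
    by rewrite -(ExD _ (b12 _ bf) (b12 _ bg)); apply: eq_Ex => x; rewrite mulrDl.
  by lra.
have DZ a f : bdm f -> D' (fun x => a * f x) = a * D' f.
  move=> bf; rewrite /D' (ExZ _ _ bf).
  have -> : Ex U (fun x => a * f (phi x) * k (psi x)) =
      a * Ex U (fun x => f (phi x) * k (psi x)).
    by rewrite -(ExZ _ _ (b12 _ bf)); apply: eq_Ex => x; rewrite mulrA.
  by lra.
have Dc f : bdm f -> `|D' f| <= M * \sum_i Ex (Ps i) (fun x => `|f x|).
  move=> bf; rewrite sumE// mulrDr /D'.
  apply: (le_trans (ler_normB _ _)); apply: lerD.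
    apply: (le_trans (Ex_abs _ (b12 _ bf))).
    rewrite -ExZ; last exact: bdm_abs (b1 _ bf).
    apply: le_Ex; [exact: bdm_abs (b12 _ bf)|apply: bdmM => //; exact: bdm_abs (b1 _ bf)|move=> x].
    by rewrite normrM mulrC ler_wpM2r.
  rewrite normrM mulrC; apply: ler_pM => //; first exact: Ex_abs_le.
  exact: Ex_abs.
apply: (linear_functional_eq0 DD DZ Dc (@Iio_systemE R) (@Iio_systemI R)).
  move=> _ [s ->]; apply: (linear_functional_lim DD DZ Dc (h := ramp s)).
  - by apply: bdm_indic; exact: measurable_itv.
  - by move=> n; have [br _ _] := lip_ramp s n; split => //; apply: Dlip (lip_ramp s n).
  - apply: (Ex_dct_fin Ps (M := 1)).
    + by move=> n; have [[]] := lip_ramp s n.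
    + by move=> n; have [_] := lip_ramp s n.
    + by apply: bdm_indic; exact: measurable_itv.
    + exact: cvg_ramp.
apply: (Dlip 0) => //; split => // y; first by rewrite normr1.
by move=> z; rewrite subrr normr0 mul0r.
Qed.

(** Independence and uniformity at once: with one function constant, the identity says that
    [sigma1 x] or [sigma2 x] is uniform. *)
Theorem Ex_split (h k : R -> R) : bdm h -> bdm k ->
  Ex U (fun x => h (sigma1 x) * k (sigma2 x)) = Ex U h * Ex U k.
Proof.
move=> bh bk; apply/eqP; rewrite -subr_eq0; apply/eqP.
apply: bilin bh => //; [exact: measurable_sigma1|exact: measurable_sigma2|move=> L {}h L0 lh].
have -> : Ex U (fun x => h (sigma1 x) * k (sigma2 x)) =
    Ex U (fun x => k (sigma2 x) * h (sigma1 x)) by apply: eq_Ex => x; rewrite mulrC.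
rewrite [X in _ - X]mulrC.
apply: bilin bk; [exact: measurable_sigma2|exact: measurable_sigma1|by case: lh|move=> L' {}k L0' lk].
have -> : Ex U (fun x => k (sigma2 x) * h (sigma1 x)) =
    Ex U (fun x => h (sigma1 x) * k (sigma2 x)) by apply: eq_Ex => x; rewrite mulrC.
rewrite [X in _ - X]mulrC.
have lipW f l : lip l f -> l <= L + L' -> lip (L + L') f.
  move=> [bf f1 fl] le_l; split => // y z; apply: (le_trans (fl y z)).
  exact: ler_wpM2r.
apply: (D_lip0 (L := L + L')); first exact: addr_ge0.
  by apply: (lipW _ L) => //; rewrite lerDl.
by apply: (lipW _ L') => //; rewrite lerDr.
Qed.

End splitting.

(** * Infinite cubes *)

Section rho.
Context (R : realType).
Local Notation U := (unif R).

(** The half [sigma2] left over is split again and again: the [rho n] are independent uniform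
    variables read off a single real. *)
Definition rho n (x : R) : R := sigma1 (iter n (@sigma2 R) x).

Lemma measurable_iter_sigma2 n : measurable_fun setT (fun x : R => iter n (@sigma2 R) x).
Proof.
elim: n => [|n IH] /=; first exact: measurable_id.
exact: measurableT_comp (@measurable_sigma2 R) IH.
Qed.

Lemma measurable_rho n : measurable_fun setT (rho n).
Proof. exact: measurableT_comp (@measurable_sigma1 R) (@measurable_iter_sigma2 n). Qed.

Lemma rho01 n x : 0 <= rho n x <= 1.
Proof. exact: sigma1_01. Qed.

(** The factor in [H] stands for the digits not yet read; with it the induction on [n] closes. *)
Lemma Ex_rho_ord n (h : nat -> R -> R) (H : R -> R) : (forall k, bdm (h k)) -> bdm H ->
  Ex U (fun x => (\prod_(k < n) h k (rho k x)) * H (iter n (@sigma2 R) x)) =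
  (\prod_(k < n) Ex U (h k)) * Ex U H.
Proof.
move=> bh bH; elim: n h bh => [|n IH] h bh.
  by rewrite big_ord0 mul1r; apply: eq_Ex => x; rewrite big_ord0 mul1r.
pose K y := (\prod_(k < n) h k.+1 (rho k y)) * H (iter n (@sigma2 R) y).
have bK : bdm K.
  apply: bdmM; last by apply: bdm_comp bH; exact: measurable_iter_sigma2.
  by apply: bdm_prod => k; apply: bdm_comp (bh _); exact: measurable_rho.
rewrite big_ord_recl -mulrA -(IH (fun k => h k.+1))//.
rewrite -[RHS](Ex_split (bh 0%N) bK); apply: eq_Ex => x.
rewrite big_ord_recl -mulrA; congr (_ * _).
rewrite /K -iterSr; congr (_ * _); apply: eq_bigr => k _.
by rewrite /rho -iterSr.
Qed.

Lemma Ex_rho_seq (s : seq nat) (h : nat -> R -> R) : uniq s -> (forall k, bdm (h k)) ->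
  Ex U (fun x => \prod_(k <- s) h k (rho k x)) = \prod_(k <- s) Ex U (h k).
Proof.
move=> us bh.
pose n := (\max_(k <- s) k.+1)%N.
(* Indices outside [s] get the factor 1, so that the product over the list becomes one over an
   initial segment. *)
pose h' k := if k \in s then h k else fun=> 1.
have bh' k : bdm (h' k) by rewrite /h'; case: ifP.
have E (f : nat -> R) :
    \prod_(k <- s) f k = \prod_(k < n) (if (k : nat) \in s then f k else 1).
  transitivity (\prod_(k <- [seq k <- index_iota 0 n | k \in s]) f k); last first.
    by rewrite big_filter big_mkcond big_mkord.
  apply: perm_big; apply: uniq_perm => //; first by rewrite filter_uniq// iota_uniq.
  move=> k; rewrite mem_filter mem_index_iota /=.
  have [ks|//] := boolP (k \in s); rewrite /= /n.
  by rewrite (big_rem k ks) /= leq_max leqnn.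
have := @Ex_rho_ord n h' (fun=> 1) bh' (bdm_cst _ _).
rewrite Ex_cst mulr1 E => h1; rewrite (_ : \prod_(k < n) _ = \prod_(k < n) Ex U (h' k)).
  rewrite -h1; apply: eq_Ex => x; rewrite mulr1 E; apply: eq_bigr => k _.
  by rewrite /h'; case: ifP.
by apply: eq_bigr => k _; rewrite /h'; case: ifP => //; rewrite Ex_cst.
Qed.

End rho.

Definition Omega (R : realType) (I : countType) : Type := I -> R.

HB.instance Definition _ (R : realType) (I : countType) :=
  Pointed.copy (Omega R I) (I -> R).

Section Omega_measurable.
Context (R : realType) (I : countType).

Definition boxes : set (set (Omega R I)) :=
  [set A | exists (s : seq I) (B : I -> set R), (forall i, measurable (B i)) /\
     A = [set w | forall i, i \in s -> B i (w i)]].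

HB.instance Definition _ := @isMeasurable.Build default_measure_display (Omega R I)
  <<s boxes >> (@sigma_algebra0 _ _ boxes) (@sigma_algebraC _ boxes)
  (@sigma_algebra_bigcup _ _ boxes).

Lemma boxesE : @measurable _ (Omega R I) = <<s boxes >>.
Proof. by []. Qed.

Lemma boxesI : setI_closed boxes.
Proof.
move=> _ _ [s [B [mB ->]]] [t [C [mC ->]]].
exists (s ++ t), (fun i => (if i \in s then B i else setT) `&` (if i \in t then C i else setT)).
split; first by move=> i; apply: measurableI; case: ifP.
apply/seteqP; split => w /=.
  move=> [hB hC] i _; split; first by case: ifP => // /hB.
  by case: ifP => // /hC.
move=> h; split => i si.
  by have [] := h i _; rewrite ?mem_cat ?si//.
by have [] := h i _; rewrite ?mem_cat ?si ?orbT//.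
Qed.

Lemma measurable_coord (i : I) : measurable_fun setT (fun w : Omega R I => w i).
Proof.
move=> _ B mB; rewrite setTI; apply: sub_sigma_algebra.
exists [:: i], (fun=> B); split => //; apply/seteqP; split => w /=.
  by move=> h j; rewrite inE => /eqP ->.
by move=> /(_ i); rewrite inE eqxx; apply.
Qed.

Lemma measurable_Omega d (T : measurableType d) (phi : T -> Omega R I) :
  (forall i, measurable_fun setT (fun x => phi x i)) -> measurable_fun setT phi.
Proof.
move=> mphi; apply: (measurability boxes) => //.
move=> _ [_ [s [B [mB ->]]] <-].
rewrite setTI (_ : _ @^-1` _ = \bigcap_(i in [set` s]) ((fun x => phi x i) @^-1` B i)).
  apply: fin_bigcap_measurable => [|i _]; first exact: finite_seq.
  by rewrite -[X in measurable X]setTI; exact: mphi.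
by apply/seteqP; split => x /= h i => /h.
Qed.

Lemma indic_box (s : seq I) (B : I -> set R) (w : Omega R I) :
  \1_[set w : Omega R I | forall i, i \in s -> B i (w i)] w =
  \prod_(i <- undup s) \1_(B i) (w i) :> R.
Proof.
rewrite indicE; have [/set_mem /= h|/negP h] := boolP (w \in _).
  rewrite big_seq big1// => i; rewrite mem_undup => /h Bi.
  by rewrite indicE mem_set.
have [i [si nBi]] : exists i, i \in s /\ ~ B i (w i).
  apply: contrapT => nex; apply: h; apply/mem_set => /= i si.
  by apply: contrapT => nB; apply: nex; exists i.
rewrite (big_rem i) ?mem_undup//= indicE memNset// mul0r//.
Qed.

Lemma Ex_Omega_unique (P Q : probability (Omega R I) R) :
  (forall (s : seq I) (h : I -> R -> R), uniq s -> (forall i, bdm (h i)) ->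
    Ex P (fun w => \prod_(i <- s) h i (w i)) = Ex Q (fun w => \prod_(i <- s) h i (w i))) ->
  forall X, bdm X -> Ex P X = Ex Q X.
Proof.
move=> h; apply: (eq_probability_Ex boxesE boxesI) => A GA.
have mA : measurable A by exact: sub_sigma_algebra.
rewrite -!Ex_indic//; congr (_%:E).
have [s [B [mB AE]]] := GA.
transitivity (Ex P (fun w => \prod_(i <- undup s) \1_(B i) (w i))).
  by apply: eq_Ex => w; rewrite AE indic_box.
apply: (etrans (h (undup s) (fun i => \1_(B i)) (undup_uniq _) _)).
  by move=> i; exact: bdm_indic.
by apply: eq_Ex => w; rewrite AE indic_box.
Qed.

Lemma measurable_rho_seq : measurable_fun setT (fun (x : R) => (fun i : I => rho (choice.pickle i) x) : Omega R I).
Proof. by apply: measurable_Omega => i; exact: measurable_rho. Qed.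

End Omega_measurable.

(** The product of countably many uniform laws, realised as the image of one uniform real under its
    digit sequences [rho]. *)
HB.lock Definition iid (R : realType) (I : countType) : probability (Omega R I) R :=
  law (unif R) (@measurable_rho_seq R I).

Section iid.
Context (R : realType) (I : countType).
Local Notation U := (unif R).
Local Notation P := (iid R I).

Lemma mpres_rho : mpres U P (fun x => (fun i : I => rho (choice.pickle i) x)).
Proof. by rewrite iid.unlock; exact: mpres_law. Qed.

Lemma bdm_prod_coord (s : seq I) (h : I -> R -> R) : (forall i, bdm (h i)) ->
  bdm (fun w : Omega R I => \prod_(i <- s) h i (w i)).
Proof.
move=> bh; apply: bdm_prod => i; apply: (bdm_comp (@measurable_coord R I i) (bh i)).
Qed.

Lemma Ex_iid_prod (s : seq I) (h : I -> R -> R) : uniq s -> (forall i, bdm (h i)) ->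
  Ex P (fun w => \prod_(i <- s) h i (w i)) = \prod_(i <- s) Ex U (h i).
Proof.
move=> us bh; rewrite -(Ex_mpres mpres_rho (bdm_prod_coord s bh)).
pose h' k := if choice.unpickle k is Some i then h i else fun=> 1.
have bh' k : bdm (h' k) by rewrite /h'; case: choice.unpickle.
have := Ex_rho_seq (s := map choice.pickle s) (h := h') _ bh'.
rewrite map_inj_uniq; last exact: (pcan_inj choice.pickleK).
move=> /(_ us); rewrite big_map (eq_bigr (fun i => Ex U (h i))); last first.
  by move=> i _; rewrite /h' choice.pickleK.
move=> <-; apply: eq_Ex => x; rewrite big_map; apply: eq_bigr => i _.
by rewrite /h' choice.pickleK.
Qed.

Lemma mpres_iid d (T : measurableType d) (Q : probability T R) (phi : T -> Omega R I) :
  measurable_fun setT phi ->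
  (forall (s : seq I) (h : I -> R -> R), uniq s -> (forall i, bdm (h i)) ->
    Ex Q (fun x => \prod_(i <- s) h i (phi x i)) = \prod_(i <- s) Ex U (h i)) ->
  mpres Q P phi.
Proof.
move=> mphi h; apply: mpres_Ex => // A mA.
transitivity (Ex (law Q mphi) \1_A).
  by rewrite -(Ex_mpres (mpres_law Q mphi) (bdm_indic R mA)).
apply: Ex_Omega_unique; last exact: bdm_indic.
move=> s f us bf; rewrite Ex_iid_prod// -h//.
by rewrite -(Ex_mpres (mpres_law Q mphi) (bdm_prod_coord s bf)).
Qed.

Lemma mpres_coord (i : I) : mpres P U (fun w => w i).
Proof.
apply: mpres_Ex => [|A mA]; first exact: measurable_coord.
have := @Ex_iid_prod [:: i] (fun=> \1_A) isT (fun=> bdm_indic R mA).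
by rewrite big_seq1 => <-; apply: eq_Ex => w; rewrite big_seq1.
Qed.

End iid.

Section relabel.
Context (R : realType) (I J : countType).

Lemma measurable_relabel (s : J -> I) :
  measurable_fun setT (fun w : Omega R I => (w \o s : Omega R J)).
Proof. by apply: measurable_Omega => j; exact: measurable_coord. Qed.

Lemma mpres_relabel (s : J -> I) : injective s ->
  mpres (iid R I) (iid R J) (fun w => w \o s).
Proof.
move=> injs; apply: mpres_iid => [|t h ut bh]; first exact: measurable_relabel.
(* A nonempty list supplies the default value [j0] used to invert [s] on it. *)
case: t ut => [|j0 t'] ut.
  by rewrite big_nil -[RHS](Ex_cst (iid R I)); apply: eq_Ex => w; rewrite big_nil.
set t := j0 :: t' in ut *.
pose h' i := h (nth j0 t (index i (map s t))).
have h'E j : j \in t -> h' (s j) = h j.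
  by move=> jt; rewrite /h' index_map// nth_index.
have := @Ex_iid_prod R I (map s t) h' _ (fun i => bh _).
rewrite map_inj_uniq// big_map => /(_ ut).
have <- : \prod_(j <- t) Ex (unif R) (h' (s j)) = \prod_(j <- t) Ex (unif R) (h j).
  by apply: eq_big_seq => j /h'E ->.
move=> <-; apply: eq_Ex => w; rewrite big_map; apply: eq_big_seq => j /h'E ->.
by [].
Qed.

End relabel.

(** * Conditional expectation by resampling coordinates *)

Section splice.
Context (R : realType) (I : countType).
Local Notation P := (iid R I).
Implicit Types (S D : pred I) (w : Omega R I) (F G H : Omega R I -> R).

Definition dep (X : Type) S (F : Omega R I -> X) :=
  forall w w', (forall i, S i -> w i = w' i) -> F w = F w'.

Definition splice S w w' : Omega R I := fun i => if S i then w i else w' i.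

(** A version of the conditional expectation of [F] given the coordinates in [S], obtained by
    resampling the others. It is defined at every point and depends on the coordinates in [S]
    exactly, not up to null sets. *)
Definition condE S (F : Omega R I -> R) : Omega R I -> R :=
  fun w => Ex P (fun w' => F (splice S w w')).

Lemma measurable_splice S :
  measurable_fun setT (fun p : Omega R I * Omega R I => splice S p.1 p.2).
Proof.
apply: measurable_Omega => i; rewrite /splice; case: (S i).
  exact: measurableT_comp (@measurable_coord R I i) measurable_fst.
exact: measurableT_comp (@measurable_coord R I i) measurable_snd.
Qed.

Lemma measurable_splicer S w : measurable_fun setT (splice S w).
Proof.
have := measurableT_comp (@measurable_splice S)
  (@measurable_pair_l _ _ (Omega R I) (Omega R I) w).
exact.
Qed.

Lemma mpres_splice S : mpres (P \x P)%E P (fun p => splice S p.1 p.2).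
Proof.
apply: mpres_iid => [|s h us bh]; first exact: measurable_splice.
have b1 (Q : pred I) : bdm (fun w : Omega R I => \prod_(i <- s | Q i) h i (w i)).
  rewrite [X in bdm X](_ : _ = fun w => \prod_(i <- s) (if Q i then h i (w i) else 1)).
    apply: bdm_prod => i; case: (Q i) => //.
    exact: (bdm_comp (@measurable_coord R I i) (bh i)).
  by apply/funext => w; rewrite big_mkcond.
have Eh (Q : pred I) : Ex P (fun w => \prod_(i <- s | Q i) h i (w i)) =
    \prod_(i <- s | Q i) Ex (unif R) (h i).
  rewrite -big_filter -Ex_iid_prod ?filter_uniq//.
  by apply: eq_Ex => w; rewrite big_filter.
rewrite Ex_Fubini; last first.
  by apply: (bdm_comp (@measurable_splice S) (bdm_prod_coord s bh)).
rewrite [RHS](bigID S) /= -!Eh mulrC -ExZ//; apply: eq_Ex => w.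
rewrite mulrC -ExZ//; apply: eq_Ex => w'; rewrite [LHS](bigID S) /=.
by congr (_ * _); apply: eq_bigr => i Si; rewrite /splice ?Si// (negbTE Si).
Qed.

Lemma bdm_splice S F : bdm F -> bdm (fun p => F (splice S p.1 p.2)).
Proof. by move=> bF; apply: (bdm_comp (@measurable_splice S) bF). Qed.

Lemma bdm_condE S F : bdm F -> bdm (condE S F).
Proof. by move=> bF; exact: (bdm_Ex P P (bdm_splice S bF)). Qed.

Lemma bdm_splicer S F w : bdm F -> bdm (fun w' => F (splice S w w')).
Proof. by move=> bF; apply: (bdm_comp (measurable_splicer S w) bF). Qed.

Lemma Ex_splice S F : bdm F -> Ex P F = Ex P (condE S F).
Proof.
move=> bF; rewrite -(Ex_mpres (mpres_splice S) bF).
by rewrite Ex_Fubini//; exact: bdm_splice.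
Qed.

Lemma dep_condE S D F : dep D F -> dep [predI S & D] (condE S F).
Proof.
move=> dF w w' ww'; apply: eq_Ex => v; apply: dF => i Di; rewrite /splice.
by case: ifP => // Si; apply: ww'; apply/andP.
Qed.

Lemma depW (X : Type) S S' (F : Omega R I -> X) :
  (forall i, S i -> S' i) -> dep S F -> dep S' F.
Proof. by move=> SS dF w w' ww'; apply: dF => i /SS; exact: ww'. Qed.

Lemma condE_id S F w : dep S F -> condE S F w = F w.
Proof.
move=> dF; rewrite -[RHS](Ex_cst P); apply: eq_Ex => v; apply: dF => i Si.
by rewrite /splice Si.
Qed.

Lemma condE_indep S D F w : dep D F -> (forall i, D i -> ~~ S i) ->
  condE S F w = Ex P F.
Proof.
move=> dF DS; apply: eq_Ex => v; apply: dF => i Di.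
by rewrite /splice (negbTE (DS i Di)).
Qed.

(** Resampling outside [S] leaves [H] unchanged: [condE S] is the orthogonal projection onto the
    functions of the coordinates in [S]. *)
Lemma Ex_condE S H F : dep S H -> bdm H -> bdm F ->
  Ex P (fun w => H w * condE S F w) = Ex P (fun w => H w * F w).
Proof.
move=> dH bH bF; rewrite [RHS](Ex_splice S); last by auto.
apply: eq_Ex => w; rewrite /condE -ExZ; last exact: bdm_splicer.
apply: eq_Ex => v; congr (_ * _); apply: dH => i Si.
by rewrite /splice Si.
Qed.

Lemma Ex_indep S D F G : dep S F -> dep D G -> (forall i, D i -> ~~ S i) ->
  bdm F -> bdm G -> Ex P (fun w => F w * G w) = Ex P F * Ex P G.
Proof.
move=> dF dG DS bF bG; rewrite -(Ex_condE dF)// mulrC -ExZ//.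
by apply: eq_Ex => w; rewrite (condE_indep _ dG DS) mulrC.
Qed.

End splice.

(** Resampling commutes with [phi]. This moves conditional expectations from sites to coordinates of
    vertex sets and along relabelings. *)
Lemma condE_morph (R : realType) (I J : countType) (S : pred I) (S' : pred J)
    (phi : Omega R I -> Omega R J) (F : Omega R J -> R) w :
  mpres (iid R I) (iid R J) phi -> bdm F ->
  (forall w w', phi (splice S w w') = splice S' (phi w) (phi w')) ->
  condE S (F \o phi) w = condE S' F (phi w).
Proof.
move=> mphi bF sphi; rewrite /condE.
rewrite -(Ex_mpres mphi (bdm_splicer S' (phi w) bF)).
by apply: eq_Ex => w'; rewrite /= sphi.
Qed.

(** * Random structures *)

Section atoms.
Context (R : realType) (L : language) (W : countType).

Definition atom : countType := {P : L & (arity P).-tuple W}.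

Definition supp (b : atom) : seq W := tagged b.

Definition face k (t : k.-tuple W) (A : r 'I_k) : {fset W} :=
  [fset tnth t i | i in enum (val A)]%fset.

Lemma faceP k (t : k.-tuple W) (A : r 'I_k) x :
  reflect (exists2 i, i \in val A & x = tnth t i) (x \in face t A).
Proof.
apply: (iffP (imfsetP _ _ _ _)) => -[i]; rewrite ?mem_enum => iA ->.
  by exists i => //; move: iA; rewrite /= mem_enum.
by exists i => //; rewrite /= mem_enum.
Qed.

Lemma face_sub (b : atom) (A : r 'I_(arity (tag b))) x :
  x \in face (tagged b) A -> x \in supp b.
Proof. by move=> /faceP [i _ ->]; exact: mem_tnth. Qed.

(* Truth values of the atoms in the structure on [W] sampled at the point [X] of
   the infinite cube. *)
Definition bits (N : forall P : L, set (Omega R (r 'I_(arity P))))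
    (X : Omega R {fset W}) : Omega R atom :=
  fun b => (uniq (supp b) && `[< N (tag b) (X \o face (tagged b)) >])%:R.

Lemma dep_bits N b :
  dep (fun C : {fset W} => all (mem (supp b)) C) (fun X => bits N X b).
Proof.
move=> X Y XY; rewrite /bits; congr (_ && `[< _ >])%:R.
congr (N _ _); apply/funext => A /=; apply: XY; apply/allP => x; exact: face_sub.
Qed.

Lemma measurable_bits N : (forall P, measurable (N P)) -> measurable_fun setT (bits N).
Proof.
move=> mN; apply: measurable_Omega => b.
rewrite (_ : (fun X => bits N X b) = (fun X => if uniq (supp b) then
    \1_(N (tag b)) ((X \o face (tagged b)) : Omega R _) else 0)); last first.
  apply/funext => X; rewrite /bits; case: (uniq (supp b)); last by [].
  rewrite andTb indicE.
  have [h|h] := pselect (N (tag b) (X \o face (tagged b))).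
    by rewrite asboolT// mem_set.
  by rewrite asboolF// memNset.
case: (uniq _) => /=; last exact: measurable_cst.
have h : measurable_fun setT (fun X : Omega R {fset W} =>
    (X \o face (tagged b)) : Omega R (r 'I_(arity (tag b)))).
  exact: measurable_relabel.
have m1 : measurable_fun setT (\1_(N (tag b)) : _ -> R).
  by apply: measurable_indic; exact: mN.
exact: (measurableT_comp m1 h).
Qed.

End atoms.

Arguments supp {L W} b.
Arguments bits {R L W} N X.

Lemma imfset_injective (K K' : choiceType) (s : K -> K') : injective s ->
  injective (fun A : {fset K} => [fset s x | x in A]%fset).
Proof.
move=> injs A B AB; apply/fsetP => x.
have : (s x \in [fset s x | x in A]%fset) = (s x \in [fset s x | x in B]%fset) by rewrite AB.
by rewrite !mem_imfset.
Qed.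

Section map_atom.
Context (R : realType) (L : language) (W W' : countType).

Definition map_atom (s : W -> W') (b : atom L W) : atom L W' :=
  Tagged (fun P : L => (arity P).-tuple W') (map_tuple s (tagged b)).

Lemma supp_map_atom s b : supp (map_atom s b) = map s (supp b).
Proof. by []. Qed.

Lemma bits_map (N : forall P : L, set (Omega R (r 'I_(arity P)))) (s : W -> W')
    (X : Omega R {fset W'}) b : injective s ->
  bits N (fun C : {fset W} => X (s @` C)%fset) b = bits N X (map_atom s b).
Proof.
move=> injs; rewrite /bits supp_map_atom map_inj_uniq//; congr (_ && `[< _ >])%:R.
congr (N _ _); apply/funext => A /=; congr X; apply/fsetP => x.
apply/imfsetP/faceP => [[y /faceP[i iA ->] ->]|[i iA ->]].
  by exists i => //; rewrite tnth_map.
exists (tnth (tagged b) i); last by rewrite tnth_map.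
by apply/faceP; exists i.
Qed.

Lemma mpres_map_fset (s : W -> W') : injective s ->
  mpres (iid R {fset W'}) (iid R {fset W}) (fun X => fun C : {fset W} => X (s @` C)%fset).
Proof. by move=> injs; apply: mpres_relabel; exact: imfset_injective. Qed.

End map_atom.

(** * Gowers-Cauchy-Schwarz and approximation by functions of smaller atoms *)

Section swap.
Context (W : eqType) (i i' : W).

Definition swap (x : W) := if x == i then i' else if x == i' then i else x.

Lemma swapK : involutive swap.
Proof.
move=> x; rewrite /swap; case: (eqVneq x i) => [->|xi].
  by case: (eqVneq i' i) => [->|]//; rewrite eqxx.
case: (eqVneq x i') => [->|xi']; first by rewrite eqxx.
by rewrite (negbTE xi) (negbTE xi').
Qed.

Lemma swap_inj : injective swap. Proof. exact: can_inj swapK. Qed.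

Lemma swap_id x : x != i -> x != i' -> swap x = x.
Proof. by rewrite /swap => /negbTE -> /negbTE ->. Qed.

Lemma swap_eq x : x != i' -> swap x != i.
Proof.
move=> xi'; rewrite /swap; case: (eqVneq x i) => [xi|//]; last by rewrite (negbTE xi').
by rewrite eq_sym -xi.
Qed.

End swap.

Section gowers.
Context (R : realType) (L : language) (W : countType).
Context (N : forall P : L, set (Omega R (r 'I_(arity P)))) (mN : forall P, measurable (N P)).
Context (Z : pred W) (V : {fset W}).
Hypothesis fresh : forall D : {fset W}, exists2 z, Z z & z \notin D.
Hypothesis VZ : forall i, i \in V -> Z i.
Local Notation P := (iid R {fset W}).
Local Notation bitsN := (bits N).
Local Notation above D C := (all (mem (D : {fset W})) (C : {fset W})).

Definition inD (D : {fset W}) : pred (atom L W) :=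
  fun b => all (fun x => (x \in D) && Z x) (supp b).

(** The test functions: bounded by 1, reading atoms over [Z] that omit some vertex of [V]. Only
    finitely many vertices are involved at a time, so that a fresh one always remains. *)
Definition low (h : Omega R (atom L W) -> R) := [/\ bdm h, forall e, `|h e| <= 1 &
  exists D, dep [predI inD D & fun b => has (fun i => i \notin supp b) V] h].

Lemma dep_bits_inD (D : {fset W}) (X : Type) (F : Omega R (atom L W) -> X) :
  dep (inD D) F -> dep (fun C : {fset W} => above D C) (fun X => F (bitsN X)).
Proof.
move=> dF X1 X2 X12; apply: dF => b /allP bD; apply: (@dep_bits R L W N b) => C /allP Cb.
by apply: X12; apply/allP => x xC; have /andP[] := bD _ (Cb _ xC).
Qed.

Lemma bdm_bits (F : Omega R (atom L W) -> R) : bdm F -> bdm (fun X => F (bitsN X)).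
Proof. by move=> bF; apply: (bdm_comp (measurable_bits mN) bF). Qed.

(* The Gowers-Cauchy-Schwarz step: two copies of G with conditionally
   independent i-parts are G and its image under exchanging i with a fresh vertex. *)
Lemma Ex_condE_swap (D : {fset W}) (i i' : W) (G : Omega R {fset W} -> R) :
  i' \notin D -> i \in D -> bdm G -> dep (fun C : {fset W} => above D C) G ->
  Ex P (fun X => condE (fun C : {fset W} => i \notin C) G X ^+ 2) =
  Ex P (fun X => G X * G (fun C => X (swap i i' @` C)%fset)).
Proof.
move=> i'D iD bG dG; set S := fun C : {fset W} => i \notin C; set c := condE S G.
have bc : bdm c by exact: bdm_condE.
pose phi (X : Omega R {fset W}) : Omega R {fset W} := fun C => X (swap i i' @` C)%fset.
have mphi : mpres P P phi by apply: mpres_map_fset; exact: swap_inj.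
have bGp : bdm (fun X => G (phi X)) by apply: bdm_comp bG; case: mphi.
have dGp : dep S (fun X => G (phi X)).
  move=> X Y XY; apply: dG => C /allP CD; rewrite /phi; apply: XY.
  apply/imfsetP => -[x /= xC].
  move/eqP; rewrite eq_sym; apply/negP; apply: swap_eq.
  by apply: contra i'D => /eqP <-; exact: CD.
have cphi X : c (phi X) = c X.
  apply: (dep_condE (S := S) dG) => C /andP[iC /allP CD]; rewrite /phi; congr X.
  rewrite -[RHS]imfset_id; apply: eq_in_imfset => x xC /=.
  by apply: swap_id; [apply: contraNneq iC => <-|apply: contraNneq i'D => <-; exact: CD].
transitivity (Ex P (fun X => G (phi X) * c X)); last first.
  by rewrite Ex_condE//; apply: eq_Ex => X; rewrite mulrC.
transitivity (Ex P (fun X => G X * c X)).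
  transitivity (Ex P (fun X => c X * G X)); last by apply: eq_Ex => X; rewrite mulrC.
  transitivity (Ex P (fun X => c X * c X)); first by apply: eq_Ex => X; rewrite expr2.
  by apply: Ex_condE => //; apply: depW (dep_condE (S := S) dG) => C /andP[].
have bGc : bdm (fun X => G X * c X) by auto.
by rewrite -(Ex_mpres mphi bGc); apply: eq_Ex => X; rewrite cphi.
Qed.

(** Induction on [s]. The factor [u i] ignores the sets containing [i]; Cauchy-Schwarz over the
    coordinates of the other sets removes it and multiplies [F], and each remaining factor, by its
    image under exchanging [i] with a fresh vertex. Every removal squares the expectation, whence
    the exponent. *)
Lemma gowers (s : seq W) (D : {fset W}) (F : Omega R (atom L W) -> R)
    (u : W -> Omega R {fset W} -> R) :
  uniq s -> {subset s <= V} -> (V `<=` D)%fset ->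
  bdm F -> (forall e, `|F e| <= 1) -> dep (inD D) F ->
  (forall i, [/\ bdm (u i), forall X, `|u i X| <= 1 &
     i \in V -> dep (fun C : {fset W} => above D C && (i \notin C)) (u i)]) ->
  exists2 h, low h &
    Ex P (fun X => F (bitsN X) * \prod_(i <- s) u i X) ^+ (2 ^ size s) <=
    Ex P (fun X => F (bitsN X) * h (bitsN X)).
Proof.
elim: s D F u => [|i s IH] D F u us sV VD bF F1 dF hu.
  exists (fun=> 1); first by split => // [e|]; [rewrite normr1|exists fset0].
  rewrite expr1 le_eqVlt; apply/orP; left; apply/eqP/eq_Ex => X; rewrite big_nil.
  by [].
have [i' Zi' i'D] := fresh D.
have iV : i \in V by apply: sV; rewrite mem_head.
have iD : i \in D by apply: (fsubsetP VD).
pose phi (X : Omega R {fset W}) : Omega R {fset W} := fun C => X (swap i i' @` C)%fset.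
have mphi : mpres P P phi by apply: mpres_map_fset; exact: swap_inj.
pose psi (e : Omega R (atom L W)) : Omega R (atom L W) := fun b => e (map_atom (swap i i') b).
have mpsi : measurable_fun setT psi by exact: measurable_relabel.
have bitsphi X : bitsN (phi X) = psi (bitsN X).
  by apply/funext => b; rewrite bits_map//; exact: swap_inj.
pose D' := (i' |` D)%fset.
have swapD x : x \in D -> swap i i' x \in D'.
  rewrite /swap inE => xD; case: ifP => _; first by rewrite inE eqxx.
  by case: ifP => _; rewrite inE ?iD ?xD orbT.
pose F' e := F e * F (psi e).
pose u' j X := u j X * u j (phi X).
(* After the exchange [i] has become [i'], so [F \o psi] reads no atom containing [i] and can be
   moved into [h]. *)
have dFpsi : dep [predI inD D' & fun b => has (fun i => i \notin supp b) V] (F \o psi).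
  move=> e e' ee'; apply: dF => b /allP bD; apply: ee'; apply/andP; split.
    apply/allP => _ /mapP[x xb ->]; have /andP[xD Zx] := bD _ xb.
    rewrite swapD// /swap; case: ifP => // _; case: ifP => // _; exact: VZ.
  apply/hasP; exists i => //; apply/mapP => -[x xb ix].
  have /andP[xD _] := bD _ xb; have := @swap_eq _ i i' x.
  by rewrite -ix eqxx => /(_ _)/negP; apply => //; apply: contraNneq i'D => <-.
have [||||||j|h [bh h1 [E dh]] hle] := IH D' F' u'.
- by case/andP: us.
- by move=> x xs; apply: sV; rewrite inE xs orbT.
- by apply: (fsubset_trans VD); exact: fsubsetU1.
- by apply: bdmM => //; apply: bdm_comp bF.
- by move=> e; rewrite normrM mulr_ile1.
- move=> e e' ee'; congr (_ * _).
    by apply: dF => b /allP bD; apply: ee'; apply/allP => x /bD /andP[xD ->]; rewrite inE xD orbT.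
  by apply: dFpsi => b /andP[bD _]; exact: ee'.
- have [bu u1 du] := hu j; split.
  + by apply: bdmM => //; apply: bdm_comp bu; case: mphi.
  + by move=> X; rewrite normrM mulr_ile1.
  + move=> jV X Y XY; congr (_ * _); apply: (du jV) => C /andP[/allP CD jC].
      by apply: XY; rewrite jC andbT; apply/allP => x /CD xD;
        have : x \in D' by rewrite inE; apply/orP; right; exact: xD.
    apply: XY; apply/andP; split.
      by apply/allP => _ /imfsetP[x /CD xD ->]; exact: swapD.
    apply/imfsetP => -[x /= xC jx].
    have xi' : x != i' by apply: contraNneq i'D => <-; exact: CD.
    have [ji|ji] := eqVneq j i.
      by have := swap_eq i xi'; rewrite -jx ji eqxx.
    have xi : x != i.
      apply: contraTneq jV => xi; rewrite jx xi /swap eqxx.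
      by apply: contraNN i'D; exact: (fsubsetP VD).
    by move: jC; rewrite jx swap_id// xC.
exists (fun e => F (psi e) * h e).
  split; first by apply: bdmM => //; apply: bdm_comp bF.
    by move=> e; rewrite normrM mulr_ile1.
  exists (D' `|` E)%fset => e e' ee'; congr (_ * _).
    apply: dFpsi => b /andP[/allP bD bV]; apply: ee'; rewrite /= bV andbT.
    by apply/allP => x /bD /andP[xD ->]; rewrite in_fsetU xD.
  apply: dh => b /andP[/allP bD bV]; apply: ee'; rewrite /= bV andbT.
  by apply/allP => x /bD /andP[xD ->]; rewrite in_fsetU xD orbT.
pose G X := F (bitsN X) * \prod_(j <- s) u j X.
have bG : bdm G.
  by apply: bdmM; [exact: bdm_bits|apply: bdm_prod => j; case: (hu j)].
have dG : dep (fun C : {fset W} => above D C) G.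
  move=> X Y XY; congr (_ * _); first exact: (dep_bits_inD dF).
  apply: eq_big_seq => j js; have [_ _ du] := hu j.
  by apply: du => [|C /andP[CD _]]; [apply: sV; rewrite inE js orbT|exact: XY].
have [bu u1 du] := hu i.
rewrite [size _]/= expnS exprM.
(* [u i] depends on the sets without [i] only, so [G] may be replaced by its conditional expectation
   before Cauchy-Schwarz; [Ex_condE_swap] then computes the second moment. *)
have step : Ex P (fun X => F (bitsN X) * \prod_(j <- i :: s) u j X) ^+ 2 <=
    Ex P (fun X => F' (bitsN X) * \prod_(j <- s) u' j X).
  have -> : Ex P (fun X => F' (bitsN X) * \prod_(j <- s) u' j X) =
      Ex P (fun X => condE (fun C : {fset W} => i \notin C) G X ^+ 2).
    rewrite (Ex_condE_swap i'D iD bG dG); apply: eq_Ex => X.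
    rewrite /G /F' /u' big_split /= -!/(phi X) bitsphi; lra.
  have -> : Ex P (fun X => F (bitsN X) * \prod_(j <- i :: s) u j X) =
      Ex P (fun X => condE (fun C : {fset W} => i \notin C) G X * u i X).
    transitivity (Ex P (fun X => u i X * G X)).
      by apply: eq_Ex => X; rewrite big_cons /G; lra.
    rewrite -(Ex_condE (S := fun C : {fset W} => i \notin C))//; last by apply: depW (du iV) => C /andP[].
    by apply: eq_Ex => X; rewrite mulrC.
  by apply: Ex_CS1 => //; exact: bdm_condE.
apply: (@le_trans _ _ (Ex P (fun X => F' (bitsN X) * \prod_(j <- s) u' j X) ^+ (2 ^ size s))).
  by apply: lerXn2r; rewrite ?nnegrE//; [exact: sqr_ge0|exact: le_trans (sqr_ge0 _) step].
apply: (le_trans hle); rewrite le_eqVlt; apply/orP; left; apply/eqP/eq_Ex => X.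
by rewrite /F' mulrA.
Qed.

End gowers.

(** The residual [xi - q] has correlation at most [t] with every low function. The condition refers
    to the law [mu] of the atoms only, and thus passes between structures with the same law. *)
Definition orth (R : realType) (L : language) (W : countType) (Z : pred W)
    (V : {fset W}) (mu : probability (Omega R (atom L W)) R)
    (xi : Omega R (atom L W) -> R) (t : R) (q : Omega R (atom L W) -> R) :=
  forall h, low Z V h -> `|Ex mu (fun e => (xi e - q e) * h e)| <= t.

Section orth.
Context (R : realType) (L : language) (W : countType) (Z : pred W) (V : {fset W}).
Local Notation Oa := (Omega R (atom L W)).
Local Notation low := (@low R L W Z V).

Lemma low_cst c : `|c| <= 1 -> low (fun=> c).
Proof. by move=> c1; split => //; exists fset0. Qed.

Lemma low_opp h : low h -> low (fun e => - h e).
Proof.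
move=> [bh h1 [D dh]]; split; [exact: bdmN|by move=> e; rewrite normrN|].
by exists D => e e' ee'; rewrite (dh e e').
Qed.

Let clamp (y : R) := Num.max (-1) (Num.min 1 y).

Lemma low_clamp h h' (t : R) : low h -> low h' ->
  low (fun e => clamp (h e + t * h' e)).
Proof.
move=> [bh h1 [D dh]] [bh' h1' [D' dh']].
have c1 y : `|clamp y| <= 1.
  rewrite ler_norml /clamp le_max lexx /= ge_max ge_min lexx /= andbT.
  by lra.
split => //.
  split; last by exists 1.
  apply: measurable_maxr => //; apply: measurable_minr => //.
  by have [] : bdm (fun e => h e + t * h' e) by auto.
exists (D `|` D')%fset => e e' ee'; congr clamp; congr (_ + _ * _).
  apply: dh => b /andP[/allP bD bV]; apply: ee'; rewrite /= bV andbT.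
  by apply/allP => x /bD /andP[xD ->]; rewrite in_fsetU xD.
apply: dh' => b /andP[/allP bD bV]; apply: ee'; rewrite /= bV andbT.
by apply/allP => x /bD /andP[xD ->]; rewrite in_fsetU xD orbT.
Qed.

(** [q] minimises the L^2 distance to [xi] up to [t ^+ 2]. Moving it by [t * h] and clamping to
    [-1, 1], which does not increase the distance as [xi] has values there, gains at most [t ^+ 2];
    but the gain is at least 2t times the correlation minus [t ^+ 2]. *)
Lemma exists_orth (mu : probability Oa R) xi (t : R) :
  bdm xi -> (forall e, `|xi e| <= 1) -> 0 < t -> exists2 q, low q & orth Z V mu xi t q.
Proof.
move=> bxi xi1 t0.
pose En q := Ex mu (fun e => (xi e - q e) ^+ 2).
pose A := [set x | exists2 q, low q & x = En q].
have hA : has_inf A.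
  split; last by exists 0 => _ [q _ ->]; exact: Ex_sqr_ge0.
  by exists (En (fun=> 0)); exists (fun=> 0) => //; apply: low_cst; rewrite normr0.
have [_ [q lq ->] hq] := inf_adherent (exprn_gt0 2 t0) hA.
exists q => //.
suff H h : low h -> Ex mu (fun e => (xi e - q e) * h e) <= t.
  move=> h lh; rewrite ler_norml (H h)// andbT lerNl.
  have := H _ (low_opp lh); rewrite (_ : Ex mu _ = - Ex mu (fun e => (xi e - q e) * h e))//.
  have [[bh _ _] [bq _ _]] := (lh, lq).
  rewrite -mulN1r -ExZ; last by auto.
  by apply: eq_Ex => e; rewrite mulrN mulN1r.
move=> lh; have [[bh h1 _] [bq _ _]] := (lh, lq).
have lc := low_clamp t lq lh; have [bc _ _] := lc.
have h2 : inf A <= En (fun e => clamp (q e + t * h e)).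
  by apply: ge_inf; [case: hA|exists (fun e => clamp (q e + t * h e))].
have h3 : En (fun e => clamp (q e + t * h e)) <=
    Ex mu (fun e => (xi e - q e - t * h e) ^+ 2).
  apply: le_Ex; [by auto|by auto 6|move=> e].
  have := xi1 e; rewrite ler_norml => /andP[a b].
  rewrite (_ : xi e - q e - t * h e = xi e - (q e + t * h e)); last by lra.
  move: (q e + t * h e) => y; rewrite -subr_ge0 /clamp.
  case: (leP 1 y) => y1.
    rewrite max_r; last by lra.
    rewrite (_ : _ - _ = (y - 1) * (y + 1 - 2 * xi e)); last by rewrite !expr2; lra.
    by apply: mulr_ge0; lra.
  case: (leP (-1) y) => y2; first by rewrite subrr.
  rewrite (_ : _ - _ = (-1 - y) * (1 - y + 2 * xi e)); last by rewrite !expr2; lra.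
  by apply: mulr_ge0; lra.
have h4 : Ex mu (fun e => (xi e - q e - t * h e) ^+ 2) =
    En q - 2 * t * Ex mu (fun e => (xi e - q e) * h e) + t ^+ 2 * Ex mu (fun e => h e ^+ 2).
  rewrite -ExZ; last by auto 6.
  rewrite -ExZ; last by auto.
  rewrite -ExB; [|by auto|by auto 7].
  rewrite -ExD; [|by auto 8|by auto].
  by apply: eq_Ex => e; rewrite !expr2; lra.
have h5 : Ex mu (fun e => h e ^+ 2) <= 1.
  apply: Ex_le_cst => [|e]; first by auto.
  by rewrite -[leLHS]real_normK ?num_real// expr_le1.
have t2 : 0 < t ^+ 2 by exact: exprn_gt0.
have h6 : t ^+ 2 * Ex mu (fun e => h e ^+ 2) <= t ^+ 2 by rewrite ger_pMr.
have h7 : 2 * t * Ex mu (fun e => (xi e - q e) * h e) <= 2 * t * t.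
  by move: hq; rewrite -/(En q) => hq; rewrite -[X in _ <= X]mulrA -expr2; lra.
by rewrite ler_pM2l// in h7; rewrite mulr_gt0.
Qed.

End orth.

Section key.
Context (R : realType) (L : language) (W : countType).
Context (N : forall P : L, set (Omega R (r 'I_(arity P)))) (mN : forall P, measurable (N P)).
Context (Z : pred W) (V : {fset W}).
Hypothesis fresh : forall D : {fset W}, exists2 z, Z z & z \notin D.
Hypothesis VZ : forall i, i \in V -> Z i.
Context (xi : Omega R (atom L W) -> R).
Hypothesis bxi : bdm xi.
Hypothesis xi1 : forall e, `|xi e| <= 1.
Hypothesis dxi : exists D, dep (inD Z D) xi.
Local Notation P := (iid R {fset W}).
Local Notation low := (@low R L W Z V).
Local Notation mu := (law P (measurable_bits (W := W) mN)).
Local Notation orth := (@orth R L W Z V mu xi).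
Let S : pred {fset W} := fun C => ~~ (V `<=` C)%fset.
(** Filling the coordinates outside [S] with 0 turns any function of all coordinates into one of
    those in [S]. *)
Let zero : Omega R {fset W} := fun=> 0.
Let G q (X : Omega R {fset W}) := xi (bits N X) - q (bits N X).

Let bdmG q : low q -> bdm (G q).
Proof. by move=> [bq _ _]; apply: bdmB; exact: (bdm_bits mN). Qed.

Let G2 q X : low q -> `|G q X| <= 2.
Proof.
move=> [_ q1 _]; apply: (le_trans (ler_normB _ _)).
by rewrite (_ : 2 = 1 + 1)//; apply: lerD.
Qed.

Let ExG q h : low q -> low h -> forall t, orth t q -> `|Ex P (fun X => G q X * h (bits N X))| <= t.
Proof.
move=> [bq _ _] lh t /(_ h lh); have [bh _ _] := lh.
by rewrite -(Ex_mpres (mpres_law P (measurable_bits mN))); auto.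
Qed.

(** The indicator of a box in the coordinates of [S] is a product of factors each ignoring the sets
    that contain some vertex of [V], so [gowers] bounds its correlation with the residual by that of
    a low function. *)
Let box_small (s : seq {fset W}) (B : {fset W} -> set R) (e : R) : 0 < e ->
  (forall C, measurable (B C)) -> exists2 t, 0 < t & forall q, low q -> orth t q ->
    `|Ex P (fun X => \1_[set Y : Omega R {fset W} | forall C, C \in s -> B C (Y C)]
       (splice S X zero) * G q X)| <= e.
Proof.
move=> e0 mB.
(* A set in [S] omits a vertex of [V]; [u i] collects the constraints on the sets omitting [i].
   Overlaps are harmless since the factors are indicators. *)
pose u i (X : Omega R {fset W}) : R :=
  \1_[set Y : Omega R {fset W} | forall C, C \in [seq C : {fset W} <- s | i \notin C] -> B C (Y C)] X.
have mbox (s' : seq {fset W}) : measurable [set Y : Omega R {fset W} | forall C, C \in s' -> B C (Y C)].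
  by apply: sub_sigma_algebra; exists s', B.
have bu i : bdm (u i) by apply: bdm_indic; exact: mbox.
have u1 i X : `|u i X| <= 1.
  by rewrite /u indicE; case: (_ \in _); rewrite ?normr1 ?normr0.
(* The coordinates outside [S] are frozen at 0 and contribute a constant. *)
pose c0 : R := (`[< forall C, C \in s -> ~~ S C -> B C 0 >])%:R.
have boxE X : \1_[set Y : Omega R {fset W} | forall C, C \in s -> B C (Y C)] (splice S X zero)
    = c0 * \prod_(i <- V) u i X.
  have prodE : \prod_(i <- V) u i X =
      (`[< forall i, i \in V -> forall C, C \in s -> i \notin C -> B C (X C) >])%:R.
    have [h|h] := pselect (forall i, i \in V -> forall C, C \in s -> i \notin C -> B C (X C)).
      rewrite asboolT// big_seq big1// => i iV; rewrite /u indicE mem_set//= => C.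
      by rewrite mem_filter => /andP[iC Cs]; exact: (h i).
    rewrite asboolF//.
    have [i iV nh] : exists2 i, i \in V & ~ (forall C, C \in s -> i \notin C -> B C (X C)).
      by apply: contrapT => nex; apply: h => i iV; apply: contrapT => nh; apply: nex; exists i.
    rewrite (big_rem i)//= /u indicE memNset ?mul0r//= => hB; apply: nh => C Cs iC.
    by apply: hB; rewrite mem_filter iC.
  rewrite prodE /c0 indicE -natrM mulnb; congr (nat_of_bool _)%:R.
  apply/idP/andP => [/set_mem /= h|[/asboolP h1 /asboolP h2]].
    split; apply/asboolP.
      by move=> C Cs SC; have := h C Cs; rewrite /splice (negbTE SC).
    move=> i iV C Cs iC; have := h C Cs; rewrite /splice.
    suff -> : S C by [].
    by apply: contra iC => /fsubsetP; exact.
  apply/mem_set => /= C Cs; rewrite /splice; case: ifPn => [/fsubsetPn[i iV iC]|SC].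
    exact: (h2 i).
  exact: h1.
have c01 : `|c0| <= 1 by rewrite /c0; case: (`[< _ >]); rewrite ?normr1 ?normr0.
have [D0 dxi0] := dxi.
pose K := (2 ^ size V)%N.
have e2 : 0 < e / 2 by exact: divr_gt0.
exists ((e / 2) ^+ K); first exact: exprn_gt0.
move=> q lq oq; have [bq q1 [Dq dq]] := lq.
pose D := (D0 `|` Dq `|` V `|` [fset x | x in flatten [seq enum_fset C | C <- s]])%fset.
(* The residual is bounded by 2 and is halved to meet the bound 1 of [gowers], which turns [e] into
   [e / 2] in the threshold; the sign [sg] serves the two halves of the absolute value. *)
pose F (sg : R) e := sg / 2 * (xi e - q e).
have main sg : `|sg| = 1 -> sg * Ex P (fun X => G q X * \prod_(i <- V) u i X) <= e.
  move=> sg1.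
  have bF : bdm (F sg) by apply: bdmM => //; apply: bdmB.
  have F1 e' : `|F sg e'| <= 1.
    rewrite /F normrM normrM sg1 mul1r ger0_norm ?invr_ge0// mulrC ler_pdivrMr// mul1r.
    by apply: (le_trans (ler_normB _ _)); rewrite (_ : 2 = 1 + 1)//; apply: lerD.
  have dF : dep (inD Z D) (F sg).
    move=> e1 e1' ee; congr (_ * (_ - _)).
      apply: dxi0 => b /allP bD; apply: ee; apply/allP => x /bD /andP[xD ->].
      by rewrite !in_fsetU xD.
    apply: dq => b /andP[/allP bD _]; apply: ee; apply/allP => x /bD /andP[xD ->].
    by rewrite !in_fsetU xD !orbT.
  have VD : (V `<=` D)%fset.
    by apply/fsubsetP => x xV; rewrite !in_fsetU xV !orbT.
  have hu i : [/\ bdm (u i), forall X, `|u i X| <= 1 &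
      i \in V -> dep (fun C : {fset W} => all (mem (D : {fset W})) C && (i \notin C)) (u i)].
    split => // iV X Y XY; rewrite /u !indicE; congr (nat_of_bool _)%:R.
    have XYC C : C \in [seq C : {fset W} <- s | i \notin C] -> X C = Y C.
      rewrite mem_filter => /andP[iC Cs]; apply: XY; rewrite iC andbT.
      apply/allP => x xC.
      have : x \in D.
        rewrite !in_fsetU; apply/orP; right; apply/imfsetP; exists x => //=.
        by apply/flattenP; exists (enum_fset C) => //; apply: map_f.
      by [].
    by apply/idP/idP => /set_mem /= h; apply/mem_set => /= C CC; [rewrite -XYC//|rewrite XYC//]; exact: h.
  have [h lh hle] := gowers mN fresh VZ (fset_uniq V) (fun x xV => xV) VD bF F1 dF hu.
  have [bh _ _] := lh.
  set y := Ex P _ in hle.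
  have bw : bdm (fun X => \prod_(i <- V) u i X) by exact: bdm_prod.
  have yE : sg * Ex P (fun X => G q X * \prod_(i <- V) u i X) = 2 * y.
    rewrite -ExZ; last by apply: bdmM => //; exact: bdmG.
    rewrite -ExZ; last by apply: bdmM => //; exact: (bdm_bits mN).
    by apply: eq_Ex => X; rewrite /F -/(G q X); lra.
  rewrite yE; suff : y <= e / 2 by lra.
  rewrite leNgt; apply/negP => ylt.
  have : (e / 2) ^+ K < y ^+ K.
    by rewrite ltr_pXn2r ?nnegrE ?(ltW e2) ?(ltW (lt_trans e2 ylt))// /K expn_gt0.
  apply/negP; rewrite -leNgt; apply: (le_trans hle).
  have b1 : bdm (fun X => G q X * h (bits N X)).
    by apply: bdmM; [exact: bdmG|exact: (bdm_bits mN)].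
  rewrite (_ : Ex P _ = sg / 2 * Ex P (fun X => G q X * h (bits N X))); last first.
    by rewrite -ExZ//; apply: eq_Ex => X; rewrite /F -mulrA.
  apply: (le_trans (ler_norm _)); rewrite normrM normrM sg1 mul1r.
  have : `|Ex P (fun X => G q X * h (bits N X))| <= (e / 2) ^+ K by exact: ExG.
  have := normr_ge0 (Ex P (fun X => G q X * h (bits N X))).
  by rewrite ger0_norm ?invr_ge0//; lra.
have -> : Ex P (fun X => \1_[set Y : Omega R {fset W} | forall C, C \in s -> B C (Y C)]
       (splice S X zero) * G q X) = c0 * Ex P (fun X => G q X * \prod_(i <- V) u i X).
  rewrite -ExZ; last by apply: bdmM; [exact: bdmG|exact: bdm_prod].
  by apply: eq_Ex => X; rewrite boxE; lra.
rewrite normrM -[leRHS]mul1r; apply: ler_pM => //.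
rewrite ler_norml; have := main 1 (normr1 _).
have := main (-1); rewrite normrN normr1 mul1r mulN1r => /(_ erefl) a b.
by rewrite b andbT lerNl.
Qed.

Let measurable_splice0 : measurable_fun setT (fun X : Omega R {fset W} => splice S X zero).
Proof.
apply: measurable_Omega => C; rewrite /splice; case: (S C) => //.
exact: measurable_coord.
Qed.

Let orthW t t' q : t <= t' -> orth t q -> orth t' q.
Proof. by move=> tt oq h lh; apply: le_trans (oq h lh) tt. Qed.

Let small (f : Omega R {fset W} -> R) := forall e : R, 0 < e ->
  exists2 t, 0 < t & forall q, low q -> orth t q ->
    `|Ex P (fun X => f (splice S X zero) * G q X)| <= e.

Let all_small f : bdm f -> small f.
Proof.
have bfs (g : Omega R {fset W} -> R) : bdm g -> bdm (fun X => g (splice S X zero)).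
  by move=> bg; apply: bdm_comp bg.
move: f; apply: (functional_monotone_class (S := small) (Ps := fun _ : unit => law P measurable_splice0)
   (@boxesE R {fset W}) (@boxesI R {fset W})).
- by move=> _ [s [B [mB ->]]] e e0; exact: box_small.
- move=> e e0; exists e => // q lq oq.
  have l1 : low (fun=> 1) by apply: low_cst; rewrite normr1.
  have := ExG lq l1 oq.
  by congr (_ <= _); congr `|_|; apply: eq_Ex => X; rewrite mulr1 mul1r.
- move=> f g bf bg hf hg e e0; have e2 : 0 < e / 2 by exact: divr_gt0.
  have [t t0 ht] := hf _ e2; have [t' t'0 ht'] := hg _ e2.
  exists (Num.min t t'); first by rewrite lt_min t0.
  move=> q lq oq.
  have o1 : orth t q by apply: orthW oq; rewrite ge_min lexx.
  have o2 : orth t' q by apply: orthW oq; rewrite ge_min lexx orbT.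
  rewrite (_ : Ex P _ = Ex P (fun X => f (splice S X zero) * G q X) +
    Ex P (fun X => g (splice S X zero) * G q X)).
    by apply: (le_trans (ler_normD _ _)); have := ht q lq o1; have := ht' q lq o2; lra.
  rewrite -ExD; [|by apply: bdmM; auto|by apply: bdmM; auto].
  by apply: eq_Ex => X; rewrite mulrDl.
- move=> c f bf hf e e0.
  have c1 : 0 < `|c| + 1 by rewrite ltr_wpDl.
  have [t t0 ht] := hf _ (divr_gt0 e0 c1); exists t => // q lq oq.
  rewrite (_ : Ex P _ = c * Ex P (fun X => f (splice S X zero) * G q X)); last first.
    rewrite -ExZ; last by apply: bdmM; auto.
    by apply: eq_Ex => X; rewrite mulrA.
  rewrite normrM; have := ht q lq oq; rewrite ler_pdivlMr// => h.
  by apply: le_trans h; rewrite mulrC ler_wpM2l// lerDl.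
- move=> f bf [h hh hf] e e0.
  have e4 : 0 < e / 4 by exact: divr_gt0.
  have [n /(_ tt) hn] := hf _ e4; have [bh sh] := hh n; move: {hf hh} hn => hn.
  have [t t0 ht] := sh _ (divr_gt0 e0 (ltr0Sn R 1)); exists t => // q lq oq.
  have bG := bdmG lq.
  rewrite (_ : Ex P _ = Ex P (fun X => (f (splice S X zero) - h n (splice S X zero)) * G q X) +
    Ex P (fun X => h n (splice S X zero) * G q X)); last first.
    rewrite -ExD; [|by apply: bdmM => //; apply: bdmB; auto|by apply: bdmM; auto].
    by apply: eq_Ex => X; lra.
  apply: (le_trans (ler_normD _ _)).
  have h1 : `|Ex P (fun X => (f (splice S X zero) - h n (splice S X zero)) * G q X)| <= 2 * (e / 4).
    have bd : bdm (fun X => `|f X - h n X|) by auto.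
    have := hn; rewrite -(Ex_mpres (mpres_law P measurable_splice0) bd) => hn'.
    have bd' : bdm (fun X => `|f (splice S X zero) - h n (splice S X zero)|).
      exact: (bfs _ bd).
    apply: (@le_trans _ _ (2 * Ex P (fun X => `|f (splice S X zero) - h n (splice S X zero)|))).
      apply: (le_trans (Ex_abs _ _)); first by apply: bdmM => //; apply: bdmB; auto.
      rewrite -ExZ//; apply: le_Ex; [|exact: bdmM|move=> X].
        by apply: bdm_abs; apply: bdmM => //; apply: bdmB; auto.
      by rewrite normrM mulrC; apply: ler_wpM2r => //; exact: G2.
    by rewrite ler_pM2l.
  by have := ht q lq oq; lra.
Qed.

(** A low [q] depends on [S] only, so the conditional residual is [p - q] with [p] that of [xi], and
    its second moment is the correlation of the residual with [p] minus that with [q]. The first is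
    small by [all_small], the second by orthogonality. As [t] does not depend on [q], one [q] can
    serve two structures. *)
Theorem key (e : R) : 0 < e -> exists2 t, 0 < t & forall q, low q -> orth t q ->
  Ex P (fun X => condE S (fun Y => xi (bits N Y) - q (bits N Y)) X ^+ 2) <= e.
Proof.
move=> e0; have e2 : 0 < e / 2 by exact: divr_gt0.
pose p := condE S (fun X => xi (bits N X)).
have bxb : bdm (fun X : Omega R {fset W} => xi (bits N X)) by exact: (bdm_bits mN).
have bp : bdm p by exact: bdm_condE.
have dpS : dep S p.
  apply: (depW (S := [predI S & xpredT])); first by move=> C /andP[].
  by apply: dep_condE => X1 X2 X12; rewrite (_ : X1 = X2)//; apply/funext => C; exact: X12.
have dp X : p (splice S X zero) = p X by apply: dpS => C SC; rewrite /splice SC.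
have [t t0 ht] := all_small bp e2.
exists (Num.min t (e / 2)); first by rewrite lt_min t0.
move=> q lq oq; have bG := bdmG lq; have [bq _ [D dq]] := lq.
have bqb : bdm (fun X : Omega R {fset W} => q (bits N X)) by exact: (bdm_bits mN).
have dqb : dep S (fun X : Omega R {fset W} => q (bits N X)).
  move=> X Y XY; apply: dq => b /andP[_ /hasP [i iV ib]].
  apply: (@dep_bits R L W N b) => C /allP Cb; apply: XY.
  by apply/negP => /fsubsetP /(_ _ iV) /Cb; apply/negP.
have cE X : condE S (G q) X = p X - q (bits N X).
  rewrite -(condE_id X dqb) /condE -ExB//.
  - exact: (bdm_splicer S X bxb).
  - exact: (bdm_splicer S X bqb).
have o1 : orth t q by apply: orthW oq; rewrite ge_min lexx.
have o2 : orth (e / 2) q by apply: orthW oq; rewrite ge_min lexx orbT.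
have -> : Ex P (fun X => condE S (fun Y => xi (bits N Y) - q (bits N Y)) X ^+ 2) =
    Ex P (fun X => condE S (G q) X * G q X).
  transitivity (Ex P (fun X => condE S (G q) X * condE S (G q) X)).
    by apply: eq_Ex => X; rewrite -expr2.
  apply: Ex_condE => //.
  - move=> X Y XY; by rewrite !cE (dqb X Y XY) (dpS X Y XY).
  - exact: bdm_condE.
have -> : Ex P (fun X => condE S (G q) X * G q X) =
   Ex P (fun X => p (splice S X zero) * G q X) - Ex P (fun X => G q X * q (bits N X)).
  rewrite -ExB; [|by under eq_fun do rewrite dp; auto|by auto].
  by apply: eq_Ex => X; rewrite cE dp; lra.
have := ht q lq o1; have := ExG lq lq o2; rewrite !ler_norml.
by move=> /andP[? ?] /andP[? ?]; lra.
Qed.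

End key.

(** * Equivariant transfer *)

Section conditional_probability.
Context (R : realType) d d' (T : measurableType d) (T' : measurableType d').
Context (P : probability T' R) (phi : {mfun T' >-> T}) (B : set T').
Context (mB : measurable B).

Definition restricted_law (A : set T) : \bar R := P (phi @^-1` A `&` B).

Let mpre A : measurable A -> measurable (phi @^-1` A).
Proof. by move=> mA; rewrite -[X in measurable X]setTI; exact: (measurable_funP phi). Qed.

Let restricted_law0 : restricted_law set0 = 0%E.
Proof. by rewrite /restricted_law preimage_set0 set0I measure0. Qed.

Let restricted_law_ge0 A : (0 <= restricted_law A)%E.
Proof. exact: measure_ge0. Qed.

Let restricted_law_sigma_additive : semi_sigma_additive restricted_law.
Proof.
move=> F mF tF mUF; rewrite /restricted_law preimage_bigcup setI_bigcupl.
apply: measure_semi_sigma_additive.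
- by move=> n; apply: measurableI => //; exact: mpre.
- apply/trivIsetP => /= i j _ _ ij; rewrite setIACA -preimage_setI.
  by move/trivIsetP : tF => /(_ _ _ _ _ ij) ->//; rewrite preimage_set0 set0I.
- by apply: bigcup_measurable => n _; apply: measurableI => //; exact: mpre.
Qed.

HB.instance Definition _ := isMeasure.Build _ _ _ restricted_law
  restricted_law0 restricted_law_ge0 restricted_law_sigma_additive.

Let restricted_law_fin : fin_num_fun restricted_law.
Proof.
by move=> A mA; apply: fin_num_measure; apply: measurableI => //; exact: mpre.
Qed.

HB.instance Definition _ := Measure_isFinite.Build _ _ _ restricted_law restricted_law_fin.

Let PT : probability T R := distribution P phi.

Lemma restricted_lawE A : measurable A ->
  restricted_law A = (Ex P (fun x => \1_A (phi x) * \1_B x))%:E.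
Proof.
move=> mA; have mA' : measurable (phi @^-1` A).
  by rewrite -[X in measurable X]setTI; exact: (measurable_funP phi).
rewrite (_ : restricted_law A = P (phi @^-1` A `&` B))// -Ex_indic; last exact: measurableI.
by congr (_%:E); apply: eq_Ex => x; rewrite indicI.
Qed.

Lemma restricted_law_dominated : restricted_law `<< PT.
Proof.
apply/null_content_dominatesP => A mA A0.
apply/eqP; rewrite eq_le measure_ge0 andbT -A0.
have mA' : measurable (phi @^-1` A).
  by rewrite -[X in measurable X]setTI; exact: (measurable_funP phi).
by apply: le_measure; rewrite ?inE//; exact: measurableI.
Qed.

(** The Radon-Nikodym derivative of [restricted_law] with respect to the law of [phi] is at most 1
    almost everywhere; cutting it at 1 makes the bounds hold at every point. *)
Lemma conditional_probability : exists g : T -> R,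
  [/\ measurable_fun setT g, forall t, 0 <= g t <= 1 &
    forall A, measurable A -> Ex P (fun x => \1_A (phi x) * \1_B x) =
      Ex P (fun x => \1_A (phi x) * g (phi x))].
Proof.
pose f := Radon_Nikodym_SigmaFinite.f restricted_law PT.
have dom := restricted_law_dominated.
have f0 := Radon_Nikodym_SigmaFinite.f_ge0 dom.
have ffin := Radon_Nikodym_SigmaFinite.f_fin_num dom.
have fi := Radon_Nikodym_SigmaFinite.f_integral dom.
have /measurable_int mf := Radon_Nikodym_SigmaFinite.f_integrable dom.
have mfine : measurable_fun setT (fun t => fine (f t)) by exact: measurableT_comp.
(* Here the derivative is at least 1 + 1/(n+1), although [restricted_law] never exceeds [PT]; so
   [C n] is null. *)
pose C n := [set t | 1 + n.+1%:R^-1 <= fine (f t)].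
have mC n : measurable (C n).
  rewrite (_ : C n = (fun t => fine (f t)) @^-1` `[1 + n.+1%:R^-1, +oo[%classic).
    by rewrite -[X in measurable X]setTI; exact: mfine.
  by apply/seteqP; split => x /=; rewrite in_itv /= andbT.
have C0 n : PT (C n) = 0%E.
  have le1 : (restricted_law (C n) <= PT (C n))%E.
    have mA' : measurable (phi @^-1` C n).
      by rewrite -[X in measurable X]setTI; exact: (measurable_funP phi).
    by apply: le_measure; rewrite ?inE//; exact: measurableI.
  have le2 : ((1 + n.+1%:R^-1)%:E * PT (C n) <= restricted_law (C n))%E.
    rewrite fi// -integral_cst//; apply: ge0_le_integral => //.
    - by move=> x _; rewrite lee_fin addr_ge0.
    - exact: measurable_funTS.
    - by move=> x Cx; rewrite -(fineK (ffin x)) lee_fin.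
  have fin : PT (C n) \is a fin_num by exact: fin_num_measure.
  have a : 0 <= fine (PT (C n)) by rewrite fine_ge0.
  have := le_trans le2 le1; rewrite -(fineK fin) -EFinM lee_fin => b.
  congr (_%:E); apply/eqP; rewrite eq_le a andbT.
  have n0 : 0 < n.+1%:R^-1 :> R by rewrite invr_gt0 ltr0n.
  by rewrite -(pmulr_rle0 _ n0); move: b; rewrite mulrDl mul1r gerDl.
have ae1 : {ae PT, forall t, fine (f t) <= 1}.
  have : negligible PT (\bigcup_n C n).
    by apply: negligible_bigcup => n; apply/negligibleP; [exact: mC|exact: C0].
  apply: negligibleS => t /= /negP; rewrite -ltNge => f1.
  exists (Num.truncn (fine (f t) - 1)^-1) => //; rewrite /C /=.
  rewrite -lerBrDl invf_ple ?posrE ?subr_gt0//.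
  exact/ltW/truncnS_gt.
pose g t := Num.min 1 (fine (f t)).
have mg : measurable_fun setT g by apply: measurable_minr.
have g01 t : 0 <= g t <= 1.
  by rewrite /g le_min ler01 fine_ge0//= ge_min lexx.
exists g; split => // A mA; apply: EFin_inj.
rewrite -restricted_lawE// fi//.
have bg : bdm (fun t => \1_A t * g t).
  by apply: bdmM; [exact: bdm_indic|split => //; exists 1 => t; have /andP[? ?] := g01 t; rewrite ger0_norm].
transitivity (Ex PT (fun t => \1_A t * g t))%:E; last first.
  congr (_%:E).
  by rewrite -(@Ex_mpres _ _ _ _ _ P PT phi)//; split => //; exact: (measurable_funP phi).
rewrite /Ex /Rintegral fineK; last first.
  exact: (integrable_fin_num measurableT (bdm_integrable PT bg)).
rewrite [LHS]integral_mkcond; apply: ae_eq_integral => //.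
- by apply/(measurable_restrictT _ mA); exact: measurable_funTS.
- by case: bg => mbg _; apply/measurable_EFinP.
apply: filterS ae1 => t f1 _; rewrite patchE indicE.
case: ifPn => tA; rewrite ?(negbTE tA) ?tA ?mul0r// mul1r /g min_r//.
by rewrite fineK.
Qed.

End conditional_probability.

Lemma Ex_product_mpres (R : realType) d d1 d2 (T : measurableType d)
    (T1 : measurableType d1) (T2 : measurableType d2)
    (P : probability T R) (mu : probability (T1 * T2)%type R) (f : T -> T1 * T2) :
  measurable_fun setT f ->
  (forall A B, measurable A -> measurable B ->
    Ex P (fun x => \1_A (f x).1 * \1_B (f x).2) = Ex mu (fun p => \1_A p.1 * \1_B p.2)) ->
  mpres P mu f.
Proof.
move=> mf h; apply: mpres_Ex => // C mC.
transitivity (Ex (law P mf) \1_C).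
  by rewrite -(Ex_mpres (mpres_law P mf) (bdm_indic R mC)).
apply: (eq_probability_Ex (@measurable_prod_measurableType _ _ T1 T2)) (bdm_indic R mC) => //.
  move=> _ _ [A mA [B mB <-]] [A' mA' [B' mB' <-]].
  exists (A `&` A'); first exact: measurableI.
  by exists (B `&` B'); [exact: measurableI|rewrite setXI].
move=> _ [A mA [B mB <-]].
have mAB : measurable (A `*` B) by exact: measurableX.
rewrite -!Ex_indic//; congr (_%:E).
have e (p : T1 * T2) : \1_(A `*` B) p = \1_A p.1 * \1_B p.2 :> R.
  rewrite !indicE -natrM mulnb; congr (nat_of_bool _)%:R.
  apply/idP/andP => [/set_mem[a b]|[/set_mem a /set_mem b]]; first by split; exact/mem_set.
  exact/mem_set.
rewrite -(Ex_mpres (mpres_law P mf) (bdm_indic R mAB)).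
transitivity (Ex P (fun x => \1_A (f x).1 * \1_B (f x).2)); first exact: eq_Ex.
by rewrite h//; apply: eq_Ex => p; rewrite e.
Qed.

Section transfer.
Context (R : realType) d (T : measurableType d) (gT : finGroupType) (act : gT -> T -> T).
Hypothesis mact : forall g, measurable_fun setT (act g).
Hypothesis act1 : forall t, act 1%g t = t.
Hypothesis actM : forall g h t, act h (act g t) = act (h * g)%g t.
Context (mu : probability (T * R)%type R).
Hypothesis mu_act : forall g X, bdm X -> Ex mu (fun p => X (act g p.1, p.2)) = Ex mu X.
Hypothesis mu_snd : forall h, bdm h -> Ex mu (fun p => h p.2) = Ex (unif R) h.
Local Notation U := (unif R).

Let muT : probability T R := law mu measurable_fst.

Let bdm_fst (h : T -> R) : bdm h -> bdm (fun p : T * R => h p.1).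
Proof. by move=> bh; apply: bdm_comp bh; exact: measurable_fst. Qed.

Let bdm_snd (h : R -> R) : bdm h -> bdm (fun p : T * R => h p.2).
Proof. by move=> bh; apply: bdm_comp bh; exact: measurable_snd. Qed.

Let Ex_muT (h : T -> R) : bdm h -> Ex muT h = Ex mu (fun p => h p.1).
Proof. by move=> bh; rewrite -(Ex_mpres (mpres_law mu measurable_fst) bh). Qed.

Let lt_ind (c : R) : R -> R := \1_(`]-oo, c[%classic).

Let bdm_lt c : bdm (lt_ind c).
Proof. by apply: bdm_indic; exact: measurable_itv. Qed.

Let lt_indE c x : lt_ind c x = (x < c)%R%:R.
Proof.
rewrite /lt_ind indicE; congr (nat_of_bool _)%:R.
by apply/idP/idP => [/set_mem|h]; [|apply/mem_set]; rewrite /= in_itv.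
Qed.

(** As [mu] is invariant, the average of a conditional probability over the group is again one. It
    is invariant at every point, not just almost everywhere. *)
Let cond_lt (c : R) : exists g : T -> R, [/\ bdm g, forall t, 0 <= g t <= 1,
  forall h t, g (act h t) = g t &
  forall A, measurable A -> Ex mu (fun p => \1_A p.1 * lt_ind c p.2) =
    Ex mu (fun p => \1_A p.1 * g p.1)].
Proof.
pose phi : {mfun (T * R)%type >-> T} := HB.pack_for {mfun (T * R)%type >-> T} fst
  (isMeasurableFun.Build _ _ _ _ fst measurable_fst).
have mB : measurable (setT `*` `]-oo, c[%classic : set (T * R)).
  by apply: measurableX => //; exact: measurable_itv.
have [g0 [mg0 g001 hg0]] := conditional_probability mu phi mB.
have bg0 : bdm g0.
  by split => //; exists 1 => t; have /andP[? ?] := g001 t; rewrite ger0_norm.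
have {}hg0 A : measurable A -> Ex mu (fun p => \1_A p.1 * lt_ind c p.2) =
    Ex mu (fun p => \1_A p.1 * g0 p.1).
  move=> mA; rewrite -[RHS]hg0//; apply: eq_Ex => p; congr (_ * _).
  rewrite /lt_ind !indicE; congr (nat_of_bool _)%:R.
  by apply/idP/idP => [/set_mem h|/set_mem [_ h]]; exact/mem_set.
have K0 : 0 < #|gT|%:R :> R by rewrite ltr0n; apply/card_gt0P; exists 1%g.
pose g t := #|gT|%:R^-1 * \sum_(h : gT) g0 (act h t).
have ba h : bdm (fun t => g0 (act h t)) by apply: bdm_comp bg0.
have bg : bdm g by apply: bdmM => //; exact: bdm_sum.
exists g; split => //.
- move=> t; rewrite /g; apply/andP; split.
    apply: mulr_ge0; first by rewrite invr_ge0 ltW.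
    by apply: sumr_ge0 => h _; case/andP: (g001 (act h t)).
  rewrite ler_pdivrMl// mulr1; apply: (@le_trans _ _ (\sum_(h : gT) 1)).
    by apply: ler_sum => h _; case/andP: (g001 (act h t)).
  by rewrite sumr_const.
- move=> h t; congr (_ * _).
  rewrite [RHS](reindex_inj (mulIg h)); apply: eq_bigr => k _.
  by rewrite actM.
- move=> A mA.
  have bA : bdm (\1_A : T -> R) by exact: bdm_indic.
  have E h : Ex mu (fun p => \1_A p.1 * g0 (act h p.1)) = Ex mu (fun p => \1_A p.1 * lt_ind c p.2).
    pose B := act h^-1%g @^-1` A.
    have mB' : measurable B by rewrite -[X in measurable X]setTI; exact: mact.
    have b2 : bdm (fun p : T * R => \1_B p.1 * g0 p.1).
      by apply: bdmM; [apply: (bdm_fst (bdm_indic R mB'))|exact: bdm_fst].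
    have BE t : \1_B (act h t) = \1_A t :> R.
      rewrite !indicE; congr (nat_of_bool _)%:R.
      have BB : B (act h t) = A t by rewrite /B /preimage /= actM mulVg act1.
      by apply/idP/idP => /set_mem a; apply/mem_set; [rewrite -BB|rewrite BB].
    rewrite (eq_Ex _ (Y := fun p => \1_B (act h p.1) * g0 (act h p.1))); last first.
      by move=> p; rewrite BE.
    rewrite (mu_act h b2) -hg0//.
    have b3 : bdm (fun p : T * R => \1_B p.1 * lt_ind c p.2).
      by apply: bdmM; [apply: (bdm_fst (bdm_indic R mB'))|exact: bdm_snd].
    by rewrite -(mu_act h b3); apply: eq_Ex => p; rewrite BE.
  rewrite [RHS](eq_Ex _ (Y := fun p => #|gT|%:R^-1 * \sum_(h : gT) \1_A p.1 * g0 (act h p.1))).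
    have bs h : bdm (fun p : T * R => \1_A p.1 * g0 (act h p.1)).
      by apply: bdmM; [exact: (bdm_fst bA)|exact: (bdm_fst (ba h))].
    rewrite ExZ; last exact: bdm_sum.
    rewrite Ex_sum// (eq_bigr (fun=> Ex mu (fun p => \1_A p.1 * lt_ind c p.2))); last by [].
    rewrite sumr_const; set E0 := Ex _ _.
    by rewrite -(mulr_natl E0) mulrA mulVf ?mul1r ?gt_eqF.
  by move=> p; rewrite /g mulrCA mulr_sumr.
Qed.

(** The rationals clamped to [0, 1], with 0 for the codes of no rational: a countable dense set of
    thresholds. *)
Let e (n : nat) : R := Num.max 0 (Num.min 1 (ratr (odflt 0%R (choice.unpickle n : option rat)))).

Let e01 n : 0 <= e n <= 1.
Proof. by rewrite /e le_max lexx /= ge_max ler01 ge_min lexx. Qed.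

Let e_dense a b : 0 <= a -> a < b -> b <= 1 -> exists n, a < e n < b.
Proof.
move=> a0 ab b1; have [q] := rat_in_itvoo ab.
rewrite in_itv /= => /andP[aq qb]; exists (choice.pickle q).
by rewrite /e choice.pickleK /= min_r ?max_r; [rewrite aq|lra|lra].
Qed.

Let G n := projT1 (cid (cond_lt (e n))).
Let bG n : bdm (G n). Proof. by rewrite /G; case: cid => g []. Qed.
Let G01 n t : 0 <= G n t <= 1. Proof. by rewrite /G; case: cid => g []. Qed.
Let Gact n h t : G n (act h t) = G n t. Proof. by rewrite /G; case: cid => g []. Qed.
Let GE n A : measurable A -> Ex mu (fun p => \1_A p.1 * lt_ind (e n) p.2) =
  Ex mu (fun p => \1_A p.1 * G n p.1).
Proof. by rewrite /G; case: cid => g [? ? ? h] mA; exact: h. Qed.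

(** The conditional quantile transform: [G n t] is the probability, given [t], of a value below
    [e n], and [f] is the infimum of the thresholds whose probability exceeds [p.2]. The element 1
    keeps the set nonempty. *)
Let f (p : T * R) : R := inf ([set 1] `|` [set e n | n in [set n | p.2 < G n p.1]]).

Let f_lt p c : (f p < c) = `[< 1 < c \/ exists2 n, e n < c & p.2 < G n p.1 >].
Proof.
have hi : has_inf ([set 1] `|` [set e n | n in [set n | p.2 < G n p.1]]).
  split; first by exists 1; left.
  by exists 0 => x [->|[n _ <-]]; rewrite ?ler01//; case/andP: (e01 n).
apply/idP/asboolP => [fc|[c1|[n ec hn]]].
- have fc' : 0 < c - f p by rewrite subr_gt0.
  have [x + xc] := inf_adherent fc' hi.
  rewrite -/(f p) addrC subrK in xc.
  by move=> [x1|[n hn xn]]; [left; rewrite -x1|right; exists n => //; rewrite xn].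
- by apply: le_lt_trans c1; apply: ge_inf; [case: hi|left].
- by apply: le_lt_trans ec; apply: ge_inf; [case: hi|right; exists n].
Qed.

Let mlt n : measurable [set p : T * R | p.2 < G n p.1].
Proof.
rewrite (_ : [set _ | _] = (fun p : T * R => p.2 - G n p.1) @^-1` `]-oo, 0[%classic).
  rewrite -[X in measurable X]setTI.
  have m : measurable_fun setT (fun p : T * R => p.2 - G n p.1).
    by apply: measurable_funB => //; case: (bdm_fst (bG n)).
  exact: m.
by apply/seteqP; split => p /=; rewrite in_itv /= subr_lt0.
Qed.

Let mf : measurable_fun setT f.
Proof.
apply: (measurability _ (@Iio_systemE R)) => _ [_ [c ->] <-]; rewrite setTI.
rewrite (_ : _ @^-1` _ = (if 1 < c then setT else set0) `|`
    \bigcup_(n in [set n | e n < c]) [set p : T * R | p.2 < G n p.1]).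
  apply: measurableU; first by case: ifP.
  by apply: bigcup_measurable => n _; exact: mlt.
apply/seteqP; split => p /=; rewrite in_itv /= f_lt.
  by move=> /asboolP [->|[n ? ?]]; [left|right; exists n].
by move=> [|[n ? ?]]; [case: ifP => // ? _; apply/asboolP; left|apply/asboolP; right; exists n].
Qed.

(** The largest [G k t] with [k < n] and [e k < c]: the chance, for uniform [x], that one of these
    thresholds witnesses [f (t, x) < c]. *)
Let m (c : R) : nat -> T -> R := fix m n t :=
  if n is k.+1 then (if e k < c then Num.max (m k t) (G k t) else m k t) else 0.

Let m01 c n t : 0 <= m c n t <= 1.
Proof.
elim: n => [|n /andP[IH0 IH1]] /=; first by rewrite lexx ler01.
case: ifP => _; rewrite ?IH0 ?IH1//.
by have /andP[a b] := G01 n t; rewrite le_max IH0 ge_max IH1.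
Qed.

Let mm c n : measurable_fun setT (m c n).
Proof.
elim: n => [|n IH] /=; first exact: measurable_cst.
by case: (e n < c) => //; apply: measurable_maxr => //; case: (bG n).
Qed.

Let bm c n : bdm (m c n).
Proof.
split; first exact: mm.
by exists 1 => t; have /andP[? ?] := m01 c n t; rewrite ger0_norm.
Qed.

Let lt_m c n t (x : R) : 0 <= x ->
  (x < m c n t) = `[< exists2 j, (j < n)%N & e j < c /\ x < G j t >].
Proof.
move=> x0; elim: n => [|n IH] /=.
  by rewrite ltNge x0; apply/esym/asboolPn => -[].
have [ec|ec] := ltP (e n) c.
  rewrite lt_max IH; apply/orP/asboolP => [[/asboolP[j jn h]|xG]|[j jn [ej xj]]].
  - by exists j => //; exact: ltnW.
  - by exists n.
  - move: jn; rewrite ltnS leq_eqVlt => /predU1P[jn|jn]; first by right; rewrite -jn.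
    by left; apply/asboolP; exists j.
rewrite IH; apply/asboolP/asboolP => [[j jn h]|[j jn [ej xj]]].
  by exists j => //; exact: ltnW.
move: jn; rewrite ltnS leq_eqVlt => /predU1P[jn|jn]; last by exists j.
by move: ej; rewrite jn ltNge ec.
Qed.

(** Each [G k] with [e k < c] integrates to at most the probability of a value below [c]. The
    maximum is handled by splitting [A] according to which function is larger, instead of through
    almost sure monotonicity of the [G n]. *)
Let Ex_m c n A : measurable A ->
  Ex mu (fun p => \1_A p.1 * m c n p.1) <= Ex mu (fun p => \1_A p.1 * lt_ind c p.2).
Proof.
have bA B : measurable B -> bdm (fun p : T * R => \1_B p.1 : R).
  by move=> mB; exact: (bdm_fst (bdm_indic R mB)).
elim: n A => [|n IH] A mA /=.
  rewrite (eq_Ex _ (Y := fun=> 0)) ?Ex_cst; last by move=> p; rewrite mulr0.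
  by apply: Ex_ge0 => p; rewrite mulr_ge0// lt_indE.
have [ec|_] := ltP (e n) c; last exact: IH.
pose B := A `&` [set t | m c n t <= G n t]; pose C := A `&` [set t | G n t < m c n t].
have mB : measurable B.
  apply: measurableI => //.
  rewrite (_ : [set t | _] = (fun t => G n t - m c n t) @^-1` `[0, +oo[%classic).
    rewrite -[X in measurable X]setTI.
    have [h _] : bdm (fun t => G n t - m c n t) by auto.
    exact: h.
  by apply/seteqP; split => t /=; rewrite in_itv /= andbT subr_ge0.
have mC : measurable C.
  apply: measurableI => //.
  rewrite (_ : [set t | _] = (fun t => G n t - m c n t) @^-1` `]-oo, 0[%classic).
    rewrite -[X in measurable X]setTI.
    have [h _] : bdm (fun t => G n t - m c n t) by auto.
    exact: h.
  by apply/seteqP; split => t /=; rewrite in_itv /= subr_lt0.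
have e1 t : (t \in [set t | m c n t <= G n t]) = (m c n t <= G n t).
  by apply/idP/idP => [/set_mem|/mem_set].
have e2 t : (t \in [set t | G n t < m c n t]) = (G n t < m c n t).
  by apply/idP/idP => [/set_mem|/mem_set].
have AE t : \1_A t = \1_B t + \1_C t :> R.
  by rewrite /B /C !indicI /= !indicE e1 e2; case: leP => _ /=; lra.
have bl : bdm (fun p : T * R => lt_ind c p.2) by exact: bdm_snd.
have bln : bdm (fun p : T * R => lt_ind (e n) p.2) by exact: bdm_snd.
have := bdm_fst (bG n) => bGn; have := bdm_fst (bm c n) => bmn.
have := bA _ mB => bB; have := bA _ mC => bC.
have -> : Ex mu (fun p => \1_A p.1 * Num.max (m c n p.1) (G n p.1)) =
    Ex mu (fun p => \1_B p.1 * G n p.1) + Ex mu (fun p => \1_C p.1 * m c n p.1).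
  rewrite -ExD; [|by auto|by auto].
  by apply: eq_Ex => p; rewrite AE /B /C !indicI /= !indicE e1 e2; case: leP => _ /=; lra.
have -> : Ex mu (fun p => \1_A p.1 * lt_ind c p.2) =
    Ex mu (fun p => \1_B p.1 * lt_ind c p.2) + Ex mu (fun p => \1_C p.1 * lt_ind c p.2).
  by rewrite -ExD; [apply: eq_Ex => p; rewrite AE mulrDl|auto|auto].
apply: lerD; last exact: IH.
rewrite -GE//; apply: le_Ex; [by auto|by auto|move=> p].
apply: ler_wpM2l; first by rewrite indicE.
rewrite !lt_indE ler_nat; have [h|//] := ltP p.2 (e n).
by rewrite (lt_trans h ec).
Qed.

Let Ex_lt_fst (A : set T) (g : T -> R) : measurable A -> bdm g -> (forall t, 0 <= g t <= 1) ->
  bdm (fun p : T * R => \1_A p.1 * lt_ind (g p.1) p.2) /\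
  Ex (muT \x U)%E (fun p => \1_A p.1 * lt_ind (g p.1) p.2) = Ex mu (fun p => \1_A p.1 * g p.1).
Proof.
move=> mA bg g01.
have bA : bdm (\1_A : T -> R) by exact: bdm_indic.
have bl : bdm (fun p : T * R => lt_ind (g p.1) p.2).
  have b0 : bdm (fun p : T * R => lt_ind 0 (p.2 - g p.1)).
    apply: (bdm_comp (phi := fun p : T * R => p.2 - g p.1) _ (bdm_lt 0)).
    by apply: measurable_funB => //; case: (bdm_fst bg).
  rewrite (_ : (fun p : T * R => lt_ind (g p.1) p.2) = fun p => lt_ind 0 (p.2 - g p.1))//.
  by apply/funext => p; rewrite !lt_indE subr_lt0.
have bAl : bdm (fun p : T * R => \1_A p.1 * lt_ind (g p.1) p.2).
  by apply: bdmM => //; exact: (bdm_fst bA).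
split => //; rewrite Ex_Fubini//.
have bAg : bdm (fun t => \1_A t * g t) by auto.
rewrite -(Ex_muT bAg); apply: eq_Ex => t /=.
rewrite ExZ; last exact: bdm_lt.
by rewrite Ex_unif_lt; have /andP[? ?] := g01 t; rewrite max_l// min_l.
Qed.

Let ae_snd : {ae mu, forall p, 0 <= p.2 <= 1}.
Proof.
have mp : mpres mu U snd.
  apply: mpres_Ex => [|A mA]; first exact: measurable_snd.
  by rewrite -(mu_snd (bdm_indic R mA)).
exact: (ae_mpres mp (unif01 R)).
Qed.

Let S c n : set (T * R) :=
  \bigcup_(j in [set j | (j < n)%N /\ e j < c]) [set p : T * R | p.2 < G j p.1].

Let mS c n : measurable (S c n).
Proof. by apply: bigcup_measurable => j _; exact: mlt. Qed.

Let S_ge (A : set T) c n : measurable A ->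
  Ex (muT \x U)%E (fun p => \1_A p.1 * \1_(S c n) p) = Ex mu (fun p => \1_A p.1 * m c n p.1).
Proof.
move=> mA; have [bl <-] := Ex_lt_fst mA (bm c n) (m01 c n).
apply: ae_Ex => //.
  by apply: bdmM; [exact: (bdm_fst (bdm_indic R mA))|apply: bdm_indic; exact: mS].
have mp : mpres (muT \x U)%E U snd.
  apply: mpres_Ex => [|B mB]; first exact: measurable_snd.
  have bB : bdm (fun p : T * R => \1_B p.2 : R) by exact: (bdm_snd (bdm_indic R mB)).
  by rewrite (Ex_Fubini muT U bB) /= Ex_cst.
apply: filterS (ae_mpres mp (unif01 R)) => p /andP[p0 _]; congr (_ * _).
rewrite lt_indE (lt_m c n p.1 p0) indicE; congr (nat_of_bool _)%:R.
apply/idP/asboolP => [/set_mem [j [jn ej] pj]|[j jn [ej pj]]]; first by exists j.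
by apply/mem_set; exists j.
Qed.

(** The upper bound is the limit of [Ex_m]. For the lower one, a threshold [e n] slightly below [c]
    gives the event [x < G n t], which implies [f (t, x) < c] and loses at most the mass of a short
    interval below [c]. *)
Let Phi_lt A c : measurable A ->
  Ex (muT \x U)%E (fun p => \1_A p.1 * lt_ind c (f p)) = Ex mu (fun p => \1_A p.1 * lt_ind c p.2).
Proof.
move=> mA.
have bA : bdm (fun p : T * R => \1_A p.1 : R) by exact: (bdm_fst (bdm_indic R mA)).
have A1 (p : T * R) : 0 <= (\1_A p.1 : R) <= 1 by rewrite indicE; case: (_ \in _); rewrite ?lexx ?ler01.
have bl c' : bdm (fun p : T * R => lt_ind c' p.2) by exact: bdm_snd.
have blf : bdm (fun p => lt_ind c (f p)) by apply: bdm_comp (bdm_lt c).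
have [c1|c1] := ltP 1 c.
  have -> : Ex (muT \x U)%E (fun p => \1_A p.1 * lt_ind c (f p)) = Ex muT \1_A.
    rewrite (eq_Ex _ (Y := fun p => \1_A p.1)); last first.
      by move=> p; rewrite lt_indE f_lt asboolT ?mulr1//; left.
    by rewrite Ex_Fubini//=; apply: eq_Ex => t; rewrite Ex_cst.
  rewrite (Ex_muT (bdm_indic R mA)); apply: ae_Ex => //; first by auto.
  apply: filterS ae_snd => p /andP[_ p1].
  by rewrite lt_indE (le_lt_trans p1 c1) mulr1.
have Aabs (P : probability (T * R)%type R) g h (x : R) : bdm g -> bdm h ->
    Ex P (fun p => `|g p - h p|) <= x ->
    `|Ex P (fun p => \1_A p.1 * g p) - Ex P (fun p => \1_A p.1 * h p)| <= x.
  move=> bg bh; apply: le_trans; rewrite -ExB; [|by auto|by auto].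
  apply: (le_trans (Ex_abs _ _)); first by auto.
  apply: le_Ex; [by auto|by auto|move=> p].
  have /andP[a0 a1] := A1 p.
  by rewrite -mulrBr normrM ger0_norm// ler_piMl.
apply/eqP; rewrite eq_le; apply/andP; split; apply/ler_addgt0Pl => x x0.
  have [n /(_ tt) hn] : exists n, forall i : unit, Ex (muT \x U)%E (fun p => `|lt_ind c (f p) - \1_(S c n) p|) <= x.
    apply: (Ex_dct_fin (fun=> muT \x U)%E (h := fun n => \1_(S c n) : T * R -> R) (M := 1)) => //.
    - by move=> n p; rewrite indicE; case: (_ \in _); rewrite ?normr1 ?normr0.
    move=> p; rewrite lt_indE f_lt.
    have [h|h] := pselect (1 < c \/ exists2 n, e n < c & p.2 < G n p.1).
      rewrite asboolT//; case: h => [|[k ek pk]]; first by lra.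
      apply: cvg_near_cst; exists k.+1 => // n /= kn.
      by rewrite indicE mem_set//; exists k.
    rewrite asboolF//; apply: cvg_near_cst; apply: nearW => n.
    rewrite indicE memNset// => -[k [_ ek] pk]; apply: h; right; by exists k.
  have bS : bdm (\1_(S c n) : T * R -> R) by apply: bdm_indic; exact: mS.
  have := Aabs _ _ _ _ blf bS hn.
  rewrite (S_ge c n mA); have := Ex_m c n mA.
  by rewrite ler_norml => a /andP[_ b]; lra.
have [c0|c0] := leP c 0.
  have -> : Ex mu (fun p => \1_A p.1 * lt_ind c p.2) = 0.
    rewrite -[RHS](Ex_cst mu); apply: ae_Ex => //; first by auto.
    apply: filterS ae_snd => p /andP[p0 _].
    by rewrite lt_indE ltNge (le_trans c0 p0) mulr0.
  apply: addr_ge0; first exact: ltW.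
  apply: Ex_ge0 => p; apply: mulr_ge0; first by case/andP: (A1 p).
  by rewrite lt_indE.
have [k /(_ tt) hk] : exists k, forall i : unit, Ex mu (fun p => `|lt_ind c p.2 - lt_ind (c - k.+1%:R^-1) p.2|) <= x.
  apply: (Ex_dct_fin (fun=> mu) (h := fun k p => lt_ind (c - k.+1%:R^-1) p.2) (M := 1)) => //.
  - by move=> n; case: (bl (c - n.+1%:R^-1)).
  - by move=> n p; rewrite lt_indE; case: (_ < _); rewrite ?normr1 ?normr0.
  move=> p; rewrite lt_indE; have [h|h] := ltP p.2 c.
    apply: cvg_near_cst; exists (Num.truncn (c - p.2)^-1).+1 => // n /= kn.
    rewrite lt_indE; suff -> : p.2 < c - n.+1%:R^-1 by [].
    rewrite ltrBrDr -ltrBrDl invf_plt ?posrE ?subr_gt0//.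
    apply: (lt_le_trans (truncnS_gt _)); rewrite ler_nat; exact: ltnW.
  apply: cvg_near_cst; apply: nearW => n; rewrite lt_indE.
  suff -> : (p.2 < c - n.+1%:R^-1) = false by [].
  apply/negbTE; rewrite -leNgt lerBlDr; apply: (le_trans h).
  by rewrite lerDl invr_ge0.
have k0 : 0 < k.+1%:R^-1 :> R by rewrite invr_gt0 ltr0n.
have [||n /andP[an nc]] := @e_dense (Num.max 0 (c - k.+1%:R^-1)) c _ _ c1.
- by rewrite le_max lexx.
- by rewrite gt_max c0 gtrBl.
have := Aabs _ _ _ _ (bl c) (bl (c - k.+1%:R^-1)) hk.
rewrite ler_norml => /andP[_ b].
have le1 : Ex mu (fun p => \1_A p.1 * lt_ind (c - k.+1%:R^-1) p.2) <=
    Ex mu (fun p => \1_A p.1 * lt_ind (e n) p.2).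
  apply: le_Ex; [by auto|by auto|move=> p].
  apply: ler_wpM2l; first by case/andP: (A1 p).
  rewrite !lt_indE ler_nat; case: (ltP p.2 (c - k.+1%:R^-1)) => // h.
  by rewrite (lt_trans h)//; apply: le_lt_trans an; rewrite le_max lexx orbT.
have [bln le2] := Ex_lt_fst mA (bG n) (G01 n).
have le3 : Ex (muT \x U)%E (fun p => \1_A p.1 * lt_ind (G n p.1) p.2) <=
    Ex (muT \x U)%E (fun p => \1_A p.1 * lt_ind c (f p)).
  apply: le_Ex; [by auto|by auto|move=> p].
  apply: ler_wpM2l; first by case/andP: (A1 p).
  rewrite !lt_indE ler_nat f_lt; case: (ltP p.2 (G n p.1)) => // h.
  by rewrite asboolT//; right; exists n.
rewrite GE// -le2 in le1.
move: b; rewrite lerBlDr => b; apply: (le_trans b); rewrite lerD2l.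
exact: le_trans le1 le3.
Qed.

(** Realises the second component of [mu] as a function of the first and of independent uniform
    noise. Invariance comes from that of the [G n], and the law is tested on half-lines by
    [Phi_lt]. *)
Theorem transfer : exists f : T * R -> R, [/\ measurable_fun setT f,
  forall g t x, f (act g t, x) = f (t, x) &
  mpres (law mu measurable_fst \x U)%E mu (fun p => (p.1, f p))].
Proof.
exists f; split => //.
- move=> g t x; rewrite /f; congr (inf (_ `|` _)); congr image.
  by apply/seteqP; split => n /=; rewrite Gact.
apply: Ex_product_mpres => [|A B mA mB]; first exact/measurable_fun_pair.
have bA : bdm (fun p : T * R => \1_A p.1 : R) by exact: (bdm_fst (bdm_indic R mA)).
have A1 (p : T * R) : `|(\1_A p.1 : R)| <= 1.
  by rewrite indicE; case: (_ \in _); rewrite ?normr1 ?normr0.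
pose D h := Ex (muT \x U)%E (fun p => \1_A p.1 * h (f p)) - Ex mu (fun p => \1_A p.1 * h p.2).
apply/eqP; rewrite -subr_eq0; apply/eqP; change (D \1_B = 0).
pose Ps (b : bool) := if b then law (muT \x U)%E mf else law mu measurable_snd.
have b1 (h : R -> R) : bdm h -> bdm (fun p => \1_A p.1 * h (f p)).
  by move=> bh; apply: bdmM => //; apply: bdm_comp bh.
have b2 (h : R -> R) : bdm h -> bdm (fun p : T * R => \1_A p.1 * h p.2).
  by move=> bh; apply: bdmM => //; exact: bdm_snd.
have DD g h : bdm g -> bdm h -> D (fun x => g x + h x) = D g + D h.
  move=> bg bh; rewrite /D.
  have -> : Ex (muT \x U)%E (fun p => \1_A p.1 * (g (f p) + h (f p))) =
      Ex (muT \x U)%E (fun p => \1_A p.1 * g (f p)) + Ex (muT \x U)%E (fun p => \1_A p.1 * h (f p)).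
    by rewrite -(ExD _ (b1 _ bg) (b1 _ bh)); apply: eq_Ex => p; rewrite mulrDr.
  have -> : Ex mu (fun p => \1_A p.1 * (g p.2 + h p.2)) =
      Ex mu (fun p => \1_A p.1 * g p.2) + Ex mu (fun p => \1_A p.1 * h p.2).
    by rewrite -(ExD _ (b2 _ bg) (b2 _ bh)); apply: eq_Ex => p; rewrite mulrDr.
  by lra.
have DZ a h : bdm h -> D (fun x => a * h x) = a * D h.
  move=> bh; rewrite /D mulrBr -(ExZ _ _ (b1 _ bh)) -(ExZ _ _ (b2 _ bh)).
  by congr (_ - _); apply: eq_Ex => p; rewrite mulrCA.
have Dc h : bdm h -> `|D h| <= 1 * \sum_i Ex (Ps i) (fun x => `|h x|).
  move=> bh; rewrite mul1r big_bool /=; apply: (le_trans (ler_normB _ _)); apply: lerD.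
    rewrite -(Ex_mpres (mpres_law (muT \x U)%E mf) (bdm_abs bh)).
    apply: (le_trans (Ex_abs _ (b1 _ bh))).
    apply: le_Ex; [exact: bdm_abs (b1 _ bh)|by apply: (bdm_comp mf (bdm_abs bh))|move=> p].
    by rewrite normrM ler_piMl.
  rewrite -(Ex_mpres (mpres_law mu measurable_snd) (bdm_abs bh)).
  apply: (le_trans (Ex_abs _ (b2 _ bh))).
  apply: le_Ex; [exact: bdm_abs (b2 _ bh)|exact: (bdm_snd (bdm_abs bh))|move=> p].
  by rewrite normrM ler_piMl.
apply: (linear_functional_eq0 DD DZ Dc (@Iio_systemE R) (@Iio_systemI R)) (bdm_indic R mB).
- by move=> _ [c ->]; apply/eqP; rewrite subr_eq0; apply/eqP; exact: Phi_lt.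
- apply/eqP; rewrite subr_eq0; apply/eqP.
  (* A threshold above 1 makes both indicators 1 almost surely, which settles the constant
     function. *)
  have := Phi_lt 2 mA; rewrite /D.
  rewrite (eq_Ex _ (Y := fun p => \1_A p.1 * 1)) => [->|p]; last first.
    by rewrite lt_indE f_lt asboolT//; left; lra.
  apply: ae_Ex; [exact: b2 (bdm_lt 2)|exact: (b2 (fun=> 1))|].
  apply: filterS ae_snd => p /andP[_ p1].
  by rewrite lt_indE (le_lt_trans p1)//; lra.
Qed.

End transfer.

(** * Coordinates with a free and a reference part *)

(** Sort the coordinates by decreasing rank. The first is uniform and independent of all that
    ignores its block, and the later ones do ignore it, so the factors can be peeled off one by
    one. *)
Lemma mpres_triangular (R : realType) (I J : countType) (bl : I -> J) (rk : J -> nat)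
    (v : Omega R I -> Omega R J) :
  measurable_fun setT v ->
  (forall j F h, bdm F -> bdm h -> dep (fun i => bl i != j) F ->
    Ex (iid R I) (fun u => F u * h (v u j)) = Ex (iid R I) F * Ex (unif R) h) ->
  (forall j j', j != j' -> (rk j' <= rk j)%N -> dep (fun i => bl i != j) (fun u => v u j')) ->
  mpres (iid R I) (iid R J) v.
Proof.
move=> mv ind dv; apply: mpres_iid => // s h us bh.
pose le j j' := (rk j' <= rk j)%N.
have le_tr : transitive le by move=> j1 j2 j3 h1 h2; exact: leq_trans h2 h1.
have le_tot : total le by move=> j1 j2; exact: leq_total.
have ps : perm_eq (sort le s) s by rewrite perm_sort.
rewrite -(perm_big _ ps) (eq_Ex _ (Y := fun u : Omega R I => \prod_(j <- sort le s) h j (v u j))); last first.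
  by move=> u; rewrite (perm_big _ ps).
have : uniq (sort le s) by rewrite sort_uniq.
have : sorted le (sort le s) by exact: sort_sorted.
have bhv j : bdm (fun u => h j (v u j)).
  by apply: (bdm_comp (phi := fun u => v u j) _ (bh j)); exact: measurableT_comp (measurable_coord j) mv.
elim: (sort le s) => [|j t IH] st ut.
  by rewrite big_nil -[RHS](Ex_cst (iid R I)); apply: eq_Ex => u; rewrite big_nil.
move: ut => /= /andP[jt ut].
rewrite big_cons -IH//; last exact: path_sorted st.
rewrite mulrC -(ind j)//.
- by apply: eq_Ex => u; rewrite big_cons mulrC.
- exact: bdm_prod.
move=> u u' uu'; apply: eq_big_seq => j' j't; congr (h j' _).
apply: (dv j j') => //; first by apply: contraNneq jt => ->.
by have /allP := order_path_min le_tr st; apply.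
Qed.

Lemma prod_fibers (R : realType) (J K : eqType) (s : seq (J * K)) (F : J * K -> R) :
  \prod_(p <- s) F p =
  \prod_(j <- undup (map fst s)) \prod_(p <- s) (if p.1 == j then F p else 1).
Proof.
rewrite exchange_big /=; apply: eq_big_seq => p ps.
have js : p.1 \in undup (map fst s) by rewrite mem_undup map_f.
rewrite (bigD1_seq p.1 js (undup_uniq _)) /= eqxx big1 ?mulr1// => j jp.
by rewrite eq_sym (negbTE jp).
Qed.

Lemma mpres_digits (R : realType) (J K : countType) :
  mpres (iid R J) (iid R (J * K)%type)
    (fun w => fun p : J * K => rho (choice.pickle p.2) (w p.1)).
Proof.
apply: mpres_iid => [|s h us bh].
  by apply: measurable_Omega => p; exact: measurableT_comp (@measurable_rho R _) (measurable_coord p.1).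
pose H j x := \prod_(p <- s) (if p.1 == j then h p (rho (choice.pickle p.2) x) else 1).
have bH j : bdm (H j).
  apply: bdm_prod => p; case: (p.1 == j) => //.
  exact: (bdm_comp (@measurable_rho R _) (bh p)).
rewrite (eq_Ex _ (Y := fun w : Omega R J => \prod_(j <- undup (map fst s)) H j (w j))); last first.
  move=> w; rewrite prod_fibers; apply: eq_bigr => j _; apply: eq_bigr => p _.
  by case: eqP => // ->.
rewrite Ex_iid_prod ?undup_uniq// [RHS]prod_fibers; apply: eq_bigr => j _.
pose t := [seq p.2 | p <- s & p.1 == j].
have ut : uniq t.
  rewrite map_inj_in_uniq ?filter_uniq// => -[a b] [a' b'] /=.
  by rewrite !mem_filter /= => /andP[/eqP -> _] /andP[/eqP -> _] ->.
have E (G : J * K -> R) : \prod_(p <- s) (if p.1 == j then G p else 1) = \prod_(k <- t) G (j, k).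
  rewrite -big_mkcond -big_filter big_map; apply: eq_big_seq => -[a b].
  by rewrite mem_filter /= => /andP[/eqP -> _].
rewrite E -(Ex_iid_prod ut (fun k => bh (j, k))).
rewrite -(Ex_mpres (mpres_rho R K) (bdm_prod_coord t (fun k => bh (j, k)))).
by apply: eq_Ex => x; rewrite /H E.
Qed.

Section free_reference.

Definition vertex : countType := (nat + nat)%type.

Definition freepart (C : {fset vertex}) : {fset nat} :=
  [fset x | x in pmap (fun w : vertex => if w is inl x then Some x else None) (enum_fset C)]%fset.

Definition refpart (C : {fset vertex}) : {fset nat} :=
  [fset x | x in pmap (fun w : vertex => if w is inr x then Some x else None) (enum_fset C)]%fset.

Lemma in_freepart C x : (x \in freepart C) = (inl x \in C).
Proof.
apply/imfsetP/idP => [[y /= + ->]|xC].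
  by rewrite mem_pmap => /mapP[[z|//] zC [->]].
by exists x => //=; rewrite mem_pmap; apply/mapP; exists (inl x).
Qed.

Lemma in_refpart C x : (x \in refpart C) = (inr x \in C).
Proof.
apply/imfsetP/idP => [[y /= + ->]|xC].
  by rewrite mem_pmap => /mapP[[//|z] zC [->]].
by exists x => //=; rewrite mem_pmap; apply/mapP; exists (inr x).
Qed.

Lemma parts_inj C C' : freepart C = freepart C' -> refpart C = refpart C' -> C = C'.
Proof.
move=> f r; apply/fsetP => -[x|x]; first by rewrite -!in_freepart f.
by rewrite -!in_refpart r.
Qed.

Definition mapfree (s : nat -> nat) (w : vertex) : vertex :=
  if w is inl x then inl (s x) else w.

Lemma mapfree_inj s : injective s -> injective (mapfree s).
Proof. by move=> injs [x|x] [y|y] //= [/injs ->]. Qed.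

Lemma freepart_map s C : freepart (mapfree s @` C)%fset = (s @` freepart C)%fset.
Proof.
apply/fsetP => x; rewrite in_freepart; apply/imfsetP/imfsetP => /= -[].
  by move=> [y|//] yC [->]; exists y => //=; rewrite in_freepart.
by move=> y; rewrite in_freepart => yC ->; exists (inl y).
Qed.

Lemma refpart_map s C : refpart (mapfree s @` C)%fset = refpart C.
Proof.
apply/fsetP => x; rewrite !in_refpart; apply/imfsetP/idP => [[[//|y] /= yC [->]]//|xC].
by exists (inr x).
Qed.

Definition iset (n : nat) : {fset nat} := [fset x | x in iota 0 n]%fset.

Lemma in_iset n x : (x \in iset n) = (x < n)%N.
Proof.
apply/imfsetP/idP => [[y /= + ->]|xn]; first by rewrite mem_iota.
by exists x => //=; rewrite mem_iota.
Qed.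

Lemma card_iset n : #|` iset n| = n.
Proof. by rewrite card_imfset//= undup_id ?iota_uniq// size_iota. Qed.

(** The enumeration of [A] extended to an injection of all naturals: relabelings act on all sites,
    so the other indices are sent beyond the maximum of [A]. *)
Definition sigma (A : {fset nat}) (i : nat) : nat :=
  if (i < #|` A|)%N then nth 0%N (enum_fset A) i else (i + \max_(x <- enum_fset A) x).+1.

Lemma sigma_inj A : injective (sigma A).
Proof.
have le_max x : x \in A -> (x <= \max_(y <- enum_fset A) y)%N.
  by move=> xA; rewrite (big_rem x xA) /= leq_maxl.
have nthA i : (i < #|` A|)%N -> nth 0%N (enum_fset A) i \in A by move=> iA; exact: mem_nth.
move=> i j; rewrite /sigma; case: ifPn => iA; case: ifPn => jA.
- by move/eqP; rewrite nth_uniq ?fset_uniq// => /eqP.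
- by move=> e; have := le_max _ (nthA _ iA); rewrite e; lia.
- by move=> e; have := le_max _ (nthA _ jA); rewrite -e; lia.
- by lia.
Qed.

Lemma sigma_iset A : (sigma A @` iset #|` A|)%fset = A.
Proof.
apply/fsetP => x; apply/imfsetP/idP => /= [[i]|xA].
  by rewrite in_iset => iA ->; rewrite /sigma iA; exact: mem_nth.
have ix : (index x (enum_fset A) < #|` A|)%N by rewrite index_mem.
by exists (index x (enum_fset A)); rewrite ?in_iset// /sigma ix nth_index.
Qed.

Lemma imfset_comp_fset (s t : nat -> nat) (A : {fset nat}) :
  (s @` (t @` A))%fset = ((s \o t) @` A)%fset.
Proof.
apply/fsetP => x; apply/imfsetP/imfsetP => /= -[y].
  by move=> /imfsetP[z /= zA ->] ->; exists z.
by move=> yA ->; exists (t y) => //=; apply/imfsetP; exists y.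
Qed.

Lemma card_imfset_inj (s : nat -> nat) (A : {fset nat}) : injective s ->
  #|` (s @` A)%fset| = #|` A|.
Proof. by move=> injs; rewrite card_imfset. Qed.

End free_reference.

Section levels.
Context (R : realType).

(* A coordinate (A, Some B) is the randomness of the set with free part A and
   reference part B; (A, None) is spare randomness used to build level A. *)
Definition site : countType := ({fset nat} * option {fset nat})%type.

Local Notation Om := (Omega R site).
Local Notation P := (iid R site).
Local Notation U := (unif R).

Definition mapsite (s : nat -> nat) (a : site) : site := ((s @` a.1)%fset, a.2).

Definition relabel (s : nat -> nat) (u : Om) : Om := fun a => u (mapsite s a).

Lemma mapsite_inj s : injective s -> injective (mapsite s).
Proof. by move=> injs [A k] [B l] [] /(imfset_injective injs) -> ->. Qed.

Lemma measurable_relabel_site s : measurable_fun setT (relabel s).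
Proof. exact: measurable_relabel. Qed.

Lemma mpres_relabel_site s : injective s -> mpres P P (relabel s).
Proof. by move=> injs; apply: mpres_relabel; exact: mapsite_inj. Qed.

Lemma relabel_comp s t u : relabel t (relabel s u) = relabel (s \o t) u.
Proof. by apply/funext => -[A k]; rewrite /relabel /mapsite /= imfset_comp_fset. Qed.

(** A level lives on the standard free set [iset e]; other sets are reached by relabeling.
    [level_sym] is invariance under permutations of [iset e], phrased for two enumerations of one
    set, and [level_ind] says that the value is uniform given all sites with another free part. *)
Record level (e : nat) (g : Om -> R) : Prop := Level {
  level_measurable : measurable_fun setT g;
  level_dep : dep (fun a => a.1 `<=` iset e)%fset g;
  level_sym : forall s s' u, {in iset e &, injective s} -> {in iset e &, injective s'} ->
    (s @` iset e)%fset = (s' @` iset e)%fset -> g (relabel s u) = g (relabel s' u);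
  level_ind : forall F h, bdm F -> bdm h -> dep (fun a => a.1 != iset e) F ->
    Ex P (fun u => F u * h (g u)) = Ex P F * Ex U h }.

(** The centred conditional expectation [K] is itself an admissible [F] in [level_ind], which shows
    that its second moment vanishes. *)
Lemma level_condE e g h : level e g -> bdm h ->
  Ex P (fun u => (condE (fun a => a.1 != iset e) (fun u => h (g u)) u - Ex U h) ^+ 2) = 0.
Proof.
move=> hg bh; set c := Ex U h; pose S0 : pred site := fun a => a.1 != iset e.
have bhg : bdm (fun u => h (g u)).
  by apply: (bdm_comp (phi := g) _ bh); exact: (level_measurable hg).
pose K u := condE S0 (fun u => h (g u)) u - c.
have bK : bdm K by apply: bdmB => //; exact: bdm_condE.
have dK : dep S0 K.
  move=> u u' uu'; congr (_ - _).
  by apply: (dep_condE (D := xpredT) (S := S0) (F := fun u => h (g u))) => [v v' vv'|i /andP[Si _]];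
    [congr (h (g _)); apply/funext => i; exact: vv'|exact: uu'].
rewrite (eq_Ex _ (Y := fun u => K u * condE S0 (fun u => h (g u)) u - c * K u)); last first.
  by move=> u; rewrite expr2 -/S0 -/(K u) {2}/K; lra.
rewrite ExB; [|by apply: bdmM => //; exact: bdm_condE|exact: bdmM].
by rewrite (Ex_condE dK)// (level_ind hg)// ExZ// -/c; lra.
Qed.

(** [sample] reads no site with second component [None], so this variable is independent of the
    structure sampled from [N]. *)
Definition spare (e : nat) (u : Om) : R := u (iset e, None).

Lemma level_spare e : level e (spare e).
Proof.
split.
- exact: measurable_coord.
- by move=> u u'; apply; rewrite /= fsubset_refl.
- by move=> s s' u _ _ ss'; rewrite /spare /relabel /mapsite /= ss'.
- move=> F h bF bh dF.
  have bh' : bdm (fun u : Om => h (spare e u)).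
    exact: (bdm_comp (@measurable_coord R site (iset e, None)) bh).
  rewrite (Ex_indep (D := pred1 (iset e, None)) dF)//.
  + by congr (_ * _); exact: (Ex_mpres (mpres_coord R ((iset e, None) : site)) bh).
  + by move=> u u' uu'; congr (h _); apply: uu'; exact: eqxx.
  + by move=> a /= /eqP ->; rewrite eqxx.
Qed.

(** The coordinate of [A] is the level of size |A| transported along [sigma A]; by [level_sym] the
    choice of the enumeration is immaterial. *)
Definition assemble (g : nat -> Om -> R) (u : Om) : Omega R {fset nat} :=
  fun A => g #|` A| (relabel (sigma A) u).

Section assemble.
Context (g : nat -> Om -> R) (hg : forall e, level e (g e)).

Lemma dep_assemble A : dep (fun a : site => a.1 `<=` A)%fset (fun u => assemble g u A).
Proof.
move=> u u' uu'; apply: (level_dep (hg _)) => a aA; apply: uu' => /=.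
rewrite -[X in (_ `<=` X)%fset](sigma_iset A); apply/fsubsetP => _ /imfsetP[/= x xa ->].
by apply/imfsetP; exists x => //=; exact: (fsubsetP aA).
Qed.

Lemma assemble_relabel s u A : injective s ->
  assemble g (relabel s u) A = assemble g u (s @` A)%fset.
Proof.
move=> injs; rewrite /assemble relabel_comp card_imfset_inj//.
apply: (level_sym (hg _)).
- by move=> x y _ _ /injs /sigma_inj.
- by move=> x y _ _ /sigma_inj.
- by rewrite -imfset_comp_fset sigma_iset -(card_imfset_inj A injs) sigma_iset.
Qed.

Lemma measurable_assemble : measurable_fun setT (assemble g).
Proof.
apply: measurable_Omega => A.
exact: measurableT_comp (level_measurable (hg _)) (measurable_relabel_site _).
Qed.

(** [level_condE] transported by [relabel (sigma A)]: given the other blocks the mean of [h] is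
    constant up to [K], and Cauchy-Schwarz discards [K], whose second moment is 0. *)
Lemma assemble_ind A F h : bdm F -> bdm h -> dep (fun a : site => a.1 != A) F ->
  Ex P (fun u => F u * h (assemble g u A)) = Ex P F * Ex U h.
Proof.
move=> bF bh dF; set e := #|` A|; set c := Ex U h.
pose S0 : pred site := fun a => a.1 != iset e.
pose S1 : pred site := fun a => a.1 != A.
have bhg : bdm (fun u => h (g e u)).
  by apply: (bdm_comp (phi := g e) _ bh); exact: (level_measurable (hg e)).
pose K u := condE S0 (fun u => h (g e u)) u - c.
have bK : bdm K by apply: bdmB => //; exact: bdm_condE.
have K0 : Ex P (fun u => K u ^+ 2) = 0 by exact: level_condE (hg e) bh.
pose phi := relabel (sigma A).
have mphi : mpres P P phi by apply: mpres_relabel_site; exact: sigma_inj.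
have bhA : bdm (fun u => h (assemble g u A)).
  by apply: (bdm_comp (phi := phi) _ bhg); case: mphi.
have bKp : bdm (fun u => K (phi u)) by apply: (bdm_comp (phi := phi) _ bK); case: mphi.
have cE u : condE S1 (fun u => h (assemble g u A)) u = K (phi u) + c.
  rewrite /K subrK -(condE_morph (S := S1) (F := fun u => h (g e u)))// => w w'.
  apply/funext => a; rewrite /phi /relabel /splice /S1 /S0 /=; congr (if ~~ _ then _ else _).
  rewrite -{2}(sigma_iset A); apply/eqP/eqP => [|->//].
  by apply: imfset_injective; exact: sigma_inj.
rewrite -(Ex_condE (S := S1))//.
rewrite (eq_Ex _ (Y := fun u => F u * K (phi u) + c * F u)); last by move=> u; rewrite cE; lra.
rewrite ExD; [|by auto|by auto].
rewrite ExZ// (_ : Ex P (fun u => F u * K (phi u)) = 0); first by lra.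
apply/eqP; rewrite -sqrf_eq0 eq_le sqr_ge0 andbT.
apply: (le_trans (Ex_CS _ bF bKp)).
have bK2 : bdm (fun u => K u ^+ 2) by auto.
by rewrite (Ex_mpres mphi bK2) K0 mulr0.
Qed.

Lemma mpres_assemble : mpres P (iid R {fset nat}) (assemble g).
Proof.
apply: (mpres_triangular (bl := fst) (rk := fun A : {fset nat} => #|` A|)).
- exact: measurable_assemble.
- by move=> A F h bF bh dF; exact: assemble_ind.
- move=> A A' AA' le; apply: depW (@dep_assemble A') => -[B k] /= BA'.
  by apply: contraNneq AA' => BA; rewrite eqEfcard -{1}BA BA' le.
Qed.

End assemble.

Definition sample (u : Om) : Omega R {fset vertex} := fun C => u (freepart C, Some (refpart C)).

(** The digits of the single coordinate of the free part are used as the coordinates for all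
    reference parts. *)
Definition decode_sets (v : Omega R {fset nat}) : Omega R {fset vertex} :=
  fun C => rho (choice.pickle (refpart C)) (v (freepart C)).

Lemma mpres_sample : mpres P (iid R {fset vertex}) sample.
Proof.
have /(mpres_relabel R) : injective (fun C => (freepart C, Some (refpart C)) : site).
  by move=> C C' [] /parts_inj; exact.
exact.
Qed.

Lemma mpres_decode_sets : mpres (iid R {fset nat}) (iid R {fset vertex}) decode_sets.
Proof.
have /(mpres_relabel R) h : injective (fun C => (freepart C, refpart C)).
  by move=> C C' [] /parts_inj; exact.
exact: (mpres_comp (@mpres_digits R {fset nat} {fset nat}) h).
Qed.

End levels.

Lemma sqr_dist_le (R : realFieldType) (a b c x : R) :
  (a - c) ^+ 2 <= x / 4 -> (b - c) ^+ 2 <= x / 4 -> (a - b) ^+ 2 <= x.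
Proof.
have := sqr_ge0 ((a - c) + (b - c)).
rewrite (_ : a - b = (a - c) - (b - c)); last by lra.
by move: (a - c) (b - c) => y z; rewrite !expr2; lra.
Qed.

Lemma ae_countable (R : realType) d (T : measurableType d) (P : probability T R)
    (I : countType) (Q : I -> T -> Prop) :
  (forall i, {ae P, forall x, Q i x}) -> {ae P, forall x, forall i, Q i x}.
Proof.
move=> h; have : {ae P, forall x, forall n : nat, if choice.unpickle n is Some i then Q i x else True}.
  by apply/ae_foralln => n; case: choice.unpickle => [i|]; [exact: h|exact: aeW].
by apply: filterS => x hx i; have := hx (choice.pickle i); rewrite choice.pickleK.
Qed.

Lemma imfset_fsubset_inj (s : nat -> nat) (A B : {fset nat}) : injective s ->
  ((s @` A) `<=` (s @` B))%fset = (A `<=` B)%fset.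
Proof.
move=> injs; apply/fsubsetP/fsubsetP => h x.
  move=> xA; have /h : s x \in (s @` A)%fset by apply/imfsetP; exists x.
  by move=> /imfsetP[/= y yB /injs ->].
by move=> /imfsetP[/= y yA ->]; apply/imfsetP; exists y => //=; exact: h.
Qed.

Section map_atom_comp.
Context (L : language) (W : countType).

Lemma map_atom_comp (s t : W -> W) (b : atom L W) :
  map_atom s (map_atom t b) = map_atom (s \o t) b.
Proof.
case: b => Q b; rewrite /map_atom /=; congr Tagged.
by apply: val_inj; rewrite /= map_comp.
Qed.

Lemma eq_map_atom (s t : W -> W) (b : atom L W) : {in supp b, s =1 t} ->
  map_atom s b = map_atom t b.
Proof.
case: b => Q b st; rewrite /map_atom /=; congr Tagged.
by apply: val_inj; apply/eq_in_map => x; exact: st.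
Qed.

Lemma map_atom_id (s : W -> W) (b : atom L W) : {in supp b, s =1 id} -> map_atom s b = b.
Proof.
case: b => Q b st; rewrite /map_atom /=; congr Tagged.
by apply: val_inj; rewrite /= map_id_in.
Qed.

End map_atom_comp.

Section ext.
Context (d : nat).

Definition ext (p : {perm 'I_d}) (i : nat) : nat :=
  if insub i is Some j then val (p j) else i.

Lemma ext_ord p (j : 'I_d) : ext p j = p j.
Proof. by rewrite /ext valK. Qed.

Lemma ext_ge p i : (d <= i)%N -> ext p i = i.
Proof. by move=> di; rewrite /ext insubF// ltnNge di. Qed.

Lemma ext_comp g h i : ext g (ext h i) = ext (h * g)%g i.
Proof.
have [id|di] := ltnP i d; last by rewrite !ext_ge.
by rewrite -[i]/(val (Ordinal id)) !ext_ord permM.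
Qed.

Lemma ext1 i : ext 1%g i = i.
Proof.
have [id|di] := ltnP i d; last by rewrite !ext_ge.
by rewrite -[i]/(val (Ordinal id)) ext_ord perm1.
Qed.

Lemma ext_inj p : injective (ext p).
Proof. by apply: (can_inj (g := ext p^-1%g)) => i; rewrite ext_comp mulgV ext1. Qed.

Lemma ext_iset p : (ext p @` iset d)%fset = iset d.
Proof.
apply/eqP; rewrite eqEfcard card_imfset_inj ?leqnn ?andbT; last exact: ext_inj.
apply/fsubsetP => _ /imfsetP[/= i + ->]; rewrite !in_iset => id.
by rewrite -[i]/(val (Ordinal id)) ext_ord.
Qed.

Lemma same_image_ext (s s' : nat -> nat) :
  {in iset d &, injective s} -> {in iset d &, injective s'} ->
  (s @` iset d)%fset = (s' @` iset d)%fset ->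
  exists p, {in iset d, s' =1 s \o ext p}.
Proof.
move=> injs injs' ss'.
have ex (i : 'I_d) : exists j : 'I_d, s j == s' i.
  have : s' i \in (s @` iset d)%fset.
    by rewrite ss'; apply/imfsetP; exists (val i); rewrite //= in_iset.
  by move=> /imfsetP[/= j]; rewrite in_iset => jd ->; exists (Ordinal jd).
pose q (i : 'I_d) := odflt i [pick j : 'I_d | s j == s' i].
have qE i : s (q i) = s' i.
  by rewrite /q; case: pickP => [j /eqP//|]; have [j sj] := ex i => /(_ j); rewrite sj.
have q_inj : injective q.
  move=> i j qij; apply: val_inj; apply: injs'; [by rewrite in_iset ltn_ord|by rewrite in_iset ltn_ord|].
  by have := qE i; rewrite qij qE => h; exact: esym h.
exists (perm q_inj) => i; rewrite in_iset => id.
change (s' (Ordinal id) = s (ext (perm q_inj) (Ordinal id))).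
by rewrite ext_ord permE qE.
Qed.

End ext.

(** * Construction of the levels by induction *)

Section step.
Context (R : realType) (L : language).
Context (N N' : forall P : L, set (Omega R (r 'I_(arity P))))
  (mN : forall P, measurable (N P)) (mN' : forall P, measurable (N' P)).
Local Notation at_ := (atom L vertex).
Local Notation Om := (Omega R site).
Local Notation P := (iid R site).
Local Notation PX := (iid R {fset vertex}).
Local Notation U := (unif R).
Hypothesis same_law : forall F : Omega R at_ -> R, bdm F ->
  Ex PX (fun X => F (bits N X)) = Ex PX (fun X => F (bits N' X)).

Definition atom_free (b : at_) : {fset nat} := freepart [fset w | w in supp b]%fset.

Lemma in_atom_free b x : (x \in atom_free b) = (inl x \in supp b).
Proof. by rewrite in_freepart; apply/imfsetP/idP => [[/= y yb ->]//|xb]; exists (inl x). Qed.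

Lemma atom_free_map s b : atom_free (map_atom (mapfree s) b) = (s @` atom_free b)%fset.
Proof.
apply/fsetP => x; rewrite in_atom_free supp_map_atom.
apply/mapP/imfsetP => [[[y|//] yb [->]]|[/= y + ->]].
  by exists y => //=; rewrite in_atom_free.
by rewrite in_atom_free => yb; exists (inl y).
Qed.

(** Only free vertices are counted. The number of reference vertices stays unbounded, and the
    approximating low functions make use of this. *)
Definition agree (g : nat -> Om -> R) d := forall b : at_, (#|` atom_free b| < d)%N ->
  {ae P, forall u, bits N (sample u) b = bits N' (decode_sets (assemble g u)) b}.

Lemma decode_eq (v v' : Omega R {fset nat}) (M : forall P : L, set (Omega R (r 'I_(arity P)))) b :
  (forall A, (A `<=` atom_free b)%fset -> v A = v' A) ->
  bits M (decode_sets v) b = bits M (decode_sets v') b.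
Proof.
move=> vv'; apply: (@dep_bits R L vertex M b) => C /allP Cb.
rewrite /decode_sets vv'//; apply/fsubsetP => x; rewrite in_freepart in_atom_free; exact: Cb.
Qed.

Lemma bits_sample_relabel (M : forall P : L, set (Omega R (r 'I_(arity P)))) s u b :
  injective s ->
  bits M (sample (relabel s u)) b = bits M (sample u) (map_atom (mapfree s) b).
Proof.
move=> injs; rewrite -bits_map; last exact: mapfree_inj.
congr (bits M _ b); apply/funext => C.
by rewrite /sample /relabel /mapsite freepart_map refpart_map.
Qed.

Lemma bits_decode_relabel (M : forall P : L, set (Omega R (r 'I_(arity P)))) g s u b :
  (forall e, level e (g e)) -> injective s ->
  bits M (decode_sets (assemble g (relabel s u))) b =
  bits M (decode_sets (assemble g u)) (map_atom (mapfree s) b).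
Proof.
move=> hg injs; rewrite -bits_map; last exact: mapfree_inj.
congr (bits M _ b); apply/funext => C.
by rewrite /decode_sets assemble_relabel// freepart_map refpart_map.
Qed.

Section one_step.
Context (d : nat) (g : nat -> Om -> R).
Hypothesis hg : forall e, level e (g e).
Hypothesis gd : forall e, (d <= e)%N -> g e = @spare R e.
Hypothesis ag : agree g d.
Local Notation V0 := (iset d).
Let V : {fset vertex} := [fset (inl x : vertex) | x in V0]%fset.
(** All reference vertices but only the free vertices of [V]: a vertex fresh for a set containing
    [V] is then a reference vertex, and a low function reads atoms with fewer than [d] free
    vertices. *)
Let Z : pred vertex := fun w => if w is inl x then (x < d)%N else true.
Let Su : pred site := fun a => ~~ (V0 `<=` a.1)%fset.
Let SX : pred {fset vertex} := fun C => ~~ (V `<=` C)%fset.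
Let Y (u : Om) := decode_sets (assemble g u).

Let V_sub C : (V `<=` C)%fset = (V0 `<=` freepart C)%fset.
Proof.
apply/fsubsetP/fsubsetP => h x.
  by move=> xV; rewrite in_freepart; apply: h; apply/imfsetP; exists x.
by move=> /imfsetP[/= y yV ->]; rewrite -in_freepart; exact: h.
Qed.

Let fresh (D : {fset vertex}) : exists2 z, Z z & z \notin D.
Proof.
exists (inr (\max_(x <- enum_fset (refpart D)) x).+1) => //.
rewrite -in_refpart; apply/negP => h.
have le_max x : x \in refpart D -> (x <= \max_(y <- enum_fset (refpart D)) y)%N.
  by move=> xA; rewrite (big_rem x xA) /= leq_maxl.
by have := le_max _ h; rewrite ltnn.
Qed.

Let VZ i : i \in V -> Z i.
Proof. by move=> /imfsetP[/= x + ->]; rewrite in_iset. Qed.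

Let assemble_spare u A : (V0 `<=` A)%fset -> assemble g u A = u (A, None).
Proof.
move=> VA; have dA : (d <= #|` A|)%N by rewrite -[d]card_iset fsubset_leq_card.
by rewrite /assemble gd// /spare /relabel /mapsite /= sigma_iset.
Qed.

Let mpresY : mpres P PX Y.
Proof. exact: mpres_comp (mpres_assemble hg) (@mpres_decode_sets R). Qed.

(** A coordinate whose free part contains [V0] is still spare and reads one site, while any other
    reads only sites whose free part does not contain [V0]. *)
Let Y_splice u u' : Y (splice Su u u') = splice SX (Y u) (Y u').
Proof.
apply/funext => C; rewrite /splice /SX V_sub /Y /decode_sets; case: ifPn => VC; congr rho.
  apply: (dep_assemble hg) => a aC; rewrite /splice /Su.
  by case: ifPn => // /negPn Va; rewrite (fsubset_trans Va aC) in VC.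
by move/negPn: VC => VC; rewrite !assemble_spare// /splice /Su /= VC.
Qed.

Let sample_splice (u u' : Om) : sample (splice Su u u') = splice SX (sample u) (sample u').
Proof. by apply/funext => C; rewrite /splice /SX V_sub. Qed.

(** Since [w] depends on [Su] only, [G] may be replaced by its conditional expectation before
    applying Cauchy-Schwarz. *)
Let weak_bound (Q : Om -> Omega R {fset vertex}) w G : mpres P PX Q ->
  (forall u u', Q (splice Su u u') = splice SX (Q u) (Q u')) ->
  bdm w -> dep Su w -> bdm G ->
  Ex P (fun u => w u * G (Q u)) ^+ 2 <=
  Ex P (fun u => w u ^+ 2) * Ex PX (fun X => condE SX G X ^+ 2).
Proof.
move=> mQ sQ bw dw bG.
have bGQ : bdm (fun u => G (Q u)) by apply: bdm_comp bG; case: mQ.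
have bc : bdm (condE SX G) by exact: bdm_condE.
have bcQ : bdm (fun u => condE SX G (Q u)) by apply: bdm_comp bc; case: mQ.
rewrite -(Ex_condE dw bw bGQ).
rewrite (eq_Ex _ (Y := fun u => w u * condE SX G (Q u))); last first.
  by move=> u; congr (_ * _); exact: (condE_morph _ mQ bG sQ).
have bc2 : bdm (fun X => condE SX G X ^+ 2) by auto.
by rewrite -(Ex_mpres mQ bc2); exact: Ex_CS.
Qed.

(** An atom over [Z] that omits a vertex of [V] has its free part properly inside [V0], hence fewer
    than [d] free vertices, and [ag] applies. *)
Let low_agree q : low Z V q -> {ae P, forall u, q (bits N (sample u)) = q (bits N' (Y u))}.
Proof.
move=> [_ _ [D dq]].
have : {ae P, forall u, forall b, inD Z D b && has (fun i => i \notin supp b) V ->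
    bits N (sample u) b = bits N' (Y u) b}.
  apply: ae_countable => b.
  have [/andP[/allP bD /hasP[w wV wb]]|nb] := boolP (inD Z D b && has (fun i => i \notin supp b) V);
    last exact: aeW.
  have [|lb] := leqP d #|` atom_free b|; last by have := ag lb; apply: filterS.
  move=> db; exfalso; move/negP: wb; apply.
  have sub : (atom_free b `<=` V0)%fset.
    by apply/fsubsetP => x; rewrite in_atom_free in_iset => /bD /andP[_].
  have /eqP E : atom_free b == V0 by rewrite eqEfcard sub card_iset.
  move: wV => /imfsetP[/= x xV ->]; by rewrite -in_atom_free E.
by apply: filterS => u hu; apply: dq => b; exact: hu.
Qed.

(** Both sides are compared with the same low function [q]: by [low_agree] its values agree almost
    surely, and by [key] and [weak_bound] the residuals contribute little on either side. *)
Let law_eq1 w xi : bdm w -> dep Su w -> bdm xi -> (forall e, `|xi e| <= 1) ->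
  (exists D, dep (inD Z D) xi) ->
  Ex P (fun u => w u * xi (bits N (sample u))) = Ex P (fun u => w u * xi (bits N' (Y u))).
Proof.
move=> bw dw bxi xi1 dxi; apply/eqP; rewrite -subr_eq0 -sqrf_eq0 eq_le sqr_ge0 andbT.
apply/ler_addgt0Pl => x x0; rewrite addr0.
set W2 := Ex P (fun u => w u ^+ 2).
have W0 : 0 <= W2 by exact: Ex_sqr_ge0.
have e0 : 0 < x / (4 * (W2 + 1)) by rewrite divr_gt0// mulr_gt0// ltr_wpDl.
have [t t0 ht] := key mN fresh VZ bxi xi1 dxi e0.
have [t' t'0 ht'] := key mN' fresh VZ bxi xi1 dxi e0.
have tt0 : 0 < Num.min t t' by rewrite lt_min t0.
(* Orthogonality is obtained for the law of the atoms of [N]; [same_law] turns it into orthogonality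
   for [N']. *)
have [q lq oq] := exists_orth Z V (law PX (measurable_bits (W := vertex) mN)) bxi xi1 tt0.
have [bq _ _] := lq.
have o1 : orth Z V (law PX (measurable_bits (W := vertex) mN)) xi t q.
  by move=> h lh; apply: (le_trans (oq h lh)); rewrite ge_min lexx.
have o2 : orth Z V (law PX (measurable_bits (W := vertex) mN')) xi t' q.
  move=> h lh; have [bh _ _] := lh.
  have bF : bdm (fun e => (xi e - q e) * h e) by auto.
  have := oq h lh.
  rewrite -(Ex_mpres (mpres_law PX (measurable_bits (W := vertex) mN)) bF) (same_law bF).
  rewrite (Ex_mpres (mpres_law PX (measurable_bits (W := vertex) mN')) bF) => oq'.
  by apply: (le_trans oq'); rewrite ge_min lexx orbT.
have bG (M : forall P : L, set (Omega R (r 'I_(arity P)))) (mM : forall P, measurable (M P)) :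
    bdm (fun X : Omega R {fset vertex} => xi (bits M X) - q (bits M X)).
  by apply: bdmB; exact: (bdm_bits mM).
have b1 := weak_bound (@mpres_sample R) sample_splice bw dw (bG N mN).
have b2 := weak_bound mpresY Y_splice bw dw (bG N' mN').
have bs F : bdm F -> bdm (fun u => F (bits N (sample u)) : R).
  move=> bF; apply: (bdm_comp (phi := @sample R) _ (bdm_bits mN bF)).
  by case: (@mpres_sample R).
have bY F : bdm F -> bdm (fun u => F (bits N' (Y u)) : R).
  by move=> bF; apply: (bdm_comp (phi := Y) _ (bdm_bits mN' bF)); case: mpresY.
have qq : Ex P (fun u => w u * q (bits N (sample u))) = Ex P (fun u => w u * q (bits N' (Y u))).
  apply: ae_Ex; [by apply: bdmM => //; exact: bs|by apply: bdmM => //; exact: bY|].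
  by apply: filterS (low_agree lq) => u ->.
set a := Ex P (fun u => w u * xi (bits N (sample u))).
set b := Ex P (fun u => w u * xi (bits N' (Y u))).
have aE : Ex P (fun u => w u * (xi (bits N (sample u)) - q (bits N (sample u)))) =
    a - Ex P (fun u => w u * q (bits N (sample u))).
  rewrite -ExB; [|by apply: bdmM => //; exact: bs|by apply: bdmM => //; exact: bs].
  by apply: eq_Ex => u; rewrite mulrBr.
have bE : Ex P (fun u => w u * (xi (bits N' (Y u)) - q (bits N' (Y u)))) =
    b - Ex P (fun u => w u * q (bits N (sample u))).
  rewrite qq -ExB; [|by apply: bdmM => //; exact: bY|by apply: bdmM => //; exact: bY].
  by apply: eq_Ex => u; rewrite mulrBr.
move: b1 b2; rewrite aE bE; move: (Ex P (fun u => w u * q (bits N (sample u)))) => c.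
move=> b1 b2.
have f1 : W2 * (x / (4 * (W2 + 1))) <= x / 4.
  apply: (@le_trans _ _ ((W2 + 1) * (x / (4 * (W2 + 1))))).
    by apply: ler_wpM2r; [exact: ltW|rewrite lerDl].
  by rewrite mulrCA invfM (mulrCA (W2 + 1)) mulfV ?mulr1// gt_eqF// ltr_wpDl.
have g1 : (a - c) ^+ 2 <= x / 4.
  by apply: (le_trans b1); apply: le_trans f1; apply: ler_wpM2l => //; exact: ht.
have g2 : (b - c) ^+ 2 <= x / 4.
  by apply: (le_trans b2); apply: le_trans f1; apply: ler_wpM2l => //; exact: ht'.
exact: (sqr_dist_le g1 g2).
Qed.

Let law_eq w xi : bdm w -> dep Su w -> bdm xi -> (exists D, dep (inD Z D) xi) ->
  Ex P (fun u => w u * xi (bits N (sample u))) = Ex P (fun u => w u * xi (bits N' (Y u))).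
Proof.
move=> bw dw bxi [D dxi]; have [_ [M hM]] := bxi.
have M0 : 0 < `|M| + 1 by rewrite ltr_wpDl.
pose c := (`|M| + 1)^-1.
have c0 : c != 0 by rewrite invr_eq0 gt_eqF.
apply: (mulfI c0).
have bxc : bdm (fun e => c * xi e) by auto.
have bs F : bdm F -> bdm (fun u => F (bits N (sample u)) : R).
  move=> bF; apply: (bdm_comp (phi := @sample R) _ (bdm_bits mN bF)).
  by case: (@mpres_sample R).
have bY F : bdm F -> bdm (fun u => F (bits N' (Y u)) : R).
  by move=> bF; apply: (bdm_comp (phi := Y) _ (bdm_bits mN' bF)); case: mpresY.
rewrite -ExZ; last by apply: bdmM => //; exact: bs.
rewrite -ExZ; last by apply: bdmM => //; exact: bY.
have h := law_eq1 bw dw bxc.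
transitivity (Ex P (fun u => w u * (c * xi (bits N (sample u))))).
  by apply: eq_Ex => u; rewrite mulrCA.
rewrite h; first by apply: eq_Ex => u; rewrite mulrCA.
  have c1 : 0 < c by rewrite invr_gt0.
  move=> e; rewrite normrM (gtr0_norm c1) /c mulrC ler_pdivrMr// mul1r.
  by apply: (le_trans (hM e)); apply: (le_trans (ler_norm M)); rewrite lerDl.
by exists D => e e' ee'; rewrite (dxi e e').
Qed.

Let T := Omega R (site + at_)%type.
Let B1 (u : Om) : Omega R at_ := bits N (sample u).
Let B2 (u : Om) : Omega R at_ := bits N' (Y u).

Let mB1 : measurable_fun setT B1.
Proof.
by have [m _] := @mpres_sample R; exact: measurableT_comp (measurable_bits mN) m.
Qed.

Let mB2 : measurable_fun setT B2.
Proof. by have [m _] := mpresY; exact: measurableT_comp (measurable_bits mN') m. Qed.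

(** What the new level has to be coupled with: the sites with free part properly inside [V0], which
    determine the lower levels there, and the atoms with free part [V0]. All other entries are set
    to 0. *)
Let observe (B : Om -> Omega R at_) (u : Om) : T := fun i =>
  match i with
  | inl a => if (a.1 `<` V0)%fset then u a else 0
  | inr b => if atom_free b == V0 then B u b else 0
  end.

Let measurable_observe B : measurable_fun setT B -> measurable_fun setT (observe B).
Proof.
move=> mB; apply: measurable_Omega => -[a|b] /=.
  by case: (_ `<` _)%fset => //; exact: measurable_coord.
case: (_ == _) => //.
exact: measurableT_comp (measurable_coord b) mB.
Qed.

(** A finite product over observed entries splits into a function of lower sites and a function of
    atoms, which is the case treated by [law_eq]. *)
Let observe_law Phi : bdm Phi ->
  Ex P (fun u => Phi (observe B1 u)) = Ex P (fun u => Phi (observe B2 u)).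
Proof.
move=> bPhi.
have E B (mB : measurable_fun setT B) F : bdm F ->
    Ex P (fun u => F (observe B u)) = Ex (law P (measurable_observe mB)) F.
  by move=> bF; rewrite -(Ex_mpres (mpres_law P (measurable_observe mB)) bF).
rewrite (E _ mB1)// (E _ mB2)//; apply: Ex_Omega_unique bPhi => s h us bh.
have bp := bdm_prod_coord s bh.
rewrite -(E _ mB1)// -(E _ mB2)//.
pose w (u : Om) : R := \prod_(i <- s)
  (if i is inl a then h i (if (a.1 `<` V0)%fset then u a else 0) else 1).
pose xi (e : Omega R at_) : R := \prod_(i <- s)
  (if i is inr b then h i (if atom_free b == V0 then e b else 0) else 1).
have split B u : \prod_(i <- s) h i (observe B u i) = w u * xi (B u).
  rewrite /w /xi -big_split /=; apply: eq_bigr => -[a|b] _ /=; first by rewrite mulr1.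
  by rewrite mul1r.
have bw : bdm w.
  apply: bdm_prod => -[a|b] //=; case: (_ `<` _)%fset; last exact: bdm_cst.
  exact: (bdm_comp (@measurable_coord R site a) (bh (inl a))).
have bxi : bdm xi.
  apply: bdm_prod => -[a|b] //=; case: (_ == _); last exact: bdm_cst.
  exact: (bdm_comp (@measurable_coord R at_ b) (bh (inr b))).
have dw : dep Su w.
  move=> u u' uu'; apply: eq_bigr => -[a|b] _ //; case: ifPn => // aV.
  congr (h _ _); apply: uu'; rewrite /Su.
  by apply: contraTN aV => Va; rewrite fproperEneq negb_and eqEfsubset Va andbT negbK orbN.
rewrite (eq_Ex _ (Y := fun u => w u * xi (B1 u))); last by move=> u; exact: split.
rewrite [RHS](eq_Ex _ (Y := fun u => w u * xi (B2 u))); last by move=> u; exact: split.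
apply: law_eq => //.
exists [fset x | x in flatten [seq (if i is inr b then supp b else [::]) | i <- s]]%fset.
move=> e e' ee'; apply: eq_big_seq => -[a|b] bs //; case: eqP => // bV.
congr (h _ _); apply: ee'; apply/allP => x xb; apply/andP; split.
  by apply/imfsetP; exists x => //=; apply/flattenP; exists (supp b) => //; apply/mapP; exists (inr b).
by case: x xb => // x; rewrite -in_atom_free bV in_iset.
Qed.

Let iact (p : {perm 'I_d}) (i : site + at_) : site + at_ :=
  match i with
  | inl a => inl (mapsite (ext p) a)
  | inr b => inr (map_atom (mapfree (ext p)) b)
  end.

Let act p (t : T) : T := fun i => t (iact p i).

Let act_measurable p : measurable_fun setT (act p).
Proof. exact: measurable_relabel. Qed.

Let act1 t : act 1%g t = t.
Proof.
apply/funext => -[[A k]|b]; rewrite /act /= /mapsite /=; congr t.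
  congr inl; congr pair; rewrite -[RHS]imfset_id; apply: eq_in_imfset => x _.
  exact: ext1.
by congr inr; apply: map_atom_id => -[x|x] _ //=; rewrite ext1.
Qed.

Let actM p q t : act q (act p t) = act (q * p)%g t.
Proof.
apply/funext => -[[A k]|b]; rewrite /act /= /mapsite /=; congr t.
  by congr inl; congr pair; rewrite imfset_comp_fset; apply: eq_in_imfset => x _; exact: ext_comp.
by congr inr; rewrite map_atom_comp; apply: eq_map_atom => -[x|x] _ //=; rewrite ext_comp.
Qed.

Let observe_act B p u :
  (forall b, B (relabel (ext p) u) b = B u (map_atom (mapfree (ext p)) b)) ->
  act p (observe B u) = observe B (relabel (ext p) u).
Proof.
have injp := @ext_inj d p.
have eqV (A : {fset nat}) : ((ext p @` A)%fset == V0) = (A == V0).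
  rewrite -{1}(ext_iset p); apply/eqP/eqP => [|->//].
  exact: imfset_injective.
move=> hB; apply/funext => -[[A k]|b]; rewrite /act /observe /iact /mapsite /=.
  rewrite !fproperEneq eqV -{2}(ext_iset p) imfset_fsubset_inj//.
by rewrite atom_free_map eqV; case: ifP => // _; rewrite hB.
Qed.

Let observe1_act p u : act p (observe B1 u) = observe B1 (relabel (ext p) u).
Proof.
by apply: observe_act => b; apply: bits_sample_relabel; exact: ext_inj.
Qed.

Let observe2_act p u : act p (observe B2 u) = observe B2 (relabel (ext p) u).
Proof.
by apply: observe_act => b; apply: bits_decode_relabel => //; exact: ext_inj.
Qed.

Let m2 : measurable_fun setT (fun u => (observe B2 u, spare d u)).
Proof.
by apply/measurable_fun_pair; [exact: measurable_observe|exact: measurable_coord].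
Qed.

(** The joint law to be reproduced: on the side of [N'] the merged coordinate of [V0] is still the
    spare one. *)
Let mu : probability (T * R)%type R := law P m2.

Let Ex_mu X : bdm X -> Ex mu X = Ex P (fun u => X (observe B2 u, spare d u)).
Proof. by move=> bX; rewrite -(Ex_mpres (mpres_law P m2) bX). Qed.

Let mu_act p X : bdm X -> Ex mu (fun q => X (act p q.1, q.2)) = Ex mu X.
Proof.
move=> bX.
have bX' : bdm (fun q : T * R => X (act p q.1, q.2)).
  apply: (bdm_comp (phi := fun q : T * R => (act p q.1, q.2)) _ bX).
  apply/measurable_fun_pair; [|exact: measurable_snd].
  exact: measurableT_comp (act_measurable p) measurable_fst.
rewrite !Ex_mu//.
have bXu : bdm (fun u => X (observe B2 u, spare d u)) by apply: bdm_comp bX.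
rewrite -(Ex_mpres (mpres_relabel_site R (@ext_inj d p)) bXu); apply: eq_Ex => u.
by rewrite observe2_act /spare /relabel /mapsite /= ext_iset.
Qed.

Let Ex_spare h : bdm h -> Ex P (fun u => h (spare d u)) = Ex U h.
Proof. by move=> bh; exact: (Ex_mpres (mpres_coord R ((iset d, None) : site)) bh). Qed.

Let mu_snd h : bdm h -> Ex mu (fun q => h q.2) = Ex U h.
Proof.
move=> bh; rewrite Ex_mu ?Ex_spare//.
by apply: (bdm_comp (phi := snd) _ bh); exact: measurable_snd.
Qed.

Let observe1_dep : dep (fun a : site => (a.1 `<=` V0)%fset && (a != (V0, None))) (observe B1).
Proof.
move=> u u' uu'; apply/funext => -[a|b] /=; case: ifPn => //.
  rewrite fproperEneq => /andP[aV aV']; apply: uu'; rewrite aV' /=.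
  by apply: contraNneq aV => ->.
move=> /eqP bV; apply: (@dep_bits R L vertex N b) => C /allP Cb; apply: uu' => /=.
apply/andP; split; last by rewrite xpair_eqE andbF.
apply/fsubsetP => x; rewrite in_freepart -bV in_atom_free; exact: Cb.
Qed.

(** Transfer yields [gn] whose joint law with the observations for [N] is that of the spare
    coordinate with the observations for [N']. There an atom with free part [V0] is a fixed function
    of lower sites and top coordinate; the same relation therefore holds almost surely for [gn]. *)
Theorem next_level : exists gn, level d gn /\
  agree (fun e => if e == d then gn else g e) d.+1.
Proof.
have [f [mf fact fmu]] := transfer act_measurable act1 actM mu_act mu_snd.
pose gn u := f (observe B1 u, spare d u).
have m1 : measurable_fun setT (fun u => (observe B1 u, spare d u)).
  by apply/measurable_fun_pair; [exact: measurable_observe|exact: measurable_coord].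
have mgn : measurable_fun setT gn by exact: measurableT_comp mf m1.
have joint X : bdm X -> Ex P (fun u => X (observe B1 u, gn u)) =
    Ex P (fun u => X (observe B2 u, spare d u)).
  move=> bX; rewrite -Ex_mu// -(Ex_mpres fmu bX).
  (* The spare coordinate is independent of [observe B1], whose law is that of [observe B2] by
     [observe_law]. *)
  have mp : mpres P (law mu measurable_fst \x U)%E (fun u => (observe B1 u, spare d u)).
    apply: Ex_product_mpres => // A B mA mB.
    have bA : bdm (fun u => \1_A (observe B1 u) : R).
      by apply: (bdm_comp (phi := observe B1) _ (bdm_indic R mA)); exact: measurable_observe.
    have bB : bdm (fun u => \1_B (spare d u) : R).
      by apply: (bdm_comp (phi := @spare R d) _ (bdm_indic R mB)); exact: measurable_coord.
    rewrite (Ex_indep (S := fun a => a != (V0, None)) (D := pred1 (V0, None)) (F := fun u => \1_A (observe B1 u)) (G := fun u => \1_B (spare d u)))//.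
    - rewrite (Ex_spare (bdm_indic R mB)) (observe_law (bdm_indic R mA)).
      have b1 : bdm (fun q : T * R => \1_A q.1 : R).
        by apply: (bdm_comp (phi := fst) _ (bdm_indic R mA)); exact: measurable_fst.
      have b2 : bdm (fun q : T * R => \1_A q.1 * \1_B q.2 : R).
        apply: bdmM => //.
        by apply: (bdm_comp (phi := snd) _ (bdm_indic R mB)); exact: measurable_snd.
      rewrite Ex_Fubini//= -(Ex_mu b1) mulrC -(ExZ _ _ b1).
      rewrite -(Ex_mpres (mpres_law mu measurable_fst) (X := fun t => Ex U (fun y => \1_A t * \1_B y))).
        by apply: eq_Ex => q; rewrite ExZ 1?mulrC//; exact: bdm_indic.
      exact: (bdm_Ex (law mu measurable_fst) U b2).
    - move=> u u' uu'; congr (\1_A _); apply: observe1_dep => a /andP[_]; exact: uu'.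
    - by move=> u u' uu'; congr (\1_B _); apply: uu'; exact: eqxx.
    - by move=> a /= /eqP ->; rewrite eqxx.
  have bXf : bdm (fun q : T * R => X (q.1, f q)).
    apply: (bdm_comp (phi := fun q : T * R => (q.1, f q)) _ bX).
    by apply/measurable_fun_pair; [exact: measurable_fst|].
  by rewrite -(Ex_mpres mp bXf).
have dgn : dep (fun a : site => a.1 `<=` V0)%fset gn.
  move=> u u' uu'; rewrite /gn; congr (f (_, _)).
    by apply: observe1_dep => a /andP[aV _]; exact: uu'.
  by apply: uu'; rewrite /= fsubset_refl.
pose lower (t : T) : Om := fun a => t (inl a).
have lowerE B u a : (a.1 `<` V0)%fset -> lower (observe B u) a = u a.
  by rewrite /lower /= => ->.
have mlower : measurable_fun setT lower by exact: measurable_relabel.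
have lgn : level d gn.
  split => //.
  - move=> s s' u injs injs' ss'.
    have [p hp] := same_image_ext injs injs' ss'.
    have -> : gn (relabel s' u) = gn (relabel (ext p) (relabel s u)).
      apply: dgn => -[A k] AV; have {}AV : (A `<=` V0)%fset := AV.
      rewrite relabel_comp /relabel /mapsite /=; congr u; congr pair.
      by apply: eq_in_imfset => x xA; apply: hp; exact: (fsubsetP AV).
    rewrite /gn -observe1_act fact; congr (f (_, _)).
    by rewrite /spare {2}/relabel /mapsite /= ext_iset.
  - move=> F h bF bh dF.
    (* Averaging out the sites not inside [V0] leaves a function of the sites properly inside it,
       which are recorded by [observe]. *)
    pose F' := condE (fun a : site => a.1 `<=` V0)%fset F.
    have bF' : bdm F' by exact: bdm_condE.
    have dF' : dep (fun a : site => a.1 `<` V0)%fset F'.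
      by apply: depW (dep_condE dF) => a /andP[aV aV']; rewrite fproperEneq; apply/andP; split.
    have bh' : bdm (fun u => h (gn u)) by apply: bdm_comp bh.
    have dh' : dep (fun a : site => a.1 `<=` V0)%fset (fun u => h (gn u)).
      by move=> u u' uu'; rewrite (dgn u u').
    transitivity (Ex P (fun u => F' (lower (observe B1 u)) * h (gn u))).
      transitivity (Ex P (fun u => h (gn u) * F' u)).
        rewrite (Ex_condE dh')//; apply: eq_Ex => u; exact: mulrC.
      apply: eq_Ex => u; rewrite mulrC; congr (_ * _); apply: dF' => a aV.
      by rewrite lowerE.
    have bX : bdm (fun q : T * R => F' (lower q.1) * h q.2).
      apply: bdmM; last by apply: (bdm_comp (phi := snd) _ bh); exact: measurable_snd.
      apply: (bdm_comp (phi := fun q : T * R => lower q.1) _ bF').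
      exact: measurableT_comp mlower measurable_fst.
    rewrite (joint _ bX) /= (eq_Ex _ (Y := fun u => F' u * h (spare d u))); last first.
      by move=> u; congr (_ * _); apply: dF' => a aV; rewrite lowerE.
    rewrite (level_ind (level_spare R d) bF' bh); last first.
      apply: depW dF' => a; apply: contraTneq => ->.
      by rewrite fproperEneq eqxx.
    by rewrite -(Ex_splice _ bF).
exists gn; split => //.
pose g' e := if e == d then gn else g e.
have hg' e : level e (g' e) by rewrite /g'; case: eqP => // ->.
have g'_low u A : (#|` A| < d)%N -> assemble g' u A = assemble g u A.
  by move=> Ad; rewrite /assemble /g' ltn_eqF.
have top b : atom_free b = V0 ->
    {ae P, forall u, bits N (sample u) b = bits N' (decode_sets (assemble g' u)) b}.
  move=> bV.
  (* The merged coordinates recomputed from an observation, with the second component in the place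
     of the coordinate of [V0]. *)
  pose vv (q : T * R) : Omega R {fset nat} :=
    fun A => if A == V0 then q.2 else assemble g (lower q.1) A.
  pose Psi q := bits N' (decode_sets (vv q)) b.
  have mvv : measurable_fun setT vv.
    apply: measurable_Omega => A; rewrite /vv; case: (A == V0) => /=; first exact: measurable_snd.
    have m3 : measurable_fun setT (fun u => assemble g u A).
      exact: measurableT_comp (measurable_coord A) (measurable_assemble hg).
    have m4 : measurable_fun setT (fun q : T * R => lower q.1).
      exact: measurableT_comp mlower measurable_fst.
    exact: (measurableT_comp m3 m4).
  have mPsi : measurable_fun setT Psi.
    have m3 : measurable_fun setT (fun X => bits N' X b).
      exact: measurableT_comp (measurable_coord b) (measurable_bits mN').
    have [m4 _] := @mpres_decode_sets R.
    exact: (measurableT_comp m3 (measurableT_comp m4 mvv)).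
  have bb M v : `|bits M v b : R| <= 1.
    by rewrite /bits; case: (_ && _); rewrite ?normr1 ?normr0.
  have bPsi : bdm Psi by split => //; exists 1 => q; exact: bb.
  (* An entry of an arbitrary point of [T] is unbounded; clamping repairs this and does not affect
     truth values. *)
  pose c01 (y : R) : R := Num.max 0 (Num.min 1 y).
  have bt : bdm (fun q : T * R => c01 (q.1 (inr b))).
    split; last first.
      by exists 1 => q; rewrite ger0_norm /c01 ?le_max ?lexx// ge_max ler01 ge_min lexx.
    apply: measurable_maxr => //; apply: measurable_minr => //.
    exact: measurableT_comp (measurable_coord _) measurable_fst.
  have clampE B u : observe B u (inr b) = B u b by rewrite /= bV eqxx.
  have clamp01 M v : c01 (bits M v b) = bits M v b.
    by rewrite /c01 /bits; case: (_ && _); rewrite ?minxx ?(min_r (@ler01 R)) ?maxxx ?(max_r (@ler01 R)).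
  pose X (q : T * R) : R := (c01 (q.1 (inr b)) - Psi q) ^+ 2.
  have bX : bdm X by rewrite /X; auto.
  have low_eq B u A : (A `<=` atom_free b)%fset -> A != V0 ->
      assemble g (lower (observe B u)) A = assemble g u A.
    rewrite bV => AV AV'; apply: (dep_assemble hg) => a aA; apply: lowerE.
    by apply: fsub_proper_trans aA _; rewrite fproperEneq AV'.
  (* For [N'] the two expressions coincide at every point; equality of the joint laws carries the
     vanishing second moment over to [N]. *)
  have E0 : Ex P (fun u => X (observe B1 u, gn u)) = 0.
    rewrite joint// -[RHS](Ex_cst P); apply: eq_Ex => u.
    transitivity ((c01 (observe B2 u (inr b)) - Psi (observe B2 u, spare d u)) ^+ 2) => //.
    rewrite clampE /B2 clamp01 /Psi (decode_eq (v' := assemble g u)) ?subrr ?expr0n//.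
    move=> A Ab; rewrite /vv; case: eqP => [->|/eqP AV] /=; last exact: low_eq.
    by rewrite assemble_spare.
  have b3 : bdm (fun u => c01 (observe B1 u (inr b)) - Psi (observe B1 u, gn u)).
    apply: (bdm_comp (phi := fun u => (observe B1 u, gn u)) _ (bdmB bt bPsi)).
    by apply/measurable_fun_pair => //; exact: measurable_observe.
  apply: filterS (Ex_sqr_eq0_ae b3 E0) => u /eqP; rewrite subr_eq0 => /eqP.
  rewrite clampE /B1 clamp01 => ->; apply: decode_eq => A Ab.
  rewrite /vv; case: eqP => [->|/eqP AV] /=.
    rewrite /assemble card_iset /g' eqxx.
    have {1}-> : u = relabel id u.
      by apply/funext => -[B k]; rewrite /relabel /mapsite /= imfset_id.
    apply: (level_sym lgn) => //; first by move=> x y _ _ /sigma_inj.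
    by rewrite [LHS]imfset_id; have := sigma_iset V0; rewrite card_iset.
  rewrite low_eq// g'_low//; rewrite bV in Ab.
  by rewrite -[d]card_iset fproper_ltn_card// fproperEneq AV.
move=> b; rewrite ltnS leq_eqVlt => /predU1P[bd|bd]; last first.
  apply: filterS (ag bd) => u ->; apply: decode_eq => A Ab.
  by rewrite g'_low//; apply: leq_ltn_trans bd; exact: fsubset_leq_card.
(* An atom with [d] free vertices is the image under [sigma A] of one with free part [V0], and both
   sides commute with relabeling. *)
pose A := atom_free b; pose s := sigma A.
pose si (w : vertex) : vertex := if w is inl x then inl (index x (enum_fset A)) else w.
pose b0 := map_atom si b.
have bE : map_atom (mapfree s) b0 = b.
  rewrite /b0 map_atom_comp; apply: map_atom_id => -[x|//] xb /=.
  have xA : x \in A by rewrite in_atom_free.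
  by rewrite /s /sigma index_mem xA nth_index.
have b0V : atom_free b0 = V0.
  apply: (imfset_injective (@sigma_inj A)); rewrite -atom_free_map bE.
  by rewrite -bd sigma_iset.
have := ae_mpres (mpres_relabel_site R (@sigma_inj A)) (top b0 b0V).
apply: filterS => u.
rewrite bits_sample_relabel; last exact: sigma_inj.
by rewrite (bits_decode_relabel _ _ _ hg'); [rewrite bE|exact: sigma_inj].
Qed.

End one_step.

(** The induction starts with all levels spare, where agreement below 0 free vertices is vacuous. *)
Theorem agreeing_levels K : exists g, (forall e, level e (g e)) /\ agree g K.
Proof.
suff [g [hg _ ag]] : exists g, [/\ forall e, level e (g e),
    forall e, (K <= e)%N -> g e = @spare R e & agree g K] by exists g.
elim: K => [|K [g [hg gK ag]]].
  by exists (@spare R); split => // e; exact: level_spare.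
have [gn [lgn ag']] := next_level hg gK ag.
exists (fun e => if e == K then gn else g e); split => // e.
  by case: eqP => [->|].
by move=> Ke; rewrite gtn_eqF// gK// ltnW.
Qed.

End step.

(** * Lebesgue measure on finite cubes *)

Section image_ext_facts.
Context d (T : measurableType d) (R : realType) (mu : probability T R).
Context (X : Type) (j : X -> T).

(** Intersect measurable covers whose measures exceed the outer measure by at most 1/(n+1). *)
Lemma image_ext_hull (S : set X) : exists A, [/\ measurable A, S `<=` j @^-1` A &
  mu A = image_ext mu j S].
Proof.
set l := image_ext mu j S.
have l0 : (0 <= l)%E by exact: outer_measure_ge0.
have l1 : (l <= 1)%E.
  apply: (@le_trans _ _ ((mu^*)%mu setT)); first exact: le_outer_measure.
  by rewrite measurable_mu_extE//; have := probability_setT mu; rewrite /= => ->.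
have lfin : l \is a fin_num by rewrite ge0_fin_numE// (le_lt_trans l1)// ltry.
have ex (n : nat) : exists B, [/\ measurable B, j @` S `<=` B & (mu B <= l + n.+1%:R^-1%:E)%E].
  have n0 : 0 < n.+1%:R^-1 :> R by rewrite invr_gt0 ltr0n.
  have [x [F [mF SF] <-] xl] := @lb_ereal_inf_adherent _ _ n.+1%:R^-1 n0 lfin.
  exists (\bigcup_k F k); split => //; first exact: bigcup_measurable.
  apply: (le_trans _ (ltW xl)).
  by apply: measure_sigma_subadditive => //; exact: bigcup_measurable.
have [B hB] := choice ex.
exists (\bigcap_n B n); split.
- by apply: bigcap_measurable => // n _; case: (hB n).
- by move=> x Sx n _; have [_ SB _] := hB n; apply: SB; exists x.
- have mI : measurable (\bigcap_n B n) by apply: bigcap_measurable => // n _; case: (hB n).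
  apply/eqP; rewrite eq_le; apply/andP; split.
    apply/lee_addgt0Pr => e e0.
    have [mB _ le] := hB (Num.truncn e^-1).
    apply: (@le_trans _ _ (mu (B (Num.truncn e^-1)))).
      by apply: le_measure; rewrite ?inE//; exact: bigcap_inf.
    apply: (le_trans le); rewrite leeD2l// lee_fin invf_ple ?posrE//.
    exact/ltW/truncnS_gt.
  rewrite -measurable_mu_extE//; apply: le_outer_measure => _ [x Sx <-] n _.
  by have [_ SB _] := hB n; apply: SB; exists x.
Qed.

End image_ext_facts.

Lemma image_ext_cara d (T : measurableType d) (R : realType) (mu : {measure set T -> \bar R})
    (X : Type) (j : X -> T) (B : set T) : measurable B ->
  caratheodory_measurable (image_ext mu j) (j @^-1` B).
Proof.
move=> mB; apply: le_caratheodory_measurable => S.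
have := caratheodory_measurable_mu_ext mu mB (j @` S) => e.
rewrite /image_ext [leRHS]e; apply: leeD; apply: le_outer_measure.
  by move=> _ [x [Sx Bx] <-]; split => //; exists x.
by move=> _ [x [Sx Bx] <-]; split => //; exists x.
Qed.

Section cube_borel.
Context (R : realType) (I : finType).
Local Notation P := (iid R I).
Local Notation lam := (lebesgue_cube R I).

Definition cnum (x : cube R I) : Omega R I := fun i => (x i)%:num.

Let untup (t : #|I|.-tuple R) : Omega R I := fun i => tnth t (enum_rank i).
Let tup (w : Omega R I) : #|I|.-tuple R := [tuple w (enum_val j) | j < #|I|].

Let tupK t : tup (untup t) = t.
Proof. by apply: eq_from_tnth => k; rewrite tnth_mktuple /untup enum_valK. Qed.

Let cnumE x : cnum x = untup (cube_coords x).
Proof. by apply/funext => i; rewrite /untup tnth_mktuple enum_rankK. Qed.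

Let tup_cnum x : tup (cnum x) = cube_coords x.
Proof. by rewrite cnumE tupK. Qed.

Let muntup : measurable_fun setT (untup : #|I|.-tuple (measurableTypeR R) -> Omega R I).
Proof. by apply: measurable_Omega => i; exact: measurable_tnth. Qed.

Let mtup : measurable_fun setT (tup : Omega R I -> #|I|.-tuple (measurableTypeR R)).
Proof.
apply/measurable_fun_tnthP => k.
rewrite (_ : _ \o _ = fun w : Omega R I => w (enum_val k)); first exact: measurable_coord.
by apply/funext => w; rewrite /= tnth_mktuple.
Qed.

Let unifE (B : set R) : measurable B -> unif R B = uniform_prob (@ltr01 R) B.
Proof. by rewrite unif.unlock. Qed.

Let untup_law A : measurable A -> unif_tuple R #|I| (untup @^-1` A) = P A.
Proof.
move=> mA; pose Q : probability (Omega R I) R := law (unif_tuple R #|I|) muntup.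
suff h : forall B, bdm B -> Ex Q B = Ex P B.
  transitivity (Q A) => //; rewrite -!Ex_indic//; congr (_%:E); apply: h; exact: bdm_indic.
apply: (eq_probability_Ex (@boxesE R I) (@boxesI R I)) => _ [s [B [mB ->]]].
pose B' i := if i \in s then B i else setT.
have mB' i : measurable (B' i) by rewrite /B'; case: ifP.
have E : [set w : Omega R I | forall i, i \in s -> B i (w i)] = [set w | forall i, i \in enum I -> B' i (w i)].
  apply/seteqP; split => w /= h i; rewrite /B'; first by move=> _; case: ifP => // /h.
  by move=> si; have := h i; rewrite /B' si; apply; rewrite mem_enum.
have mbox : measurable [set w : Omega R I | forall i, i \in enum I -> B' i (w i)].
  by apply: sub_sigma_algebra; exists (enum I), B'.
rewrite E -[RHS]Ex_indic//.
rewrite (eq_Ex _ (Y := fun w : Omega R I => \prod_(i <- enum I) \1_(B' i) (w i))); last first.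
  by move=> w; rewrite indic_box undup_id ?enum_uniq.
rewrite (Ex_iid_prod (enum_uniq I) (fun i => bdm_indic R (mB' i))).
transitivity (unif_tuple R #|I| [set t | forall k, B' (enum_val k) (tnth t k)]).
  congr (unif_tuple R #|I| _); apply/seteqP; split => t /= h.
    by move=> k; have := h (enum_val k); rewrite /untup enum_valK; apply; rewrite mem_enum.
  by move=> i _; have := h (enum_rank i); rewrite enum_rankK.
rewrite (unif_tuple_box (B := fun k => B' (enum_val k))).
  rewrite (eq_bigr (fun k : 'I_#|I| => (Ex (unif R) \1_(B' (enum_val k)))%:E)); last first.
    by move=> k _; rewrite Ex_indic// unifE.
  rewrite prodEFin; congr (_%:E); rewrite big_enum /=.
  by rewrite [RHS](reindex _ (onW_bij _ (enum_val_bij I))).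
by move=> k; exact: mB'.
Qed.

Lemma cube_iid A : measurable A -> lam (cnum @^-1` A) = P A.
Proof.
move=> mA.
pose C := untup @^-1` A : set (#|I|.-tuple (measurableTypeR R)).
pose B : set R := `[0, 1]%classic.
(* The range of [cube_coords]. It has full measure, so intersecting with it changes nothing. *)
pose Rg := [set t : #|I|.-tuple (measurableTypeR R) | forall k, B (tnth t k)].
have mC : measurable C by rewrite -[X in measurable X]setTI; exact: muntup.
have mB : measurable B by exact: measurable_itv.
have mRg : measurable Rg by exact: (measurable_box (B := fun=> B)).
have Rg1 : unif_tuple R #|I| Rg = 1%E.
  rewrite (unif_tuple_box (B := fun=> B))// big1// => k _.
  by rewrite /uniform_prob integral_uniform_pdf1.
have -> : lam (cnum @^-1` A) = ((unif_tuple R #|I|)^*)%mu (C `&` Rg).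
  congr (mu_ext _ _); apply/seteqP; split => [_ [x /= Ax <-]|t [/= Ct Rt]].
    split; first by rewrite /C /= -cnumE.
    by move=> k; rewrite tnth_mktuple /B /= in_itv /=; apply/andP.
  have h i : 0 <= tnth t (enum_rank i) <= 1 by have := Rt (enum_rank i); rewrite /B /= in_itv.
  pose x (i : I) : {i01 R} := Itv01 (proj1 (andP (h i))) (proj2 (andP (h i))).
  have xt : cube_coords x = t.
    by apply: eq_from_tnth => k; rewrite tnth_mktuple /= enum_valK.
  by exists x => //=; rewrite cnumE xt.
rewrite measurable_mu_extE; last exact: measurableI.
rewrite -(untup_law mA) -/C.
rewrite [RHS](@measureDI _ _ _ (unif_tuple R #|I|) C Rg mC mRg).
rewrite [X in _ = (X + _)%E](_ : _ = 0%E) ?add0e//.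
apply/eqP; rewrite eq_le measure_ge0 andbT.
apply: (@le_trans _ _ (unif_tuple R #|I| (~` Rg))).
  apply: le_measure; rewrite ?inE; [exact: measurableD|exact: measurableC|].
  by move=> t [].
have := probability_setC (unif_tuple R #|I|) mRg; rewrite /= => ->.
by have := Rg1; rewrite /= => ->; rewrite subee.
Qed.

Lemma cube_hull (S : set (cube R I)) :
  exists A, [/\ measurable A, S `<=` cnum @^-1` A & P A = lam S].
Proof.
have [A' [mA' SA' lA']] := image_ext_hull (unif_tuple R #|I|) (@cube_coords R I) S.
have mA : measurable (tup @^-1` A').
  by rewrite -[X in measurable X]setTI; exact: mtup.
exists (tup @^-1` A'); split; first exact: mA.
  by move=> x Sx; rewrite /= tup_cnum; exact: SA'.
rewrite -(untup_law mA); apply: etrans lA'; congr (unif_tuple R #|I| _).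
by apply/seteqP; split => t /=; rewrite tupK.
Qed.

Lemma cube_measurable_preimage A : measurable A -> cube_measurable (cnum @^-1` A).
Proof.
move=> mA; rewrite (_ : cnum @^-1` A = @cube_coords R I @^-1` (untup @^-1` A)).
  by apply: image_ext_cara; rewrite -[X in measurable X]setTI; exact: muntup.
by apply/seteqP; split => x /=; rewrite cnumE.
Qed.

Lemma ae_cubeP (Q : cube R I -> Prop) :
  ae_cube Q <-> exists Z, [/\ measurable Z, P Z = 0%E & forall x, ~ Z (cnum x) -> Q x].
Proof.
split=> [[B [mB B0 QB]]|[Z [mZ Z0 QZ]]].
  have [Z [mZ BZ ZE]] := cube_hull B; exists Z; split => //; first by rewrite ZE.
  move=> x nZ; apply: contrapT => nQ; apply: nZ; apply: BZ; exact: QB.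
exists (cnum @^-1` Z); split.
- exact: cube_measurable_preimage.
- by have := cube_iid mZ; rewrite Z0.
- by move=> x nQ; apply: contrapT => nZ; apply: nQ; exact: QZ.
Qed.

Lemma ae_iid_cube (Q : Omega R I -> Prop) :
  {ae P, forall w, Q w} -> ae_cube (fun x => Q (cnum x)).
Proof.
move=> [Z [mZ Z0 QZ]]; apply/ae_cubeP; exists Z; split => // x nZ.
by apply: contrapT => nQ; apply: nZ; exact: QZ.
Qed.

(** The hulls of [S] and of its complement cover the cube, and by the Caratheodory condition their
    measures add up to that of the cube. Hence they overlap, and differ from the two sets, in a null
    set. *)
Lemma cube_measurable_borel (S : set (cube R I)) : cube_measurable S -> exists A, measurable A /\
  ae_cube (fun x => S x <-> A (cnum x)).
Proof.
move=> mS; have [A [mA SA AE]] := cube_hull S; have [A' [mA' SA' AE']] := cube_hull (~` S).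
exists A; split => //; apply/ae_cubeP; exists (A `&` A'); split.
- exact: measurableI.
- have := mS setT; rewrite !setTI -AE -AE' => e.
  have e1 : lam setT = P (A `|` A').
    rewrite -(cube_iid (measurableU _ _ mA mA')); congr (lam _).
    apply/seteqP; split => // x _; have [/SA|/SA'] := pselect (S x); [by left|by right].
  rewrite e1 -!Ex_indic// in e; [|exact: measurableU].
  rewrite -Ex_indic; last exact: measurableI.
  congr (_%:E).
  have e' : Ex P \1_(A `|` A') = Ex P \1_A + Ex P \1_A' by apply: EFin_inj; rewrite EFinD.
  have : Ex P \1_A + Ex P \1_A' = Ex P \1_(A `|` A') + Ex P \1_(A `&` A').
    rewrite -!ExD; try exact: bdm_indic.
    - apply: eq_Ex => w; rewrite !indicE in_setU in_setI.
      by case: (w \in A); case: (w \in A') => /=; lra.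
    - by apply: bdm_indic; exact: measurableU.
    - by apply: bdm_indic; exact: measurableI.
  by rewrite e'; lra.
- move=> x nZ; split => [/SA//|Ax]; apply: contrapT => nS; apply: nZ; split => //.
  exact: SA'.
Qed.

Lemma cube_measurable_ae (S S' : set (cube R I)) : cube_measurable S -> ae_cube (fun x => S x <-> S' x) ->
  cube_measurable S'.
Proof.
move=> mS [B [mB B0 QB]].
have mc (C : set (cube R I)) : C `<=` B -> cube_measurable C.
  by move=> CB; apply: (@measure_is_complete_caratheodory _ _ lam); exists B.
have -> : S' = (S `\` (S `\` S')) `|` (S' `\` S).
  apply/seteqP; split => x /=.
    by move=> S'x; have [Sx|nSx] := pselect (S x); [left; split => // -[]|right].
  by move=> [[Sx h]|[]//]; apply: contrapT => nS'; apply: h.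
apply: (@measurableU _ (caratheodory_type lam)); last first.
  by apply: mc => x [S'x nS]; apply: QB => /= -[_ /(_ S'x)].
apply: (@measurableD _ (caratheodory_type lam)) => //.
by apply: mc => x [Sx nS']; apply: QB => /= -[/(_ Sx)].
Qed.

Lemma lam_ae (S S' : set (cube R I)) : ae_cube (fun x => S x -> S' x) -> (lam S <= lam S')%E.
Proof.
move=> [B [mB B0 QB]].
apply: (@le_trans _ _ (lam (S' `|` B))).
  apply: le_outer_measure => x Sx; have [S'x|nS'] := pselect (S' x); [by left|right].
  by apply: QB => /= /(_ Sx).
by apply: (le_trans (outer_measureU2 _ _ _)); have /= -> := B0; rewrite adde0.
Qed.

Lemma lam_ae_eq (S S' : set (cube R I)) : ae_cube (fun x => S x <-> S' x) -> lam S = lam S'.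
Proof.
move=> h; apply/eqP; rewrite eq_le; apply/andP; split; apply: lam_ae; move: h;
  by move=> [B [mB B0 QB]]; exists B; split => // x /= nx; apply: QB => /= -[].
Qed.

Let e (n : nat) : R := Num.max 0 (Num.min 1 (ratr (odflt 0%R (choice.unpickle n : option rat)))).

Let e01 n : 0 <= e n <= 1.
Proof. by rewrite /e le_max lexx /= ge_max ler01 ge_min lexx. Qed.

Let e_dense a b : 0 <= a -> a < b -> b <= 1 -> exists n, a < e n < b.
Proof.
move=> a0 ab b1; have [q] := rat_in_itvoo ab.
rewrite in_itv /= => /andP[aq qb]; exists (choice.pickle q).
by rewrite /e choice.pickleK /= min_r ?max_r; [rewrite aq|lra|lra].
Qed.

Lemma measurable_to_i01_borel (F : Omega R I -> R) (f : cube R I -> {i01 R}) :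
  measurable_fun setT F -> ae_cube (fun x => (f x)%:num = F (cnum x)) -> measurable_to_i01 f.
Proof.
move=> mF fF _ B mB; rewrite setTI.
have mFB : measurable (F @^-1` B) by have := mF measurableT B mB; rewrite setTI.
apply: (cube_measurable_ae (cube_measurable_preimage mFB)).
by apply/ae_cubeP; case/ae_cubeP: fF => Z [mZ Z0 hZ]; exists Z; split => // x /hZ /= ->.
Qed.

(** Borel versions [A n] of the level sets at countably many dense thresholds determine [F] as an
    infimum of thresholds; it equals [f] off the union of the exceptional sets. *)
Lemma measurable_to_i01_ae (f : cube R I -> {i01 R}) : measurable_to_i01 f ->
  exists F : Omega R I -> R, [/\ measurable_fun setT F, forall w, 0 <= F w <= 1 &
    ae_cube (fun x => (f x)%:num = F (cnum x))].
Proof.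
move=> mf.
have ex n : exists A : set (Omega R I), measurable A /\
    ae_cube (fun x => (f x)%:num < e n <-> A (cnum x)).
  apply: (@cube_measurable_borel [set x | (f x)%:num < e n]).
  have := mf measurableT `]-oo, e n[%classic (measurable_itv _); rewrite setTI.
  have -> : (fun x => (f x)%:num : R) @^-1` `]-oo, e n[%classic = [set x | (f x)%:num < e n].
    by apply/seteqP; split => x /=; rewrite in_itv.
  exact.
have [A hA] := choice ex.
have hZ n : exists Z, [/\ measurable Z, P Z = 0%E &
    forall x, ~ Z (cnum x) -> ((f x)%:num < e n <-> A n (cnum x))].
  by apply/ae_cubeP; case: (hA n).
have [Z hZ'] := choice hZ.
pose F (w : Omega R I) : R := inf ([set 1] `|` [set e n | n in [set n | A n w]]).
have hi w : has_inf ([set 1] `|` [set e n | n in [set n | A n w]]).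
  split; first by exists 1; left.
  by exists 0 => x [->|[n _ <-]]; rewrite ?ler01//; case/andP: (e01 n).
have F_lt w c : F w < c <-> (1 < c \/ exists2 n, e n < c & A n w).
  split=> [fc|[c1|[n ec hn]]].
  - have fc' : 0 < c - F w by rewrite subr_gt0.
    have [x + xc] := inf_adherent fc' (hi w).
    rewrite -/(F w) addrC subrK in xc.
    by move=> [x1|[n hn xn]]; [left; rewrite -x1|right; exists n => //; rewrite xn].
  - by apply: le_lt_trans c1; apply: ge_inf; [case: (hi w)|left].
  - by apply: le_lt_trans ec; apply: ge_inf; [case: (hi w)|right; exists n].
exists F; split.
- apply: (measurability _ (@Iio_systemE R)) => _ [_ [c ->] <-]; rewrite setTI.
  rewrite (_ : _ @^-1` _ = (if 1 < c then setT else set0) `|`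
      \bigcup_(n in [set n | e n < c]) A n).
    apply: measurableU; first by case: ifP.
    by apply: bigcup_measurable => n _; case: (hA n).
  apply/seteqP; split => w /=; rewrite in_itv /=.
    by move=> /F_lt [->|[n ? ?]]; [left|right; exists n].
  by move=> [|[n ? ?]]; [case: ifP => // ? _; apply/F_lt; left|apply/F_lt; right; exists n].
- move=> w; apply/andP; split; last by apply: ge_inf; [case: (hi w)|left].
  by apply: lb_le_inf; [exists 1; left|move=> x [->//|[n _ <-]]; case/andP: (e01 n)].
- apply/ae_cubeP; exists (\bigcup_n Z n); split.
  + by apply: bigcup_measurable => n _; case: (hZ' n).
  + apply/negligibleP; first by apply: bigcup_measurable => n _; case: (hZ' n).
    by apply: negligible_bigcup => n; apply/negligibleP; case: (hZ' n).
  + move=> x nZ.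
    have hx n : (f x)%:num < e n <-> A n (cnum x).
      by have [_ _ h] := hZ' n; apply: h => Zn; apply: nZ; exists n.
    have f0 : 0 <= (f x)%:num by [].
    have f1 : (f x)%:num <= 1 by [].
    apply/eqP; rewrite eq_le; apply/andP; split.
      apply: lb_le_inf; first by exists 1; left.
      by move=> y [->//|[n /hx An <-]]; exact: ltW.
    rewrite leNgt; apply/negP => lt.
    have F1 : F (cnum x) <= 1 by apply: ge_inf; [case: (hi (cnum x))|left].
    have [n /andP[fe eF]] := e_dense f0 lt F1.
    have : F (cnum x) < F (cnum x).
      by apply/F_lt; right; exists n => //; apply/hx.
    by rewrite ltxx.
Qed.

End cube_borel.

Section i01_borel.
Context (R : realType).
Local Notation U := (unif R).
Local Notation num1 := (fun y : {i01 R} => y%:num : R).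

Lemma i01_unif (B : set R) : measurable B -> lebesgue_i01 R [set y : {i01 R} | B y%:num] = U B.
Proof.
move=> mB; rewrite unif_itv//.
rewrite -(@measurable_mu_extE _ _ _ (@lebesgue_measure R)); last first.
  by apply: measurableI => //; exact: measurable_itv.
congr (mu_ext _ _); apply/seteqP; split => [_ [y /= By <-]|y [/= By]].
  by split => //; rewrite /= in_itv /=; apply/andP.
rewrite in_itv /= => /andP[y0 y1].
by exists (Itv01 y0 y1).
Qed.

Lemma measure_preserving_i01_borel (H : R -> R) (h : {i01 R} -> {i01 R}) :
  mpres U U H -> (forall y, (h y)%:num = H y%:num) -> measure_preserving_i01 h.
Proof.
move=> [mH hH] hE; split.
  move=> _ B mB; rewrite setTI (_ : _ @^-1` B = num1 @^-1` (H @^-1` B)).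
    by apply: image_ext_cara; have := mH measurableT B mB; rewrite setTI.
  by apply/seteqP; split => y /=; rewrite hE.
move=> B mB; rewrite i01_unif// -hH// -i01_unif; last first.
  by have := mH measurableT B mB; rewrite setTI.
by congr (lebesgue_i01 R _); apply/seteqP; split => y /=; rewrite hE.
Qed.

Lemma i01_mpres (H : R -> R) (h : {i01 R} -> {i01 R}) (Z : set R) :
  measure_preserving_i01 h -> measurable_fun setT H -> measurable Z -> U Z = 0%E ->
  (forall y : {i01 R}, ~ Z y%:num -> (h y)%:num = H y%:num) -> mpres U U H.
Proof.
move=> [_ hh] mH mZ Z0 hH; split => // B mB.
have mHB : measurable (H @^-1` B) by have := mH measurableT B mB; rewrite setTI.
have le (S S' : set {i01 R}) : (forall y, S y -> S' y \/ Z y%:num) ->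
    (lebesgue_i01 R S <= lebesgue_i01 R S')%E.
  move=> SS; apply: (@le_trans _ _ (lebesgue_i01 R (S' `|` [set y : {i01 R} | Z y%:num]))).
    exact: le_outer_measure.
  apply: (le_trans (outer_measureU2 _ _ _)).
  by rewrite (i01_unif mZ) Z0 adde0.
rewrite -(i01_unif mHB) -(i01_unif mB) -(hh B mB); apply/eqP; rewrite eq_le; apply/andP; split; apply: le => y /= By.
  by have [Zy|nZ] := pselect (Z y%:num); [right|left; rewrite hH].
by have [Zy|nZ] := pselect (Z y%:num); [right|left; rewrite -hH].
Qed.

End i01_borel.

(** Fubini for null sets: almost every section of [Z] is null. The second moment of a function with
    values in [0, 1] is at most its mean. *)
Lemma ae_condE_null (R : realType) (I : countType) (S : pred I) (Z : set (Omega R I)) :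
  measurable Z -> iid R I Z = 0%E -> {ae iid R I, forall w, condE S (\1_Z : Omega R I -> R) w = 0}.
Proof.
move=> mZ Z0; have bZ : bdm (\1_Z : Omega R I -> R) by exact: bdm_indic.
have bcZ : bdm (condE S (\1_Z : Omega R I -> R)) by exact: bdm_condE.
apply: Ex_sqr_eq0_ae => //; apply/eqP; rewrite eq_le Ex_sqr_ge0 andbT.
apply: (@le_trans _ _ (Ex (iid R I) (condE S \1_Z))); last first.
  by rewrite -Ex_splice// -lee_fin Ex_indic// Z0.
apply: le_Ex => // [|w]; first by auto.
have c0 : 0 <= condE S \1_Z w by apply: Ex_ge0 => w'; rewrite indicE.
rewrite expr2 ler_piMl//; apply: Ex_le_cst => [|w']; first exact: bdm_splicer.
by rewrite indicE; case: (_ \in _).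
Qed.

Section ae_cube_facts.
Context (R : realType) (I : finType).

Lemma ae_cube_all (J : countType) (Q : J -> cube R I -> Prop) :
  (forall j, ae_cube (Q j)) -> ae_cube (fun x => forall j, Q j x).
Proof.
move=> h.
have hZ j : exists Z, [/\ measurable Z, iid R I Z = 0%E & forall x, ~ Z (cnum x) -> Q j x].
  exact/ae_cubeP.
have [Z hZ'] := choice hZ.
have : {ae iid R I, forall w, forall j, ~ Z j w}.
  apply: ae_countable => j; exists (Z j); case: (hZ' j) => mZ Z0 _; split => // w /= nn.
  exact: contrapT.
move=> /ae_iid_cube /ae_cubeP [Y [mY Y0 hY]]; apply/ae_cubeP; exists Y; split => // x nY j.
by have [_ _] := hZ' j; apply; exact: hY.
Qed.

Lemma ae_cubeW (Q Q' : cube R I -> Prop) : (forall x, Q x -> Q' x) -> ae_cube Q -> ae_cube Q'.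
Proof.
move=> QQ /ae_cubeP [Z [mZ Z0 hZ]]; apply/ae_cubeP; exists Z; split => // x nZ.
by apply: QQ; exact: hZ.
Qed.

Lemma ae_cube_and (Q Q' : cube R I -> Prop) : ae_cube Q -> ae_cube Q' ->
  ae_cube (fun x => Q x /\ Q' x).
Proof.
move=> h h'; have := @ae_cube_all bool (fun b => if b then Q else Q').
move=> /(_ (fun b => match b with true => h | false => h' end)).
by apply: ae_cubeW => x hx; split; [exact: (hx true)|exact: (hx false)].
Qed.

End ae_cube_facts.

(** * Hats of families and their measure preservation *)

Section pullback.
Context (R : realType).

Lemma imset_r_inj (U V : finType) (a : U -> V) : injective a -> injective (imset_r a).
Proof.
move=> inja A B /(congr1 val) /= AB; apply: val_inj; exact: (imset_inj inja).
Qed.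

Lemma cnum_pullback (U V : finType) (a : U -> V) (x : E R V) :
  cnum (pullback a x) = cnum x \o imset_r a.
Proof. by []. Qed.

Lemma mpres_pullback (U V : finType) (a : U -> V) : injective a ->
  mpres (iid R (r V)) (iid R (r U)) (fun w => w \o imset_r a).
Proof. by move=> inja; apply: mpres_relabel; exact: imset_r_inj. Qed.

Lemma ae_cube_pullback (U V : finType) (a : U -> V) (Q : E R U -> Prop) : injective a ->
  ae_cube Q -> ae_cube (fun x : E R V => Q (pullback a x)).
Proof.
move=> inja /ae_cubeP [Z [mZ Z0 hZ]].
have [ma ha] := mpres_pullback inja.
apply/ae_cubeP; exists ((fun w : Omega R (r V) => w \o imset_r a) @^-1` Z); split.
- by have := ma measurableT Z mZ; rewrite setTI.
- by rewrite ha.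
- by move=> x nZ; exact: hZ.
Qed.

Lemma pullback_comp (U V W : finType) (a : U -> V) (b : V -> W) (x : E R W) :
  pullback a (pullback b x) = pullback (b \o a) x.
Proof.
by apply/funext => A; congr x; apply: val_inj; rewrite /= -imset_comp.
Qed.

(** Two enumerations of a set differ by a permutation. The sizes [m] and [n] are kept distinct
    because the cardinals compared later are equal only propositionally. *)
Lemma symmetric_enum (V : finType) (f : fun_family R) (m n : nat) (s : 'I_m -> V)
    (t : 'I_n -> V) (x : E R V) : symmetric_fun (f m) ->
  injective s -> injective t -> (s @: [set: 'I_m] = t @: [set: 'I_n])%SET ->
  f m (pullback s x) = f n (pullback t x).
Proof.
move=> sf injs injt st.
have mn : m = n.
  by rewrite -[m]card_ord -[n]card_ord -!cardsT -(card_imset _ injs) st card_imset.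
subst n.
have ex i : exists j, s j == t i.
  have : t i \in (s @: [set: 'I_m])%SET by rewrite st imset_f.
  by move=> /imsetP[j _ ->]; exists j.
pose q i := xchoose (ex i).
have qE i : s (q i) = t i by apply/eqP; exact: (xchooseP (ex i)).
have q_inj : injective q by move=> i j qij; apply: injt; rewrite -!qE qij.
rewrite -(sf (perm q_inj)) pullback_comp; congr (f m (pullback _ x)).
by apply/funext => i /=; rewrite permE qE.
Qed.

End pullback.

Section top_coordinate.
Context (R : realType) (d : nat) (d_gt0 : (0 < d)%N).
Local Notation I := (r 'I_d).
Local Notation U := (unif R).

Lemma setT_neq0 : [set: 'I_d]%SET != finset.set0.
Proof. by apply/set0Pn; exists (Ordinal d_gt0); rewrite inE. Qed.

Definition rtop : I := Sub [set: 'I_d]%SET setT_neq0.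

Lemma rtopE (A : I) : (A == rtop) = (val A == [set: 'I_d]%SET).
Proof. by rewrite -val_eqE. Qed.

Definition set_top (w : Omega R I) (y : R) : Omega R I := fun B => if B == rtop then y else w B.

Lemma splice_top (w w' : Omega R I) : splice (predC1 rtop) w w' = set_top w (w' rtop).
Proof.
by apply/funext => B; rewrite /splice /set_top /=; case: eqVneq => [->|].
Qed.

Lemma measurable_set_top w : measurable_fun setT (set_top w).
Proof.
apply: measurable_Omega => B; rewrite /set_top; case: (B == rtop) => //.
Qed.

Lemma cnum_E_pair (w : Omega R I) (xs : Estar R 'I_d) (y : {i01 R}) :
  (forall B : rstar 'I_d, (xs B)%:num = w (val B)) ->
  cnum (E_pair xs y) = set_top w y%:num.
Proof.
move=> hx; apply/funext => B; rewrite /cnum /E_pair /set_top rtopE.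
case: insubP => [B' nB e|/negPn ->//]; by rewrite (negbTE nB) hx e.
Qed.

Lemma condE_top (F : Omega R I -> R) w : bdm F ->
  condE (predC1 rtop) F w = Ex U (fun y => F (set_top w y)).
Proof.
move=> bF; rewrite /condE.
have bFw : bdm (fun y : R => F (set_top w y)).
  by apply: (bdm_comp (phi := set_top w) _ bF); exact: measurable_set_top.
by rewrite -(Ex_mpres (mpres_coord R rtop) bFw); apply: eq_Ex => w'; rewrite splice_top.
Qed.

(** For almost every [w] the coordinates lie in [0, 1] and the section of the exceptional set is
    null. On such a fibre [F] agrees almost everywhere with [f], which preserves the measure
    there. *)
Lemma mp_highest_order_condE (f : E R 'I_d -> {i01 R}) (F : Omega R I -> R) h :
  mp_highest_order f -> measurable_fun setT F ->
  ae_cube (fun x => (f x)%:num = F (cnum x)) -> bdm h ->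
  {ae iid R I, forall w, condE (predC1 rtop) (fun w => h (F w)) w = Ex U h}.
Proof.
move=> [_ mp] mF /ae_cubeP [Z [mZ Z0 hZ]] bh.
have bhF : bdm (fun w => h (F w)) by apply: bdm_comp bh.
have bZ : bdm (\1_Z : Omega R I -> R) by exact: bdm_indic.
have aeZ := ae_condE_null (predC1 rtop) mZ Z0.
have ae01 : {ae iid R I, forall w, forall B, 0 <= w B <= 1}.
  by apply: ae_countable => B; exact: (ae_mpres (mpres_coord R B) (unif01 R)).
apply: filterS2 aeZ ae01 => w Zw w01.
pose xs (B : rstar 'I_d) : {i01 R} := Itv01 (proj1 (andP (w01 (val B)))) (proj2 (andP (w01 (val B)))).
have xsE B : (xs B)%:num = w (val B) by [].
have mZw : measurable (set_top w @^-1` Z).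
  by have := @measurable_set_top w measurableT Z mZ; rewrite setTI.
have mp1 : mpres U U (fun y => F (set_top w y)).
  apply: (i01_mpres (mp xs) (Z := set_top w @^-1` Z)) => //.
  - exact: measurableT_comp mF (@measurable_set_top w).
  - rewrite -Ex_indic//; move: Zw; rewrite condE_top// => Zw; congr (_%:E).
    by rewrite -[RHS]Zw; apply: eq_Ex => y; rewrite !indicE.
  - by move=> y nZ; rewrite hZ (cnum_E_pair _ xsE).
rewrite condE_top//.
exact: (Ex_mpres mp1 bh).
Qed.

End top_coordinate.

Section hat.
Context (R : realType) (k : nat) (f : fun_family R) (gf : good_family k f).
Local Notation U := (unif R).

(** The hat on an arbitrary vertex set. Coordinates of sets larger than [k], where the family is
    unconstrained, are left alone, so that the measure is preserved for every [V]. *)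
Definition hat_on (V : finType) (x : E R V) : E R V := fun A =>
  if (#|val A| <= k)%N then f (pullback (fun i : 'I_#|val A| => enum_val i) x) else x A.

Lemma card_r_gt0 (V : finType) (A : r V) : (0 < #|val A|)%N.
Proof. by rewrite card_gt0 (valP A). Qed.

Lemma imset_enum_val (V : finType) (A : {set V}) :
  ((fun i : 'I_#|A| => enum_val i) @: [set: 'I_#|A|])%SET = A.
Proof.
apply/finset.setP => x; apply/imsetP/idP => [[i _ ->]|xA]; first exact: enum_valP.
by exists (enum_rank_in xA x); rewrite // enum_rankK_in.
Qed.

Lemma pullback_hat_on (V : finType) d (a : 'I_d -> V) (x : E R V) : (d <= k)%N -> injective a ->
  pullback a (hat_on x) = hat f (pullback a x).
Proof.
move=> dk inja; apply/funext => A.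
have cA : #|val (imset_r a A)| = #|val A| by rewrite card_imset.
have Ak : (#|val A| <= k)%N by apply: leq_trans dk; rewrite -[leqRHS](card_ord d) max_card.
have cAk : (#|val (imset_r a A)| <= k)%N by rewrite cA.
rewrite {1}/pullback /hat_on cAk /hat pullback_comp.
apply: symmetric_enum.
- have d0 : (0 < #|val (imset_r a A)| <= k)%N by rewrite cAk card_r_gt0.
  by have [] := gf d0.
- exact: enum_val_inj.
- by move=> i j /inja /enum_val_inj.
- rewrite imset_enum_val.
  transitivity (a @: ((fun i : 'I_#|val A| => enum_val i) @: [set: 'I_#|val A|]))%SET.
    by rewrite imset_enum_val.
  by rewrite -imset_comp; exact: eq_imset.
Qed.

Lemma good_family_borel : exists F : forall d, Omega R (r 'I_d) -> R,
  (forall d, measurable_fun setT (F d)) /\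
  forall d, (0 < d <= k)%N -> ae_cube (fun x : E R 'I_d => (f x)%:num = F d (cnum x)).
Proof.
have exF d : exists F : Omega R (r 'I_d) -> R, measurable_fun setT F /\
    ((0 < d <= k)%N -> ae_cube (fun x : E R 'I_d => (f x)%:num = F (cnum x))).
  have [dk|ndk] := boolP (0 < d <= k)%N; last by exists (cst 0).
  have [_ [mf _]] := gf dk.
  by have [F [mF _ fF]] := measurable_to_i01_ae mf; exists F.
by exists (fun d => projT1 (cid (exF d))); split => d; case: (projT2 (cid (exF d))).
Qed.

Context (F : forall d, Omega R (r 'I_d) -> R).
Hypothesis mF : forall d, measurable_fun setT (@F d).
Hypothesis fF : forall d, (0 < d <= k)%N -> ae_cube (fun x : E R 'I_d => (f x)%:num = F (cnum x)).

Let sub_enum (V : finType) (A : r V) (w : Omega R (r V)) : Omega R (r 'I_#|val A|) :=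
  w \o imset_r (fun i : 'I_#|val A| => enum_val i).

Let mpres_sub (V : finType) (A : r V) : mpres (iid R (r V)) (iid R (r 'I_#|val A|)) (@sub_enum _ A).
Proof. by apply: mpres_pullback; exact: enum_val_inj. Qed.

Definition hat_borel (V : finType) (w : Omega R (r V)) : Omega R (r V) := fun A =>
  if (#|val A| <= k)%N then F (sub_enum (A := A) w) else w A.

Lemma hat_on_borel (V : finType) :
  ae_cube (fun x : E R V => cnum (hat_on x) = hat_borel (cnum x)).
Proof.
have : ae_cube (fun x : E R V => forall A : r V, (hat_on x A)%:num = hat_borel (cnum x) A).
  apply: ae_cube_all => A; rewrite /hat_on /hat_borel.
  case Ak: (#|val A| <= k)%N; last by apply/ae_cubeP; exists set0; split.
  have d0 : (0 < #|val A| <= k)%N by rewrite card_r_gt0 Ak.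
  apply: (ae_cubeW _ (ae_cube_pullback (@enum_val_inj _ (mem (val A))) (fF d0))).
  by move=> x ->.
by apply: ae_cubeW => x h; apply/funext => A; exact: h.
Qed.

Lemma mpres_hat_borel (V : finType) : mpres (iid R (r V)) (iid R (r V)) (@hat_borel V).
Proof.
apply: (mpres_triangular (bl := id) (rk := fun A : r V => #|val A|)).
- apply: measurable_Omega => A; rewrite /hat_borel.
  case: (#|val A| <= k)%N; last exact: measurable_coord.
  have [m _] := mpres_sub A.
  exact: (measurableT_comp (@mF _) m).
- move=> A H h bH bh dH; rewrite /hat_borel; case Ak: (#|val A| <= k)%N; last first.
    have bhA : bdm (fun w : Omega R (r V) => h (w A)).
      exact: (bdm_comp (@measurable_coord R (r V) A) bh).
    rewrite (Ex_indep (D := pred1 A) dH)//.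
    + by rewrite (Ex_mpres (mpres_coord R A) bh).
    + by move=> w w' ww'; congr h; apply: ww'; exact: eqxx.
    + by move=> B /= /eqP ->; rewrite eqxx.
  have d0 := card_r_gt0 A.
  have d0k : (0 < #|val A| <= k)%N by rewrite d0 Ak.
  have [_ mp] := gf d0k.
  have bhF : bdm (fun w => h (@F #|val A| w)) by apply: (bdm_comp _ bh); exact: mF.
  have bhA : bdm (fun w => h (F (sub_enum (A := A) w))).
    by apply: (bdm_comp (phi := @sub_enum _ A) _ bhF); case: (mpres_sub A).
  rewrite -(Ex_condE (S := fun B => B != A) dH)//.
  transitivity (Ex (iid R (r V)) (fun w => H w * Ex U h)); last first.
    by rewrite mulrC -ExZ//; apply: eq_Ex => w; rewrite mulrC.
  apply: ae_Ex; [by apply: bdmM => //; exact: bdm_condE|by auto|].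
  have := ae_mpres (mpres_sub A) (mp_highest_order_condE d0 mp (@mF _) (fF d0k) bh).
  apply: filterS => w <-; congr (_ * _).
  apply: (condE_morph (S := fun B => B != A) (F := fun w => h (F w)) _ (mpres_sub A) bhF) => w1 w2.
  apply/funext => B; rewrite /sub_enum /splice /=; congr (if ~~ _ then _ else _).
  rewrite rtopE -val_eqE /=; apply/eqP/eqP => [e|->]; last exact: imset_enum_val.
  apply: (imset_inj (@enum_val_inj _ (mem (val A)))).
  by rewrite imset_enum_val; exact: e.
- move=> A A' AA' le; rewrite /hat_borel; case: (#|val A'| <= k)%N; last first.
    by move=> w w'; apply; rewrite eq_sym.
  move=> w w' ww'; congr F; apply/funext => B; apply: ww'.
  apply: contraNneq AA' => BA; apply/eqP.
  have sub : val A \subset val A'.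
    rewrite -BA /=; apply/fintype.subsetP => _ /imsetP[i _ ->]; exact: enum_valP.
  by apply: val_inj; apply/eqP; rewrite eqEcard sub.
Qed.

Lemma ae_cube_hat_on (V : finType) (Q : E R V -> Prop) :
  ae_cube Q -> ae_cube (fun x => Q (hat_on x)).
Proof.
move=> /ae_cubeP [Z [mZ Z0 hZ]].
have [mv hv] := @mpres_hat_borel V.
have : {ae iid R (r V), forall w, ~ Z (hat_borel w)}.
  exists (@hat_borel V @^-1` Z); split.
  - by have := mv measurableT Z mZ; rewrite setTI.
  - by rewrite hv.
  - by move=> w /= /contrapT.
move=> /ae_iid_cube h; apply: ae_cubeW (ae_cube_and h (@hat_on_borel V)) => x [nZ e].
by apply: hZ; rewrite e.
Qed.

End hat.

(** * Densities and the law of the random structure *)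

Section Tind.
Context (R : realType) (L : language).

(** Maps are taken in a [{ffun}] type, which is finite, so that intersections over them are
    countable and keep null sets null. *)
Lemma TindP (V : finType) (M : structure_on L V) (N : euclidean_structure R L) x :
  Tind M N x <-> forall (P : L) (a : {ffun 'I_(arity P) -> V}), injective a ->
    (M P a <-> N P (pullback a x)).
Proof.
split=> [h P a inja|h P _].
  have [hin hout] := h P I; split => [Ma|]; first by apply: hin; split.
  by move=> Na; apply: contrapT => nMa; apply: (hout a _ Na); split.
split=> a [inja Ma] /=; have := h P (finfun a); rewrite (_ : finfun a = a :> (_ -> _)).
- by move=> /(_ inja) [+ _]; exact.
- by apply/funext => i; rewrite ffunE.
- by move=> /(_ inja) [_ h'] /h'.
- by apply/funext => i; rewrite ffunE.
Qed.

Lemma euclidean_borel (N : euclidean_structure R L) :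
  exists NB : forall P : L, set (Omega R (r 'I_(arity P))),
    (forall P, measurable (NB P)) /\
    forall P, ae_cube (fun x : E R 'I_(arity P) => N P x <-> NB P (cnum x)).
Proof.
have h P := cid (cube_measurable_borel (@eset_measurable _ _ N P)).
by exists (fun P => projT1 (h P)); split => P; case: (projT2 (h P)).
Qed.

Section borel.
Context (NB : forall P : L, set (Omega R (r 'I_(arity P)))) (mNB : forall P, measurable (@NB P)).
Arguments NB : clear implicits.
Arguments mNB : clear implicits.

Definition Tind_borel (V : finType) (M : structure_on L V) : set (Omega R (r V)) :=
  [set w : Omega R (r V) | forall (P : L) (a : {ffun 'I_(arity P) -> V}), injective a ->
    (M P a <-> NB P (w \o imset_r a))].

Lemma measurable_Tind_borel (V : finType) (M : structure_on L V) : measurable (Tind_borel M).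
Proof.
rewrite (_ : Tind_borel M = \bigcap_(P in [set: L])
    \bigcap_(a in [set a : {ffun 'I_(arity P) -> V} | injective a])
      [set w : Omega R (r V) | M P a <-> NB P (w \o imset_r a)]); last first.
  by apply/seteqP; split => w /= h P => [_ a|a]; [exact: h|exact: (h P I)].
apply: fin_bigcap_measurable => // P _.
apply: fin_bigcap_measurable => [|a inja]; first exact: finite_finset.
have [m _] := mpres_pullback R inja.
have mB := m measurableT _ (mNB P); rewrite setTI in mB.
have [Ma|nMa] := pselect (M P a).
  by rewrite (_ : [set _ | _] = (fun w : Omega R (r V) => w \o imset_r a) @^-1` NB P)//;
    apply/seteqP; split => w /=; tauto.
rewrite (_ : [set _ | _] = ~` ((fun w : Omega R (r V) => w \o imset_r a) @^-1` NB P)).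
  exact: measurableC.
by apply/seteqP; split => w /=; tauto.
Qed.

Context (N : euclidean_structure R L).
Hypothesis NNB : forall P, ae_cube (fun x : E R 'I_(arity P) => N P x <-> NB P (cnum x)).

Lemma ae_Tind_borel (V : finType) (M : structure_on L V) :
  ae_cube (fun x : E R V => Tind M N x <-> Tind_borel M (cnum x)).
Proof.
have : ae_cube (fun x : E R V => forall (P : L) (a : {ffun 'I_(arity P) -> V}), injective a ->
    (N P (pullback a x) <-> NB P (cnum (pullback a x)))).
  apply: ae_cube_all => P; apply: ae_cube_all => a.
  have [inja|ninj] := pselect (injective a).
    by apply: ae_cubeW (ae_cube_pullback inja (NNB P)).
  by apply/ae_cubeP; exists set0; split.
apply: ae_cubeW => x h; rewrite TindP; split => h' P a inja; rewrite (h' P a inja).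
  exact: h.
by split => /(h P a inja).
Qed.

Lemma lebesgue_Tind (V : finType) (M : structure_on L V) :
  lebesgue_cube R (r V) (Tind M N) = iid R (r V) (Tind_borel M).
Proof.
rewrite -cube_iid; last exact: measurable_Tind_borel.
exact: lam_ae_eq (ae_Tind_borel M).
Qed.

End borel.

(** Up to a null set, [Tind M N2] is the preimage of [Tind M N] under [hat_on], a measure preserving
    map. *)
Lemma lebesgue_Tind_hat (N N2 : euclidean_structure R L) (f : fun_family R) :
  good_family (max_arity L) f ->
  (forall P, ae_cube (fun x : E R 'I_(arity P) => N2 P x <-> N P (hat f x))) ->
  forall (V : finType) (M : structure_on L V),
    lebesgue_cube R (r V) (Tind M N2) = lebesgue_cube R (r V) (Tind M N).
Proof.
move=> gf h V M; set k := max_arity L.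
have arity_le (P : L) : (arity P <= k)%N by exact: leq_bigmax.
have [NB [mNB NNB]] := euclidean_borel N.
have [F [mF fF]] := good_family_borel gf.
have hat2 : ae_cube (fun x : E R V => Tind M N2 x <-> Tind M N (hat_on k f x)).
  have : ae_cube (fun x : E R V => forall (P : L) (a : {ffun 'I_(arity P) -> V}), injective a ->
      (N2 P (pullback a x) <-> N P (pullback a (hat_on k f x)))).
    apply: ae_cube_all => P; apply: ae_cube_all => a.
    have [inja|ninj] := pselect (injective a).
      apply: ae_cubeW (ae_cube_pullback inja (h P)) => x e _.
      by rewrite (pullback_hat_on gf).
    by apply/ae_cubeP; exists set0; split.
  apply: ae_cubeW => x e; rewrite !TindP; split => h' P a inja; rewrite (h' P a inja).
    exact: e.
  by split => /(e P a inja).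
have [mh hh] := mpres_hat_borel gf mF fF V.
have mT := measurable_Tind_borel mNB M.
rewrite (lebesgue_Tind mNB NNB) -hh//.
rewrite -cube_iid; last by have := mh measurableT _ mT; rewrite setTI.
apply: lam_ae_eq.
have e23 := ae_cube_and (ae_cube_hat_on gf mF fF (ae_Tind_borel NNB M)) (hat_on_borel fF V).
apply: ae_cubeW (ae_cube_and hat2 e23) => x [e1 [e2 e3]].
by rewrite /= -e3 e1.
Qed.

End Tind.

Section finite_law.
Context (R : realType) (L : language).

Section patterns.
Context (V : finType).

Local Notation at_ := {P : L & (arity P).-tuple V}.

Definition fset_of (A : r V) : {fset V} := [fset x | x in val A]%fset.

Lemma fset_of_inj : injective fset_of.
Proof.
move=> A B /fsetP AB; apply: val_inj; apply/finset.setP => x.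
by have := AB x; rewrite !inE.
Qed.

Lemma face_fset_of k (t : k.-tuple V) (A : r 'I_k) : face t A = fset_of (imset_r (tnth t) A).
Proof.
apply/fsetP => x; rewrite inE /=; apply/faceP/imsetP => -[i iA ->]; by exists i.
Qed.

Definition pattern_structure (m : {ffun at_ -> bool}) : structure_on L V :=
  fun P a => injective a /\ m (Tagged (fun P : L => (arity P).-tuple V) [tuple a i | i < arity P]).

Lemma canonical_pattern m : canonical_structure (pattern_structure m).
Proof. by move=> P a []. Qed.

Definition pattern (NB : forall P : L, set (Omega R (r 'I_(arity P)))) (X : Omega R {fset V}) :
  {ffun at_ -> bool} := [ffun b : at_ => uniq (tagged b) && `[< NB (tag b) (X \o face (tagged b)) >]].

Lemma patternP NB X (m : {ffun at_ -> bool}) : (forall b : at_, m b -> uniq (tagged b)) ->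
  pattern NB X = m <-> Tind_borel NB (pattern_structure m) (X \o fset_of).
Proof.
move=> mu; have faceE k (t : k.-tuple V) : X \o face t = (X \o fset_of) \o imset_r (tnth t).
  by apply/funext => A /=; rewrite face_fset_of.
split=> [<- P a inja|h].
  rewrite /pattern_structure ffunE /= (_ : X \o face _ = (X \o fset_of) \o imset_r a); last first.
    by rewrite faceE; congr (_ \o imset_r _); apply/funext => i; rewrite tnth_mktuple.
  have u : uniq [tuple a i | i < arity P] by rewrite map_inj_uniq ?enum_uniq.
  rewrite u /=; split; first by move=> [_ /asboolP].
  by move=> n; split=> //; exact/asboolP.
apply/ffunP => -[P t]; rewrite ffunE /=.
have [u|nu] := boolP (uniq t); last by apply/esym/negbTE; apply: contra nu => /mu.
have inja : injective (finfun (tnth t)) by move=> i j; rewrite !ffunE => /tuple_uniqP; exact.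
have [h1 h2] := h P (finfun (tnth t)) inja.
have aE : finfun (tnth t) = tnth t :> (_ -> _) by apply/funext => i; rewrite ffunE.
have tE : [tuple (finfun (tnth t)) i | i < arity P] = t.
  by apply: eq_from_tnth => i; rewrite tnth_mktuple aE.
move: h1 h2; rewrite /pattern_structure tE aE -faceE => h1 h2.
apply/asboolP/idP => [/h2 []//|mt]; apply: h1; split => //.
by rewrite -aE.
Qed.

(** Exactly one truth table supported on injective tuples is realised at each point, so the
    expectation is a finite sum over canonical structures on [V]. *)
Lemma Ex_pattern NB (F : Omega R (atom L V) -> R) : (forall P, measurable (NB P)) -> bdm F ->
  Ex (iid R {fset V}) (fun X => F (bits NB X)) =
  \sum_(m : {ffun at_ -> bool} | [forall b : at_, m b ==> uniq (tagged b)])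
    F (fun b => (m b)%:R) * fine (iid R (r V) (Tind_borel NB (pattern_structure m))).
Proof.
move=> mNB bF.
have mp := mpres_relabel R fset_of_inj.
pose B (m : {ffun at_ -> bool}) := Tind_borel NB (pattern_structure m).
have mB m : measurable (B m) by exact: measurable_Tind_borel.
have bB m : bdm (\1_(B m) : Omega R (r V) -> R) by exact: bdm_indic.
have bBX m : bdm (fun X : Omega R {fset V} => \1_(B m) (X \o fset_of) : R).
  by case: mp => mp _; exact: (bdm_comp mp (bB m)).
transitivity (Ex (iid R {fset V}) (fun X =>
    \sum_(m : {ffun at_ -> bool} | [forall b : at_, m b ==> uniq (tagged b)])
      F (fun b => (m b)%:R) * \1_(B m) (X \o fset_of))).
  apply: eq_Ex => X.
  rewrite (bigD1 (pattern NB X)) /=; last first.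
    by apply/forallP => b; apply/implyP; rewrite ffunE => /andP[].
  rewrite big1 => [|m /andP[/forallP mu mX]]; last first.
    rewrite indicE memNset ?mulr0// => /patternP mE; move: mX; rewrite mE ?eqxx// => b mb.
    by have := mu b; rewrite mb.
  rewrite addr0 indicE mem_set ?mulr1; last first.
    by apply/patternP => // b; rewrite ffunE => /andP[].
  by congr F; apply/funext => b; rewrite ffunE.
rewrite -big_filter; transitivity (Ex (iid R {fset V}) (fun X =>
    \sum_(m <- [seq m : {ffun at_ -> bool} <- index_enum _ | [forall b : at_, m b ==> uniq (tagged b)]])
      F (fun b => (m b)%:R) * \1_(B m) (X \o fset_of))).
  by apply: eq_Ex => X; rewrite -big_filter.
rewrite Ex_sum => [|m]; last exact: bdmM.
apply: eq_bigr => m _; rewrite ExZ//; congr (_ * _).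
by rewrite (Ex_mpres mp (bB m)) -(Ex_indic (iid R (r V)) (mB m)).
Qed.

End patterns.

Context (NB NB' : forall P : L, set (Omega R (r 'I_(arity P))))
  (mNB : forall P, measurable (@NB P)) (mNB' : forall P, measurable (@NB' P))
  (same_Tind : forall (V : finType) (M : structure_on L V), canonical_structure M ->
    iid R (r V) (Tind_borel NB M) = iid R (r V) (Tind_borel NB' M)).

Lemma Ex_bits_finite (V : finType) (F : Omega R (atom L V) -> R) : bdm F ->
  Ex (iid R {fset V}) (fun X => F (bits NB X)) = Ex (iid R {fset V}) (fun X => F (bits NB' X)).
Proof.
move=> bF; rewrite !Ex_pattern//; apply: eq_bigr => m _.
by rewrite same_Tind//; exact: canonical_pattern.
Qed.

Lemma atom_restrict (W : countType) (Z : {fset W}) (b : atom L W) : all (mem Z) (supp b) ->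
  exists b' : atom L (fset_sub_type Z), map_atom val b' = b.
Proof.
case: b => P t /allP tZ.
have /choice[c cE] : forall i : 'I_(arity P), exists v : fset_sub_type Z, val v = tnth t i.
  by move=> i; exists [` tZ _ (mem_tnth i t)]%fset.
exists (Tagged (fun P : L => (arity P).-tuple (fset_sub_type Z)) [tuple c i | i < arity P]).
congr (Tagged _); apply: eq_from_tnth => i.
by rewrite tnth_map tnth_mktuple.
Qed.

(** A finite product involves only atoms over a finite set [Z] of vertices; restriction to [Z]
    reduces it to a finite vertex type. *)
Lemma Ex_bits (W : countType) (F : Omega R (atom L W) -> R) : bdm F ->
  Ex (iid R {fset W}) (fun X => F (bits NB X)) = Ex (iid R {fset W}) (fun X => F (bits NB' X)).
Proof.
move=> bF.
have mb := measurable_bits (W := W) mNB; have mb' := measurable_bits (W := W) mNB'.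
rewrite (Ex_mpres (mpres_law (iid R {fset W}) mb) bF).
rewrite (Ex_mpres (mpres_law (iid R {fset W}) mb') bF).
apply: Ex_Omega_unique bF => s h us bh.
have bs : bdm (fun w : Omega R (atom L W) => \prod_(i <- s) h i (w i)) by exact: bdm_prod_coord.
rewrite -(Ex_mpres (mpres_law (iid R {fset W}) mb) bs).
rewrite -(Ex_mpres (mpres_law (iid R {fset W}) mb') bs).
pose Z : {fset W} := [fset x | x in flatten (map supp s)]%fset.
have [s' s'E] : exists s', map (map_atom (val : fset_sub_type Z -> W)) s' = s.
  have : forall b, b \in s -> all (mem Z) (supp b).
    move=> b bs'; apply/allP => x xb; apply/imfsetP; exists x => //=; apply/flattenP.
    by exists (supp b) => //; exact: map_f.
  elim: (s) => [|b t IH] hs; first by exists [::].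
  have [b' b'E] := atom_restrict (hs b (mem_head _ _)).
  have [t' <-] := IH (fun c ct => hs c (mem_behead (s := b :: t) ct)).
  by exists (b' :: t') => /=; rewrite b'E.
have injv : injective (fun A : {fset fset_sub_type Z} => (val @` A)%fset : {fset W}).
  exact: imfset_injective val_inj.
have mp := mpres_relabel R injv.
pose G (y : Omega R (atom L (fset_sub_type Z))) := \prod_(b <- s') h (map_atom val b) (y b).
have bG : bdm G.
  by apply: bdm_prod => b; apply: (bdm_comp _ (bh _)); exact: measurable_coord.
suff E M (mM : forall P, measurable (M P)) : Ex (iid R {fset W}) (fun X => \prod_(b <- s) h b (bits M X b)) =
    Ex (iid R {fset fset_sub_type Z}) (fun X => G (bits M X)).
  by rewrite !E// Ex_bits_finite.
have bGM : bdm (fun X => G (bits M X)) by apply: (bdm_comp _ bG); exact: measurable_bits.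
rewrite -(Ex_mpres mp bGM); apply: eq_Ex => X.
rewrite -s'E big_map; apply: eq_bigr => b _.
by rewrite -bits_map//; exact: val_inj.
Qed.

End finite_law.

(** Structures that are not models have measure 0 on both sides, and for models the positive factor
    |V|!/|Aut M| is cancelled. *)
Lemma lebesgue_Tind_weak_on (R : realType) (L : language) (T : universal_theory L)
    (N N' : euclidean_structure R L) : weak_on T N -> weak_on T N' ->
  (forall (V : finType) (M : structure_on L V), is_model T M -> density M N = density M N') ->
  forall (V : finType) (M : structure_on L V), canonical_structure M ->
    lebesgue_cube R (r V) (Tind M N) = lebesgue_cube R (r V) (Tind M N').
Proof.
move=> hN hN' h V M cM; have [mM|nM] := pselect (is_model T M); last by rewrite hN// hN'.
have := h V M mM; rewrite /density => e.
have c0 : (0 < (#|V|)`!%:R / #|automorphisms M|%:R :> R)%R.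
  rewrite divr_gt0// ltr0n ?fact_gt0//; apply/card_gt0P; exists 1%g.
  rewrite inE; apply/asboolP => P a; rewrite (_ : _ \o a = a)//.
  by apply/funext => i /=; rewrite perm1.
by apply/eqP; move/eqP: e; rewrite !eq_le !lee_pmul2l.
Qed.

(** * Substitution of finite cubes into the infinite one *)

Section rational_thresholds.
Context (R : realType).
Local Notation U := (unif R).

(** A countable generating pi-system: almost sure identities for its members hold simultaneously. *)
Definition Iio_rat : set (set R) := [set A | exists q : rat, A = `]-oo, ratr q[%classic].

Lemma Iio_ratE : @measurable _ R = <<s Iio_rat >>.
Proof.
apply/seteqP; split; last first.
  apply: smallest_sub; first exact: sigma_algebra_measurable.
  by move=> _ [q ->]; exact: measurable_itv.
rewrite Iio_systemE; apply: smallest_sub; first exact: smallest_sigma_algebra.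
move=> _ [s ->].
rewrite (_ : `]-oo, s[%classic =
    \bigcup_(q : rat) if ratr q < s then `]-oo, (ratr q : R)[%classic else set0); last first.
  apply/seteqP; split => [x /=|x [q _]].
    rewrite in_itv /= => /rat_in_itvoo[q]; rewrite in_itv /= => /andP[xq qs].
    by exists q => //; rewrite qs /= in_itv.
  by case: ifP => //= qs; rewrite !in_itv /= => xq; exact: lt_trans qs.
apply: (@bigcupT_measurable_rat _ (g_sigma_algebraType Iio_rat)) => q.
by case: ifP => // _; apply: sub_sigma_algebra; exists q.
Qed.

Lemma Iio_ratI : setI_closed Iio_rat.
Proof.
move=> _ _ [p ->] [q ->]; have [pq|qp] := leP p q.
  exists p; apply/seteqP; split => x /=; rewrite !in_itv /=; first by case.
  by move=> xp; split => //; apply: lt_le_trans xp _; rewrite ler_rat.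
exists q; apply/seteqP; split => x /=; rewrite !in_itv /=; first by case.
by move=> xq; split => //; apply: lt_trans xq _; rewrite ltr_rat.
Qed.

Lemma mpres_Iio_rat (H : R -> R) : measurable_fun setT H ->
  (forall q : rat, Ex U (fun y => \1_`]-oo, ratr q[%classic (H y)) = Ex U \1_`]-oo, ratr q[%classic) ->
  mpres U U H.
Proof.
move=> mH h; have lH := mpres_law U mH; apply: mpres_Ex => // A mA.
have bA : bdm (\1_A : R -> R) by exact: bdm_indic.
rewrite (Ex_mpres lH bA); apply: (eq_probability_Ex Iio_ratE Iio_ratI) bA => _ [q ->].
have mq : measurable (`]-oo, ratr q[%classic : set R) by exact: measurable_itv.
rewrite -Ex_indic// -[RHS]Ex_indic//; congr (_%:E).
by rewrite -h -(Ex_mpres lH (bdm_indic R mq)).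
Qed.

End rational_thresholds.

Lemma ae_exists (R : realType) d (T : measurableType d) (P : probability T R) (Q : T -> Prop) :
  {ae P, forall x, Q x} -> exists x, Q x.
Proof.
move=> [A [mA A0 QA]]; apply: contrapT => nQ.
have AT : A = setT by apply/seteqP; split => // x _; apply: QA => Qx; apply: nQ; exists x.
by move: A0; rewrite AT probability_setT => /eqP; rewrite onee_eq0.
Qed.

Section place.
Context (R : realType) (d : nat).
Local Notation J := (r 'I_d).
Local Notation K := (option {fset nat}).
Local Notation Om := (Omega R site).
Local Notation P := (iid R site).
Local Notation U := (unif R).

Definition nat_set (A : J) : {fset nat} := [fset val i | i in enum (val A)]%fset.

Lemma nat_setP (A : J) (x : nat) : reflect (exists2 i : 'I_d, i \in val A & x = i) (x \in nat_set A).
Proof.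
apply: (iffP (imfsetP _ _ _ _)) => -[i /=]; rewrite ?mem_enum => iA ->; exists i => //=.
by rewrite mem_enum.
Qed.

Lemma in_nat_set (A : J) (i : 'I_d) : (nat_of_ord i \in nat_set A) = (i \in val A).
Proof. by apply/nat_setP/idP => [[j jA /val_inj ->]|iA]//; exists i. Qed.

Lemma nat_set_inj : injective nat_set.
Proof.
by move=> A B AB; apply: val_inj; apply/finset.setP => i; rewrite -!in_nat_set AB.
Qed.

Definition as_face (A : {fset nat}) : option J := [pick B | nat_set B == A].

Lemma nat_setK : pcancel nat_set as_face.
Proof.
by move=> A; rewrite /as_face; case: pickP => [B /eqP/nat_set_inj ->//|/(_ A)]; rewrite eqxx.
Qed.

Lemma as_faceK A B : as_face A = Some B -> nat_set B = A.
Proof. by rewrite /as_face; case: pickP => // C /eqP <- [->]. Qed.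

Lemma as_face_None A : (A `<=` iset d)%fset -> as_face A = None -> A = fset0.
Proof.
move=> /fsubsetP Ad; rewrite /as_face; case: pickP => // nA _.
apply/eqP; apply: contraT => /fset0Pn[x xA].
have xd : (x < d)%N by have := Ad _ xA; rewrite in_iset.
have B0 : [set i : 'I_d | nat_of_ord i \in A]%SET != finset.set0.
  by apply/set0Pn; exists (Ordinal xd); rewrite inE.
pose B : J := Sub [set i : 'I_d | nat_of_ord i \in A]%SET B0.
have := nA B; move/negbT/negP; case; apply/eqP/fsetP => y.
apply/nat_setP/idP => [[i]|yA]; first by rewrite SubK inE => iA ->.
have yd : (y < d)%N by have := Ad _ yA; rewrite in_iset.
by exists (Ordinal yd) => //; rewrite SubK inE.
Qed.

Definition digits (w : Omega R J) : Omega R (J * K)%type :=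
  fun p => rho (choice.pickle p.2) (w p.1).

(** Sites whose free part is a nonempty subset of [d] are taken from [v], all others from the fixed
    point [z]. Among the sites with free part inside [d], only those with empty free part come from
    [z]. *)
Definition place (z : Om) (v : Omega R (J * K)%type) : Om := fun a =>
  if as_face a.1 is Some B then v (B, a.2) else z a.

Lemma measurable_place z : measurable_fun setT (place z).
Proof.
apply: measurable_Omega => a; rewrite /place.
by case: (as_face a.1) => [B|]; [exact: measurable_coord|exact: measurable_cst].
Qed.

Lemma mpres_dig : mpres (iid R J) (iid R (J * K)%type) digits.
Proof. exact: mpres_digits. Qed.

Lemma mpres_faces : mpres P (iid R (J * K)%type) (fun u => u \o (fun p : J * K => (nat_set p.1, p.2))).
Proof. by apply: mpres_relabel => -[A k] [B l] [/nat_set_inj -> ->]. Qed.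

Lemma measurable_place_digits z : measurable_fun setT (fun w => place z (digits w)).
Proof. by have [m _] := mpres_dig; exact: measurableT_comp (@measurable_place z) m. Qed.

Lemma Ex_place (H : Omega R (J * K)%type -> R) : bdm H ->
  Ex P (fun u => H (u \o (fun p : J * K => (nat_set p.1, p.2)))) = Ex (iid R J) (fun w => H (digits w)).
Proof. by move=> bH; rewrite (Ex_mpres mpres_faces bH) -(Ex_mpres mpres_dig bH). Qed.

Lemma condE_place F z : bdm F ->
  condE (fun a : site => ~~ as_face a.1) F z = Ex (iid R J) (fun w => F (place z (digits w))).
Proof.
move=> bF; have bH : bdm (fun v => F (place z v)) by exact: bdm_comp (@measurable_place z) bF.
rewrite -(Ex_place bH); apply: eq_Ex => w'; congr F; apply/funext => -[A k].
rewrite /splice /place /=; case e: (as_face A) => [B|] //=.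
by rewrite (as_faceK e).
Qed.

(** Resampling the sites over faces of [d] amounts to replacing them by independent digits, so this
    is Fubini for null sets in the form of [ae_condE_null]. *)
Lemma ae_place (Q : Om -> Prop) : {ae P, forall u, Q u} ->
  {ae P, forall z, {ae iid R J, forall w, Q (place z (digits w))}}.
Proof.
move=> [Z [mZ Z0 QZ]]; have bZ : bdm (\1_Z : Om -> R) by exact: bdm_indic.
apply: filterS (ae_condE_null (fun a : site => ~~ as_face a.1) mZ Z0) => z.
rewrite condE_place// => e.
have mZ' : measurable ((fun w => place z (digits w)) @^-1` Z).
  by have := @measurable_place_digits z measurableT Z mZ; rewrite setTI.
exists ((fun w => place z (digits w)) @^-1` Z); split => //.
  by rewrite -Ex_indic//; congr (_%:E); rewrite -[RHS]e; apply: eq_Ex => w; rewrite !indicE.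
by move=> w nQ; exact: QZ.
Qed.

Section top.
Hypothesis d_gt0 : (0 < d)%N.
Local Notation top := (rtop d_gt0).

Lemma nat_set_top : nat_set top = iset d.
Proof.
apply/fsetP => x; rewrite in_iset; apply/nat_setP/idP => [[i _ ->]|xd]; first exact: ltn_ord.
by exists (Ordinal xd); rewrite //= inE.
Qed.

Lemma condE_place_top F z w : bdm F ->
  condE (fun a : site => a.1 != iset d) F (place z (digits w)) =
  Ex U (fun y => F (place z (digits (set_top d_gt0 w y)))).
Proof.
move=> bF.
pose S : pred (J * K) := fun p => p.1 != top.
have bH : bdm (fun v => F (place z (splice S (digits w) v))).
  apply: (bdm_comp (phi := fun v => place z (splice S (digits w) v)) _ bF).
  exact: measurableT_comp (@measurable_place z) (measurable_splicer S (digits w)).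
have bFd : bdm (fun w => F (place z (digits w))).
  exact: (bdm_comp (@measurable_place_digits z) bF).
rewrite -(condE_top d_gt0 w bFd) /condE.
transitivity (Ex P (fun u => F (place z (splice S (digits w)
    (u \o (fun p : J * K => (nat_set p.1, p.2))))))).
  apply: eq_Ex => u; congr F; apply/funext => -[A k].
  rewrite /splice /place /S /=; have [->|nA] := eqVneq A (iset d).
    by rewrite -nat_set_top nat_setK eqxx.
  case e: (as_face A) => [B|] //=; case: eqVneq => // BT.
  by move: nA; rewrite -(as_faceK e) BT nat_set_top eqxx.
rewrite (Ex_place bH); apply: eq_Ex => w'; congr (F (place z _)); apply/funext => p.
by rewrite /splice /digits /S /=; case: ifP.
Qed.

(** Given all other blocks, each rational half-line has the right conditional probability by
    [level_condE]. The outer [rho] picks the digits of the empty reference part and preserves the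
    uniform law. *)
Lemma ae_place_mpres g : level d g ->
  {ae P, forall z, {ae iid R J, forall w,
    mpres U U (fun y => rho (choice.pickle (fset0 : {fset nat}))
      (g (place z (digits (set_top d_gt0 w y)))))}}.
Proof.
move=> hg.
have mg := level_measurable hg.
have bq (q : rat) : bdm (\1_`]-oo, (ratr q : R)[%classic : R -> R).
  by apply: bdm_indic; exact: measurable_itv.
have bgq q : bdm (fun u => \1_`]-oo, (ratr q : R)[%classic (g u) : R) by exact: (bdm_comp mg (bq q)).
have : {ae P, forall u, forall q : rat,
    condE (fun a : site => a.1 != iset d) (fun u => \1_`]-oo, (ratr q : R)[%classic (g u)) u =
    Ex U \1_`]-oo, ratr q[%classic}.
  apply: ae_countable => q.
  have := Ex_sqr_eq0_ae (bdmB (bdm_condE _ (bgq q)) (bdm_cst _ _)) (level_condE hg (bq q)).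
  by apply: filterS => u /eqP; rewrite subr_eq0 => /eqP.
move=> /ae_place; apply: filterS => z; apply: filterS => w h.
have mr : mpres U U (@rho R (choice.pickle (fset0 : {fset nat}))).
  exact: (mpres_comp (mpres_rho R {fset nat}) (mpres_coord R (fset0 : {fset nat}))).
apply: (mpres_comp (phi := fun y => g (place z (digits (set_top d_gt0 w y)))) _ mr).
apply: mpres_Iio_rat => [|q].
  apply: (measurableT_comp mg); apply: (measurableT_comp (@measurable_place_digits z)).
  exact: measurable_set_top.
by rewrite -h condE_place_top.
Qed.

End top.

End place.

Section place_relabel.
Context (R : realType) (d e : nat) (s : 'I_e -> 'I_d) (inj_s : injective s).

Definition extend_nat (n : nat) : nat := if insub n is Some i then s i else n.

Lemma extend_natE (i : 'I_e) : extend_nat i = s i.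
Proof. by rewrite /extend_nat insubT // => ie; congr (s _ : nat); exact: val_inj. Qed.

Lemma extend_nat_inj : {in iset e &, injective extend_nat}.
Proof.
move=> m n; rewrite !in_iset => me ne.
rewrite (extend_natE (Ordinal me)) (extend_natE (Ordinal ne)) => /val_inj/inj_s.
by move=> /(congr1 val).
Qed.

Lemma extend_nat_set (A : r 'I_e) : (extend_nat @` nat_set A)%fset = nat_set (imset_r s A).
Proof.
apply/fsetP => x; apply/imfsetP/nat_setP => /= [[_ /nat_setP[i iA ->] ->]|[_ /imsetP[i iA ->] ->]].
  by exists (s i); rewrite ?imset_f// extend_natE.
by exists (nat_of_ord i); rewrite ?in_nat_set// extend_natE.
Qed.

(** A subset of [iset e] is either a face, moved along [s], or empty; in the latter case both sides
    read [z]. *)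
Lemma place_imset (z : Omega R site) w (a : site) : (a.1 `<=` iset e)%fset ->
  place z (digits (w \o imset_r s)) a = relabel extend_nat (place z (digits w)) a.
Proof.
case: a => A k /= Ae; rewrite /relabel /mapsite /place /=.
case eA: (as_face e A) => [B|]; first by rewrite -(as_faceK eA) extend_nat_set nat_setK.
rewrite (as_face_None Ae eA) imfset0.
rewrite /as_face; case: pickP => // B /eqP B0.
by case/set0Pn: (valP B) => i; rewrite -in_nat_set B0.
Qed.

End place_relabel.

(** * From levels to families of symmetric functions *)

Section fix_top.
Context (R : realType) (d : nat) (d_gt0 : (0 < d)%N) (G : Omega R (r 'I_d) -> R).
Local Notation I := (r 'I_d).
Local Notation U := (unif R).
Hypothesis mG : measurable_fun setT G.
Hypothesis G01 : forall w, 0 <= G w <= 1.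
Hypothesis Gsym : forall (s : {perm 'I_d}) w, G (w \o imset_r s) = G w.
Hypothesis Gmp : {ae iid R I, forall w, mpres U U (fun y => G (set_top d_gt0 w y))}.

(* [G] may fail to be measure preserving in the top coordinate on a null set of
   fibres; there it is replaced by the top coordinate itself. *)
Definition fix_top (x : E R 'I_d) : {i01 R} :=
  if pselect (mpres U U (fun y => G (set_top d_gt0 (cnum x) y)))
  then Itv01 (proj1 (andP (G01 (cnum x)))) (proj2 (andP (G01 (cnum x))))
  else x (rtop d_gt0).

Lemma fix_top_ae : ae_cube (fun x => (fix_top x)%:num = G (cnum x)).
Proof.
by apply: ae_cubeW (ae_iid_cube Gmp) => x h; rewrite /fix_top; case: pselect.
Qed.

Lemma imset_r_top (s : {perm 'I_d}) : imset_r s (rtop d_gt0) = rtop d_gt0.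
Proof.
apply: val_inj; apply/finset.setP => i /=; rewrite inE; apply/imsetP.
by exists ((s^-1)%g i); rewrite ?inE// permKV.
Qed.

Lemma set_top_imset (s : {perm 'I_d}) (w : Omega R I) y :
  set_top d_gt0 (w \o imset_r s) y = set_top d_gt0 w y \o imset_r s.
Proof.
apply/funext => B; rewrite /set_top /= -{2}(imset_r_top s).
by rewrite (inj_eq (imset_r_inj (@perm_inj _ s))).
Qed.

Lemma symmetric_fix_top : symmetric_fun fix_top.
Proof.
move=> s x; rewrite /fix_top cnum_pullback.
have -> : (fun y => G (set_top d_gt0 (cnum x \o imset_r s) y)) =
    (fun y => G (set_top d_gt0 (cnum x) y)).
  by apply/funext => y; rewrite set_top_imset Gsym.
case: pselect => h; last by rewrite /pullback imset_r_top.
by apply: val_inj => /=; rewrite Gsym.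
Qed.

Lemma mp_fix_top : mp_highest_order fix_top.
Proof.
split; first exact: measurable_to_i01_borel mG fix_top_ae.
move=> xs; pose w := cnum (E_pair xs (point : {i01 R})).
have xE (y : {i01 R}) : cnum (E_pair xs y) = set_top d_gt0 w y%:num.
  by apply: cnum_E_pair => B; rewrite /w /cnum /E_pair valK.
have set_set y y' : set_top d_gt0 (set_top d_gt0 w y) y' = set_top d_gt0 w y'.
  by apply/funext => B; rewrite /set_top; case: eqP.
(* The test in [fix_top] ignores the top coordinate, so one alternative holds along the whole
   fibre. *)
have [h|nh] := pselect (mpres U U (fun y => G (set_top d_gt0 w y))).
  apply: (measure_preserving_i01_borel h) => y; rewrite /fix_top xE.
  case: pselect => [_ //|]; case; rewrite (_ : (fun _ => _) = (fun y => G (set_top d_gt0 w y)))//.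
  by apply/funext => y'; rewrite set_set.
apply: (measure_preserving_i01_borel (H := id)) => [|y]; first by split.
rewrite /fix_top xE; case: pselect => [h|h].
  case: nh; move: h; rewrite (_ : (fun _ => _) = (fun y => G (set_top d_gt0 w y)))//.
  by apply/funext => y'; rewrite set_set.
by have := congr1 (fun v => v (rtop d_gt0)) (xE y); rewrite /cnum /set_top eqxx.
Qed.

End fix_top.

Section family_of.
Context (R : realType) (k : nat) (G : forall d, Omega R (r 'I_d) -> R).
Hypothesis G01 : forall d, (0 < d)%N -> forall w, 0 <= @G d w <= 1.

Definition family_of : fun_family R := fun d x =>
  if pselect (0 < d)%N is left d_gt0 then fix_top d_gt0 (@G01 d d_gt0) x else point.

Lemma family_ofP : (forall d, measurable_fun setT (@G d)) ->
  (forall d, (0 < d)%N -> forall (s : {perm 'I_d}) w, G (w \o imset_r s) = G w) ->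
  (forall d (d_gt0 : (0 < d)%N), {ae iid R (r 'I_d), forall w,
    mpres (unif R) (unif R) (fun y => G (set_top d_gt0 w y))}) ->
  good_family k family_of /\ forall d, (0 < d <= k)%N ->
    ae_cube (fun x : E R 'I_d => (family_of x)%:num = G (cnum x)).
Proof.
move=> mG Gsym Gmp; split=> d /andP[d0 _]; rewrite /family_of;
  (case: (pselect (0 < d)%N) => [h|]; last by rewrite d0).
  split; last exact: (mp_fix_top (mG d) (@G01 d h) (Gmp d h)).
  exact: (symmetric_fix_top h (@G01 d h) (Gsym d h)).
exact: (fix_top_ae (@G01 d h) (Gmp d h)).
Qed.

End family_of.

Section level_place.
Context (R : realType) (z : Omega R site).

Lemma level_place (d e : nat) (g : Omega R site -> R) (s : 'I_e -> 'I_d)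
    (t : nat -> nat) (w : Omega R (r 'I_d)) : level e g -> injective s -> injective t ->
  (t @` iset e)%fset = (extend_nat s @` iset e)%fset ->
  g (place z (digits (w \o imset_r s))) = g (relabel t (place z (digits w))).
Proof.
move=> hg injs injt st.
transitivity (g (relabel (extend_nat s) (place z (digits w)))).
  by apply: (level_dep hg) => a ae; exact: place_imset.
apply: (level_sym hg) => //; first exact: extend_nat_inj.
by move=> x y _ _ /injt.
Qed.

Lemma incr_enum_inj d (A : {set 'I_d}) : injective (@incr_enum d A).
Proof. by move=> i j; exact: enum_val_inj. Qed.

Lemma incr_enum_iset d (A : r 'I_d) :
  (extend_nat (@incr_enum d (val A)) @` iset #|val A|)%fset = nat_set A.
Proof.
have A0 := card_r_gt0 A.
rewrite -(nat_set_top A0) extend_nat_set.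
by congr nat_set; apply: val_inj; exact: imset_enum_val.
Qed.

Lemma card_nat_set d (A : r 'I_d) : #|` nat_set A| = #|val A|.
Proof.
rewrite -incr_enum_iset card_in_imfset /= ?card_iset//.
by apply: extend_nat_inj; exact: incr_enum_inj.
Qed.

Lemma level_place_face d (g : nat -> Omega R site -> R) (A : r 'I_d) (w : Omega R (r 'I_d)) :
  (forall e, level e (g e)) ->
  g #|val A| (place z (digits (w \o imset_r (@incr_enum d (val A))))) =
  assemble g (place z (digits w)) (nat_set A).
Proof.
move=> hg; rewrite /assemble card_nat_set; apply: level_place => //.
- exact: incr_enum_inj.
- exact: sigma_inj.
- by rewrite incr_enum_iset -card_nat_set sigma_iset.
Qed.

Lemma level_place_perm d (g : Omega R site -> R) (s : {perm 'I_d}) (w : Omega R (r 'I_d)) :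
  level d g -> (0 < d)%N -> g (place z (digits (w \o imset_r s))) = g (place z (digits w)).
Proof.
move=> hg d0; have idE (A : {fset nat}) : (id @` A)%fset = A.
  by apply/fsetP => x; apply/imfsetP/idP => /= [[y yA ->]|xA] //; exists x.
rewrite (level_place (t := id) w hg)//; last 2 first.
- exact: perm_inj.
- rewrite idE -(nat_set_top d0) extend_nat_set.
  by rewrite imset_r_top.
by congr g; apply/funext => -[A k]; rewrite /relabel /mapsite /= idE.
Qed.

End level_place.

Section hat_ae.
Context (R : realType) (k : nat) (f : fun_family R) (gf : good_family k f).

Lemma ae_cube_hat d (Q : E R 'I_d -> Prop) : (d <= k)%N ->
  ae_cube Q -> ae_cube (fun x => Q (hat f x)).
Proof.
move=> dk; have [F [mF fF]] := good_family_borel gf.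
move=> /(ae_cube_hat_on gf mF fF); apply: ae_cubeW => x.
have pid (y : E R 'I_d) : pullback id y = y.
  by apply/funext => A; congr y; apply: val_inj; rewrite /= imset_id.
by rewrite -[hat_on k f x]pid (pullback_hat_on gf)// pid.
Qed.

Lemma hat_borel_ae (F : forall d, Omega R (r 'I_d) -> R) d : (d <= k)%N ->
  (forall e, (0 < e <= k)%N -> ae_cube (fun x : E R 'I_e => (f x)%:num = F e (cnum x))) ->
  ae_cube (fun x : E R 'I_d => forall A : r 'I_d,
    cnum (hat f x) A = F #|val A| (cnum x \o imset_r (@incr_enum d (val A)))).
Proof.
move=> dk fF; apply: ae_cube_all => A.
have d0 : (0 < #|val A| <= k)%N.
  by rewrite card_r_gt0 /=; apply: leq_trans dk; rewrite -[leqRHS](card_ord d) max_card.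
exact: (ae_cubeW _ (ae_cube_pullback (@enum_val_inj _ (mem (val A))) (fF _ d0))).
Qed.

End hat_ae.

Section construction.
Context (R : realType) (L : language) (N N' : euclidean_structure R L).
Context (NB NB' : forall P : L, set (Omega R (r 'I_(arity P))))
  (mNB : forall P, measurable (@NB P)) (mNB' : forall P, measurable (@NB' P)).
Arguments NB : clear implicits.
Arguments NB' : clear implicits.
Hypothesis NNB : forall P, ae_cube (fun x : E R 'I_(arity P) => N P x <-> NB P (cnum x)).
Hypothesis NNB' : forall P, ae_cube (fun x : E R 'I_(arity P) => N' P x <-> NB' P (cnum x)).
Local Notation U := (unif R).
Local Notation k := (max_arity L).

Definition free_atom (P : L) : atom L vertex :=
  Tagged (fun P : L => (arity P).-tuple vertex) [tuple (inl (val i) : vertex) | i < arity P].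

Lemma uniq_free_atom P : uniq (supp (free_atom P)).
Proof. by rewrite map_inj_uniq ?enum_uniq// => i j [] /val_inj. Qed.

Lemma atom_free_free_atom P : atom_free (free_atom P) = iset (arity P).
Proof.
apply/fsetP => x; rewrite in_atom_free in_iset; apply/mapP/idP => [[i _ [->]]|xP] /=.
  exact: ltn_ord.
by exists (Ordinal xP); rewrite ?mem_enum.
Qed.

Lemma face_free_atom P (A : r 'I_(arity P)) :
  freepart (face (tagged (free_atom P)) A) = nat_set A /\
  refpart (face (tagged (free_atom P)) A) = fset0.
Proof.
have tE i : tnth (tagged (free_atom P)) i = inl (val i) by exact: tnth_mktuple.
split; apply/fsetP => x.
  rewrite in_freepart; apply/faceP/nat_setP => -[i iA].
    by rewrite tE => -[->]; exists i.
  by move=> ->; exists i; rewrite ?tE.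
rewrite in_refpart in_fset0; apply/negbTE/negP => /faceP[i _].
by rewrite tE.
Qed.

Context (g : nat -> Omega R site -> R) (hg : forall e, level e (g e)) (z : Omega R site).
Hypothesis zmp : forall d (d_gt0 : (0 < d)%N), {ae iid R (r 'I_d), forall w,
  mpres U U (fun y => rho (choice.pickle (fset0 : {fset nat}))
    (g d (place z (digits (set_top d_gt0 w y)))))}.
Hypothesis zbits : forall P : L, {ae iid R (r 'I_(arity P)), forall w,
  bits NB (sample (place z (digits w))) (free_atom P) =
  bits NB' (decode_sets (assemble g (place z (digits w)))) (free_atom P)}.

(** [G1] and [G2] give, on the two sides, the coordinate of [iset d] with empty reference part;
    atoms without reference vertices read only coordinates of this kind. *)
Let G1 d (w : Omega R (r 'I_d)) : R := place z (digits w) (iset d, Some fset0).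
Let G2 d (w : Omega R (r 'I_d)) : R :=
  rho (choice.pickle (fset0 : {fset nat})) (g d (place z (digits w))).

Let place_top d (d_gt0 : (0 < d)%N) (w : Omega R (r 'I_d)) :
  @G1 d w = rho (choice.pickle (Some (fset0 : {fset nat}))) (w (rtop d_gt0)).
Proof. by rewrite /G1 -(nat_set_top d_gt0) /place /= nat_setK. Qed.

Let G1_01 d (d_gt0 : (0 < d)%N) w : 0 <= @G1 d w <= 1.
Proof. by rewrite (place_top d_gt0) rho01. Qed.

Let G2_01 d (d_gt0 : (0 < d)%N) w : 0 <= @G2 d w <= 1.
Proof. exact: rho01. Qed.

Let f := family_of G1_01.
Let f' := family_of G2_01.

Let f_spec : good_family k f /\ forall e, (0 < e <= k)%N ->
  ae_cube (fun x : E R 'I_e => (f x)%:num = @G1 e (cnum x)).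
Proof.
apply: family_ofP => [d|d d_gt0 s w|d d_gt0].
- have := measurableT_comp (@measurable_coord R site (iset d, Some fset0)) (@measurable_place_digits R d z).
  exact.
- by rewrite !(place_top d_gt0) /= imset_r_top.
- apply: aeW => w; rewrite (_ : (fun _ => _) = @rho R (choice.pickle (Some (fset0 : {fset nat})))).
    exact: (mpres_comp (mpres_rho R (option {fset nat})) (mpres_coord R (Some (fset0 : {fset nat})))).
  by apply/funext => y; rewrite (place_top d_gt0) /set_top eqxx.
Qed.

Let f'_spec : good_family k f' /\ forall e, (0 < e <= k)%N ->
  ae_cube (fun x : E R 'I_e => (f' x)%:num = @G2 e (cnum x)).
Proof.
apply: family_ofP => [d|d d_gt0 s w|d d_gt0]; last exact: zmp.
- apply: (measurableT_comp (@measurable_rho R _)).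
  exact: (measurableT_comp (level_measurable (hg d)) (@measurable_place_digits R d z)).
- congr (rho _ _).
  by apply: level_place_perm.
Qed.

Let G1_face d (A : r 'I_d) (w : Omega R (r 'I_d)) :
  @G1 #|val A| (w \o imset_r (@incr_enum d (val A))) = place z (digits w) (nat_set A, Some fset0).
Proof.
rewrite /G1 place_imset ?fsubset_refl//.
by rewrite /relabel /mapsite /= incr_enum_iset.
Qed.

Let G2_face d (A : r 'I_d) (w : Omega R (r 'I_d)) :
  @G2 #|val A| (w \o imset_r (@incr_enum d (val A))) =
  rho (choice.pickle (fset0 : {fset nat})) (assemble g (place z (digits w)) (nat_set A)).
Proof. by congr (rho _ _); exact: level_place_face. Qed.

Let hat_bits P : ae_cube (fun x : E R 'I_(arity P) => (NB P (cnum (hat f x)) <-> NB' P (cnum (hat f' x)))).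
Proof.
have Pk : (arity P <= k)%N by exact: leq_bigmax.
have [_ fE] := f_spec; have [_ fE'] := f'_spec.
have h := ae_cube_and (hat_borel_ae Pk fE) (hat_borel_ae Pk fE').
apply: ae_cubeW (ae_cube_and h (ae_iid_cube (zbits P))) => x [[h1 h2]].
have bnat (b b' : bool) : b = b' :> nat -> b = b' by case: b; case: b'.
rewrite /bits uniq_free_atom /= => /eqP; rewrite eqr_nat => /eqP/bnat.
set u := place z _.
have -> : sample u \o face (tagged (free_atom P)) = cnum (hat f x).
  apply/funext => A; rewrite h1 G1_face /= /sample.
  by have [-> ->] := face_free_atom A.
have -> : decode_sets (assemble g u) \o face (tagged (free_atom P)) = cnum (hat f' x).
  apply/funext => A; rewrite h2 G2_face /= /decode_sets.
  by have [-> ->] := face_free_atom A.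
by move=> e; split => /asboolP; [rewrite e|rewrite -e] => /asboolP.
Qed.

Let measurable_hat P : cube_measurable [set x : E R 'I_(arity P) | N P (hat f x)].
Proof.
have Pk : (arity P <= k)%N by exact: leq_bigmax.
have [gf fE] := f_spec.
pose v (w : Omega R (r 'I_(arity P))) : Omega R (r 'I_(arity P)) :=
  fun A => @G1 #|val A| (w \o imset_r (@incr_enum _ (val A))).
have mv : measurable_fun setT v.
  apply: measurable_Omega => A; rewrite /v.
  under eq_fun do rewrite G1_face.
  exact: (measurableT_comp (@measurable_coord R site (nat_set A, Some fset0))
    (@measurable_place_digits R _ z)).
have mB : measurable (v @^-1` NB P) by have := mv measurableT _ (@mNB P); rewrite setTI.
apply: (cube_measurable_ae (cube_measurable_preimage mB)).
apply: ae_cubeW (ae_cube_and (ae_cube_hat gf Pk (@NNB P)) (hat_borel_ae Pk fE)) => x [h1 h2].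
by rewrite /= h1 (_ : v (cnum x) = cnum (hat f x))//; apply/funext => A; rewrite h2.
Qed.

Lemma exists_common_hat : exists (f f' : fun_family R) (N2 : euclidean_structure R L),
  [/\ good_family k f, good_family k f', (forall P (x : E R 'I_(arity P)), N2 P x <-> N P (hat f x)) &
    forall P, ae_cube (fun x : E R 'I_(arity P) => N P (hat f x) <-> N' P (hat f' x))].
Proof.
have [gf _] := f_spec; have [gf' _] := f'_spec.
exists f, f', (EuclideanStructure measurable_hat); split => // P.
have Pk : (arity P <= k)%N by exact: leq_bigmax.
have h := ae_cube_and (ae_cube_hat gf Pk (@NNB P)) (ae_cube_hat gf' Pk (@NNB' P)).
by apply: ae_cubeW (ae_cube_and (hat_bits P) h) => x [h0 [-> ->]].
Qed.

End construction.

Lemma ae_cubeT (R : realType) (I : finType) (Q : cube R I -> Prop) : (forall x, Q x) -> ae_cube Q.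
Proof. by move=> h; apply/ae_cubeP; exists set0; split. Qed.

(** Countably many almost sure conditions hold together at some point [z]. The successor in
    [(max_arity L).+1] is there because [agree] bounds the number of free vertices strictly. *)
Lemma exists_seed (R : realType) (L : language)
    (NB NB' : forall P : L, set (Omega R (r 'I_(arity P)))) (g : nat -> Omega R site -> R) :
  (forall e, level e (g e)) -> agree NB NB' g (max_arity L).+1 ->
  exists z : Omega R site,
    (forall d (d_gt0 : (0 < d)%N), {ae iid R (r 'I_d), forall w,
      mpres (unif R) (unif R) (fun y => rho (choice.pickle (fset0 : {fset nat}))
        (g d (place z (digits (set_top d_gt0 w y)))))}) /\
    forall P : L, {ae iid R (r 'I_(arity P)), forall w,
      bits NB (sample (place z (digits w))) (free_atom P) =
      bits NB' (decode_sets (assemble g (place z (digits w)))) (free_atom P)}.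
Proof.
move=> hg ag; apply: (@ae_exists _ _ _ (iid R site)); apply: filterI.
  apply: ae_countable => d.
  have [d0|d0] := pselect (is_true (0 < d)%N); last by apply: aeW => z d_gt0; case: (d0 d_gt0).
  apply: filterS (ae_place_mpres d0 (hg d)) => z h d_gt0.
  have -> // : d_gt0 = d0 by exact: bool_irrelevance.
apply: ae_countable => P.
have lP : (#|` atom_free (free_atom P)| < (max_arity L).+1)%N.
  by rewrite atom_free_free_atom card_iset ltnS leq_bigmax.
exact: (@ae_place R (arity P) _ (ag _ lP)).
Qed.

Theorem theorem3p16 (R : realType) (L : language) (T : universal_theory L)
    (hT : canonical_theory T) (N N' : euclidean_structure R L)
    (hN : weak_on T N) (hN' : weak_on T N') :
  (forall (V : finType) (M : structure_on L V),
      is_model T M -> density M N = density M N') <->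
  (exists (f g : fun_family R) (N'' : euclidean_structure R L),
      [/\ good_family (max_arity L) f,
          good_family (max_arity L) g,
          weak_on T N'' &
          forall P : L, ae_cube (fun x : E R 'I_(arity P) =>
            (N'' P x <-> N P (hat f x)) /\
            (N P (hat f x) <-> N' P (hat g x)))]).
Proof.
split=> [h|[f [g [N2 [gf gg _ h]]]] V M mM]; last first.
  (* Both measures are compared with that of [N2], through [f] for [N] and through [g] for [N']. *)
  rewrite /density -(lebesgue_Tind_hat gf (N := N) (N2 := N2)) => [|P].
    rewrite -(lebesgue_Tind_hat gg (N := N') (N2 := N2))// => P.
    by apply: ae_cubeW (h P) => x [-> ->].
  by apply: ae_cubeW (h P) => x [].
have [NB [mNB NNB]] := euclidean_borel N.
have [NB' [mNB' NNB']] := euclidean_borel N'.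
have same_Tind (V : finType) (M : structure_on L V) : canonical_structure M ->
    iid R (r V) (Tind_borel NB M) = iid R (r V) (Tind_borel NB' M).
  move=> cM; rewrite -(lebesgue_Tind mNB NNB) -(lebesgue_Tind mNB' NNB').
  exact: (lebesgue_Tind_weak_on hN hN' h).
have [g [hg ag]] := agreeing_levels mNB mNB' (Ex_bits mNB mNB' same_Tind (W := vertex))
  (max_arity L).+1.
have [z [zmp zbits]] := exists_seed hg ag.
have [f [f' [N2 [gf gf' N2E fE]]]] := exists_common_hat mNB NNB NNB' hg zmp zbits.
exists f, f', N2; split => // [V M cM nM|P]; last first.
  by apply: ae_cubeW (fE P) => x e; split=> //; exact: N2E.
(* [N2] is a weak T-on because its events have the same measures as those of [N]. *)
rewrite (lebesgue_Tind_hat gf (N := N))// => [|P]; first exact: hN.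
by apply: ae_cubeT => x; exact: N2E.
Qed.
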